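(* Let $n\ge 1$ and let $\Phi\in\mathcal{Y}$ be a Young's function. (a) (Semigroups) (i) $S(t)$ is a semigroup on $L^{\Phi}$ satisfying $\|S(t)\varphi\|_{\Phi}\le 2\|\varphi\|_{\Phi}$ for all $\varphi\in L^{\Phi}$ and $t\ge 0$. (ii) For all $\varphi\in L_0^{\Phi}$, $\|S(t)\varphi-\varphi\|_{\Phi}\to 0$ as $t\to 0$. (iii) If $\Phi\in\mathcal{N}$ then $S(t)$ is a $C_0$-semigroup on $M^{\Phi}$ satisfying $\|S(t)\varphi\|_{\Phi}\le 2\|\varphi\|_{\Phi}$ for all $\varphi\in M^{\Phi}$ and $t\ge 0$. (b) (Smoothing) Let $\Psi\in\mathcal{Y}$ and suppose there exist $\beta\in(0,1)$ and $\Theta\in\mathcal{Y}$ such that $$\beta x\Psi^{-1}(x)\le \Phi^{-1}(x)\Theta^{-1}(x)\le x\Psi^{-1}(x),\qquad x\ge 0.$$ (i) For all $t>0$, $S(t):L^{\Phi}\to L^{\Psi}$ is a bounded linear operator and there exists a constant $\mathscr{C}=\mathscr{C}(n,\Phi,\Psi)>0$ such that for all $\varphi\in L^{\Phi}$ and $t>0$, $$\|S(t)\varphi\|_{\Psi}\le \mathscr{C}\,\frac{\Phi^{-1}(t^{-n/2})}{\Psi^{-1}(t^{-n/2})}\,\|\varphi\|_{\Phi}.$$ (ii) If $\displaystyle\lim_{s\to\infty}\frac{\Psi^{-1}(s)}{\Phi^{-1}(s)}=0$ then $$\lim_{t\to 0}\left[\frac{\Psi^{-1}(t^{-n/2})}{\Phi^{-1}(t^{-n/2})}\|S(t)\varphi\|_{\Psi}\right]=0,$$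 uniformly for $\varphi$ in compact subsets of $L_0^{\Phi}$.
   Context: ''Increasing'' means nondecreasing. A (nontrivial) Young's function is a map $\Phi:[0,\infty]\to[0,\infty]$ with $\Phi(0)=0$ such that either (I) $\Phi$ is convex, increasing, finite-valued and not identically zero on $[0,\infty)$; or (II) there is $x_\infty^{\Phi}>0$ such that $\Phi$ is convex, increasing and finite-valued on $[0,x_\infty^{\Phi}]$ and $\Phi(x)=\infty$ for $x>x_\infty^{\Phi}$; or (III) there is $x_\infty^{\Phi}>0$ such that $\Phi$ is convex, increasing and finite-valued on $[0,x_\infty^{\Phi})$, $\lim_{x\uparrow x_\infty^{\Phi}}\Phi(x)=\infty$ and $\Phi(x)=\infty$ for $x\ge x_\infty^{\Phi}$. The set of Young's functions is $\mathcal{Y}$. $\Phi\in\mathcal{Y}$ is finite if it satisfies (I), and positive if $\Phi>0$ on $(0,\infty)$. $\Phi\in\mathcal{Y}$ is an $N$-function ($\Phi\in\mathcal{N}$) if it is finite, positive, and $\lim_{x\to0}\Phi(x)/x=\lim_{x\to\infty}x/\Phi(x)=0$. The generalised inverse is $\Phi^{-1}(y)=\inf\{x>0:\Phi(x)>y\}$, with $\inf\emptyset=\infty$. All function spaces are over $\mathbb{R}^n$ and consist of Lebesgue measurable real-valued functions (identified when equal a.e.). $L^{\Phi}$ is the set of measurable $u$ with $\int_{\mathbb{R}^n}\Phi(|u(x)|/k)\,dx<\infty$ for some $k>0$, with the Luxemburg norm $\|u\|_{\Phi}=\inf\{k>0:\int_{\mathbb{R}^n}\Phi(|u(x)|/k)\,dx\le1\}$.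 $L_0^{\Phi}$ is the closure of $C_0^\infty(\mathbb{R}^n)$ (smooth compactly supported functions) in $L^{\Phi}$. $M^{\Phi}$ is the set of measurable $u$ with $\int_{\mathbb{R}^n}\Phi(|u(x)|/k)\,dx<\infty$ for all $k>0$, with the norm $\|\cdot\|_{\Phi}$. $S(t)$ is the heat semigroup: $[S(t)\varphi](x)=\int_{\mathbb{R}^n}G(x-y,t)\varphi(y)\,dy$ for $t>0$, where $G(x,t)=(4\pi t)^{-n/2}\exp(-|x|^2/(4t))$, and $S(0)$ is the identity. *)

(* Defs.v *)
From HB Require Import structures.
From mathcomp Require Import all_boot all_order all_algebra.
From mathcomp Require Import all_classical all_reals all_analysis.
Set Implicit Arguments.
Unset Strict Implicit.
Unset Printing Implicit Defensive.
Import Order.TTheory GRing.Theory Num.Theory.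
Import numFieldNormedType.Exports.
Local Open Scope classical_set_scope.
Local Open Scope ring_scope.

Definition rV_display : measure_display.
Proof. exact: default_measure_display. Qed.

Section borel_rV.
Context {R : realType} (n : nat).

Let coor (i : 'I_n) (x : 'rV[R]_n) : R := x 0 i.

Let rV_set0 : g_sigma_preimage coor set0.
Proof. exact: sigma_algebra0. Qed.

Let rV_setC A : g_sigma_preimage coor A -> g_sigma_preimage coor (~` A).
Proof. exact: sigma_algebraC. Qed.

Let rV_bigcup (F : (set 'rV[R]_n)^nat) :
  (forall i, g_sigma_preimage coor (F i)) ->
  g_sigma_preimage coor (\bigcup_i F i).
Proof. exact: sigma_algebra_bigcup. Qed.

(* The Borel sigma-algebra of 'rV_n, as generated by the coordinate maps. *)
HB.instance Definition _ := @isMeasurable.Build rV_display 'rV[R]_n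
  (g_sigma_preimage coor) rV_set0 rV_setC rV_bigcup.

Lemma measurable_coor (i : 'I_n) :
  measurable_fun [set: 'rV[R]_n] (fun x : 'rV[R]_n => x 0 i).
Proof.
move=> _ Y mY; rewrite setTI; apply: sub_sigma_algebra => /=.
rewrite -bigcup_seq/=; exists i => /=; first by rewrite mem_index_enum.
by exists Y => //; rewrite setTI.
Qed.

Lemma measurable_fun_rV d (T : measurableType d) (f : T -> 'rV[R]_n) :
  (forall i, measurable_fun [set: T] (fun t => f t 0 i)) ->
  measurable_fun [set: T] f.
Proof.
move=> mf; suff : measurable `<=` [set A | measurable (f @^-1` A)].
  by move=> H _ A mA; rewrite setTI; exact: H.
apply: smallest_sub.
  split; first by rewrite /= preimage_set0; exact: measurable0.
  - move=> A mA; rewrite /= setTD preimage_setC.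
    exact: (measurableC mA).
  - by move=> F mF; rewrite /= preimage_bigcup; apply: bigcup_measurable => i _; exact: mF.
rewrite -bigcup_seq => A [i _] [B mB <-] /=; rewrite setTI.
by have := mf i measurableT B mB; rewrite setTI.
Qed.

End borel_rV.

Section lebesgue_rV.
Context {R : realType}.

Definition rV_cons n (p : measurableTypeR R * 'rV[R]_n) : 'rV[R]_n.+1 :=
  @row_mx R 1 1 n (const_mx p.1) p.2.

Lemma rV_cons0 n (p : measurableTypeR R * 'rV[R]_n) : rV_cons p 0 0 = p.1.
Proof.
transitivity (@row_mx R 1 1 n (const_mx p.1) p.2 0 (lshift n 0)).
  by congr (fun_of_matrix _ _ _); exact: val_inj.
by rewrite row_mxEl mxE.
Qed.

Lemma rV_consS n (p : measurableTypeR R * 'rV[R]_n) j :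
  rV_cons p 0 (lift ord0 j) = p.2 0 j.
Proof.
transitivity (@row_mx R 1 1 n (const_mx p.1) p.2 0 (rshift 1 j)).
  by congr (fun_of_matrix _ _ _); exact: val_inj.
by rewrite row_mxEr.
Qed.

Lemma measurable_rV_cons n : measurable_fun setT (@rV_cons n).
Proof.
apply: measurable_fun_rV => i; case: (unliftP ord0 i) => [j|] ->.
  rewrite (_ : (fun _ => _) = (fun x : 'rV[R]_n => x 0 j) \o snd).
    by apply: measurableT_comp; [exact: measurable_coor|exact: measurable_snd].
  by apply/funext => p; rewrite rV_consS.
rewrite (_ : (fun _ => _) = fst); first exact: measurable_fst.
by apply/funext => p; rewrite rV_cons0.
Qed.

Section step.
Variables (n : nat) (mu : {sigma_finite_measure set 'rV[R]_n -> \bar R}).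

Definition lebesgue_step : set 'rV[R]_n.+1 -> \bar R :=
  pushforward (lebesgue_measure \x mu)%E (@rV_cons n).

Let lebesgue_step0 : lebesgue_step set0 = 0%E.
Proof. by rewrite /lebesgue_step /pushforward preimage_set0 measure0. Qed.

Let lebesgue_step_ge0 A : (0 <= lebesgue_step A)%E.
Proof. by rewrite /lebesgue_step /pushforward measure_ge0. Qed.

Let lebesgue_step_sigma_additive : semi_sigma_additive lebesgue_step.
Proof.
move=> F mF tF mUF; rewrite /lebesgue_step /pushforward preimage_bigcup.
have mc A : measurable A -> measurable (@rV_cons n @^-1` A).
  by move=> mA; rewrite -[X in measurable X]setTI; exact: measurable_rV_cons.
apply: measure_semi_sigma_additive.
- by move=> i; exact: mc.
- apply/trivIsetP => /= i j _ _ ij; rewrite -preimage_setI.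
  by move/trivIsetP : tF => /(_ _ _ _ _ ij) ->//; rewrite preimage_set0.
- by rewrite -preimage_bigcup; exact: mc.
Qed.

HB.instance Definition _ := isMeasure.Build _ _ _ lebesgue_step
  lebesgue_step0 lebesgue_step_ge0 lebesgue_step_sigma_additive.

Let lebesgue_step_sigma_finite : sigma_finite setT lebesgue_step.
Proof.
have /sigma_finiteP[A [TA ndA Aoo]] := sigma_finiteT (@lebesgue_measure R).
have /sigma_finiteP[B [TB ndB Boo]] := sigma_finiteT mu.
pose f (x : 'rV[R]_n.+1) : measurableTypeR R * 'rV[R]_n :=
  (x 0 0, \row_j x 0 (lift ord0 j)).
have fK p : f (rV_cons p) = p.
  rewrite /f rV_cons0; case: p => a v; congr pair.
  by apply/rowP => j; rewrite mxE rV_consS.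
have mf : measurable_fun setT f.
  apply/measurable_fun_pair; first exact: measurable_coor.
  apply: measurable_fun_rV => j.
  rewrite (_ : (fun _ => _) = fun x : 'rV[R]_n.+1 => x 0 (lift ord0 j)).
    exact: measurable_coor.
  by apply/funext => x; rewrite mxE.
exists (fun k => f @^-1` (A k `*` B k)).
  rewrite -preimage_bigcup (_ : \bigcup_k _ = setT) ?preimage_setT//.
  rewrite -setXTT TA TB; apply/seteqP; split=> -[x y].
    by move=> [k _ [/= ? ?]]; split; exists k.
  move=> [/= [k _ Akx] [l _ Bly]]; exists (maxn k l) => //; split.
  - by move: x Akx; exact/subsetPset/ndA/leq_maxl.
  - by move: y Bly; exact/subsetPset/ndB/leq_maxr.
move=> k; have [mA Akoo] := Aoo k; have [mB Bkoo] := Boo k.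
have mAB : measurable (A k `*` B k) by exact: measurableX.
split; first by rewrite -[X in measurable X]setTI; exact: mf.
rewrite /lebesgue_step /pushforward (_ : _ @^-1` _ = A k `*` B k).
  by rewrite product_measure1E// lte_mul_pinfty// ge0_fin_numE.
by apply/seteqP; split => p; rewrite /preimage /mkset fK.
Qed.

HB.instance Definition _ := Measure_isSigmaFinite.Build _ _ _ lebesgue_step
  lebesgue_step_sigma_finite.

End step.

Fixpoint borel_lebesgue n : {sigma_finite_measure set 'rV[R]_n -> \bar R} :=
  match n with
  | 0 => \d_(0 : 'rV[R]_0)
  | m.+1 => lebesgue_step (borel_lebesgue m)
  end.

End lebesgue_rV.

Lemma borel_lebesgue_box (R : realType) n (A : 'I_n -> set (measurableTypeR R)) :
  (forall i, measurable (A i)) ->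
  borel_lebesgue n [set x : 'rV[R]_n | forall i, A i (x 0 i)] =
  (\prod_(i < n) lebesgue_measure (A i))%E.
Proof.
elim: n A => [|n IH] A mA; first by rewrite big_ord0 /= diracE mem_set//= => -[].
rewrite big_ord_recl -IH; last by move=> i; exact: mA.
rewrite /= /lebesgue_step /pushforward.
rewrite (_ : _ @^-1` _ = A ord0 `*`
    [set x : 'rV[R]_n | forall i, A (lift ord0 i) (x 0 i)]); last first.
  apply/seteqP; split => -[a v] /=.
    move=> H; split; first by have := H 0; rewrite rV_cons0.
    by move=> i; have := H (lift ord0 i); rewrite rV_consS.
  move=> [H0 H1] i; case: (unliftP ord0 i) => [j|] ->.
    by rewrite rV_consS; exact: H1.
  by rewrite rV_cons0.
rewrite product_measure1E//.
rewrite (_ : mkset _ = \bigcap_(i in [set: 'I_n])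
  ((fun x : 'rV[R]_n => x 0 i) @^-1` A (lift ord0 i))); last first.
  by apply/seteqP; split => x /= H i; [move=> _|]; exact: H.
apply: fin_bigcap_measurable => // i _.
have := @measurable_coor R n i measurableT _ (mA (lift ord0 i)).
by rewrite setTI.
Qed.

(* The measurable sets of [lebesgue_space] are the Caratheodory (that is,
   Lebesgue) measurable sets, and [leb] is the completion of [borel_lebesgue];
   the carrier is 'rV[R]_n. *)
Definition lebesgue_space (R : realType) (n : nat) :=
  caratheodory_type ((@borel_lebesgue R n)^*)%mu.

HB.instance Definition _ R n := Measurable.on (lebesgue_space R n).

Section leb.
Context {R : realType} (n : nat).

Definition leb : set (lebesgue_space R n) -> \bar R :=
  @completed_measure_extension _ _ _ (borel_lebesgue n).

HB.instance Definition _ := Measure.on leb.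

Let leb_sigma_finite : sigma_finite setT leb.
Proof. exact/completed_measure_extension_sigma_finite/sigma_finiteT. Qed.

HB.instance Definition _ := Measure_isSigmaFinite.Build _ _ _ leb
  leb_sigma_finite.

End leb.
Arguments leb {R} n.

Section young.
Context {R : realType}.
Implicit Types (Phi : \bar R -> \bar R) (D : set R).

Definition young_real Phi : R -> R := fun x => fine (Phi x%:E).

Definition convex_increasing_finite_on D Phi :=
  [/\ forall x, D x -> Phi x%:E \is a fin_num,
      convex_function D (young_real Phi)
    & {in D &, {homo young_real Phi : x y / x <= y}}].

Definition young_I Phi :=
  convex_increasing_finite_on `[0, +oo[ Phi /\
  exists2 x : R, 0 <= x & Phi x%:E != 0%E.

Definition young_II Phi := exists xoo : R,
  [/\ 0 < xoo, convex_increasing_finite_on `[0, xoo] Phi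
    & forall x, (xoo%:E < x -> Phi x = +oo)%E].

Definition young_III Phi := exists xoo : R,
  [/\ 0 < xoo, convex_increasing_finite_on `[0, xoo[ Phi,
      Phi x%:E @[x --> xoo^'-] --> +oo%E
    & forall x, (xoo%:E <= x -> Phi x = +oo)%E].

(* Young's functions map [0, +oo] to itself; their values at negative arguments
   are irrelevant. *)
Definition young Phi :=
  [/\ forall x, (0 <= x -> 0 <= Phi x)%E, Phi 0%E = 0%E
    & young_I Phi \/ young_II Phi \/ young_III Phi].

Definition young_finite Phi := young Phi /\ young_I Phi.

Definition young_positive Phi :=
  young Phi /\ forall x : R, 0 < x -> (0 < Phi x%:E)%E.

Definition N_function Phi :=
  [/\ young_finite Phi, young_positive Phi,
      (Phi x%:E / x%:E)%E @[x --> 0^'+] --> 0%E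
    & (x%:E / Phi x%:E)%E @[x --> +oo] --> 0%E].

Definition young_inv Phi (y : \bar R) : \bar R :=
  ereal_inf [set x | (0 < x)%E /\ (y < Phi x)%E].

End young.

Section orlicz.
Context {R : realType} (n : nat) (Phi : \bar R -> \bar R).
Implicit Types u : 'rV[R]_n -> R.

Definition modular u (k : R) : \bar R :=
  (\int[leb n]_x Phi (`|u x| / k)%:E)%E.

Definition luxemburg u : \bar R :=
  ereal_inf [set k%:E | k in [set k : R | 0 < k /\ (modular u k <= 1)%E]].

Definition L_orlicz : set ('rV[R]_n -> R) := [set u |
  measurable_fun [set: lebesgue_space R n] (u : lebesgue_space R n -> R) /\
  exists2 k : R, 0 < k & (modular u k < +oo)%E].

Definition M_orlicz : set ('rV[R]_n -> R) := [set u |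
  measurable_fun [set: lebesgue_space R n] (u : lebesgue_space R n -> R) /\
  forall k : R, 0 < k -> (modular u k < +oo)%E].

Record orlicz := Orlicz {
  orlicz_fun :> 'rV[R]_n -> R ;
  orliczP : L_orlicz orlicz_fun }.

HB.instance Definition _ := gen_eqMixin orlicz.
HB.instance Definition _ := gen_choiceMixin orlicz.

(* The topology of the Luxemburg seminorm. Elements of [orlicz] are functions,
   not classes of functions modulo equality almost everywhere, so that this
   topology does not separate functions that are equal almost everywhere. *)
Definition luxemburg_open (U : set orlicz) := forall u : orlicz, U u ->
  exists2 e : R, 0 < e &
    forall v : orlicz, (luxemburg (v \- u)%R < e%:E)%E -> U v.

Let luxemburg_openT : luxemburg_open setT.
Proof. by move=> u _; exists 1. Qed.

Let luxemburg_openI : setI_closed luxemburg_open.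
Proof.
move=> U V oU oV u [/oU[d d0 dU] /oV[e e0 eV]].
exists (Num.min d e); first by rewrite lt_min d0.
move=> v uv; split; [apply: dU|apply: eV]; apply: (lt_le_trans uv).
- by rewrite lee_fin ge_min lexx.
- by rewrite lee_fin ge_min lexx orbT.
Qed.

Let luxemburg_open_bigU (I : Type) (U : I -> set orlicz) :
  (forall i, luxemburg_open (U i)) -> luxemburg_open (\bigcup_i U i).
Proof.
move=> oU u [i _ /oU[e e0 eU]]; exists e => // v /eU Uv; by exists i.
Qed.

HB.instance Definition _ := @isOpenTopological.Build orlicz luxemburg_open
  luxemburg_openT luxemburg_openI luxemburg_open_bigU.

End orlicz.

Arguments L_orlicz {R} n Phi.
Arguments M_orlicz {R} n Phi.
Arguments orlicz {R} n Phi.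

Section test_functions.
Context {R : realType} (n : nat).
Implicit Types u : 'rV[R]_n -> R.

Definition partials (s : seq 'I_n) u : 'rV[R]_n -> R :=
  foldr (fun i f => 'D_(delta_mx 0 i : 'rV[R]_n) f) u s.

Definition smooth u := forall s : seq 'I_n,
  continuous (partials s u) /\
  forall x (i : 'I_n), derivable (partials s u) x (delta_mx 0 i).

Definition test_function u :=
  smooth u /\ compact (closure [set x | u x != 0]).

Definition L0_orlicz (Phi : \bar R -> \bar R) : set (orlicz n Phi) :=
  closure [set u : orlicz n Phi | test_function u].

End test_functions.

Arguments L0_orlicz {R} n Phi.

Section heat.
Context {R : realType} {n : nat}.

Definition heat_kernel (x : 'rV[R]_n) (t : R) : R :=
  (4 * pi * t) `^ (- (n%:R / 2)) *
  expR (- (\sum_(i < n) x 0 i ^+ 2) / (4 * t)).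

(* Only used for t >= 0. *)
Definition heat (t : R) (phi : 'rV[R]_n -> R) : 'rV[R]_n -> R := fun x =>
  if t == 0 then phi x
  else \int[leb n]_y (heat_kernel (x - y) t * phi y).

Definition heat_abs_cvg (t : R) (phi : 'rV[R]_n -> R) (x : 'rV[R]_n) :=
  (leb n).-integrable [set: lebesgue_space R n]
    (fun y => (heat_kernel (x - (y : 'rV[R]_n)) t * phi y)%:E).

End heat.

Section operators.
Context {R : realType} {n : nat}.
Local Notation fct := ('rV[R]_n -> R).

Definition ae_equal (u v : fct) := u = v %[ae leb n].

(* Functions are identified when they are equal almost everywhere, hence
   linearity only holds almost everywhere, and compatibility with this
   identification is part of the definition. *)
Definition bounded_linear_operator (X : set fct) (normX : fct -> \bar R)
    (Y : set fct) (normY : fct -> \bar R) (T : fct -> fct) :=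
  [/\ forall u, X u -> Y (T u),
      forall u v, X u -> X v -> ae_equal u v -> ae_equal (T u) (T v),
      forall (a : R) u v, X u -> X v ->
        ae_equal (T (fun x => a * u x + v x)) (fun x => a * T u x + T v x)
    & exists2 M : R, 0 < M & forall u, X u -> (normY (T u) <= M%:E * normX u)%E].

Definition operator_semigroup (X : set fct) (norm : fct -> \bar R)
    (S : R -> fct -> fct) :=
  [/\ forall t, 0 <= t -> bounded_linear_operator X norm X norm (S t),
      forall u, X u -> ae_equal (S 0 u) u
    & forall s t u, 0 <= s -> 0 <= t -> X u ->
        ae_equal (S (s + t) u) (S s (S t u))].

Definition C0_semigroup (X : set fct) (norm : fct -> \bar R)
    (S : R -> fct -> fct) :=
  operator_semigroup X norm S /\
  forall u, X u -> norm (S t u \- u) @[t --> 0^'+] --> 0%E.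

End operators.

(* Main.v *)
Require Import Defs.
From HB Require Import structures.
From mathcomp Require Import all_boot all_order all_algebra.
From mathcomp Require Import all_classical all_reals all_analysis.
From mathcomp Require Import measurable_realfun.
From mathcomp Require Import ring lra.
Set Implicit Arguments.
Unset Strict Implicit.
Unset Printing Implicit Defensive.
Import Order.TTheory GRing.Theory Num.Theory.
Import numFieldNormedType.Exports.
Local Open Scope classical_set_scope.
Local Open Scope ring_scope.

(** Everything rests on two elementary properties of the heat kernel [G]: it is
    positive with mass one in each variable, and [G x t <= t^(-n/2)].

    Since [S(t) u x] is an average of [u], Jensen's inequality
    ([jensen_density]) gives [Phi (|S(t) u x| / k) <= int G(x - y, t)
    Phi (|u y| / k) dy].  Integrating in [x] and exchanging the integrals shows
    that [S(t)] does not increase any modular ([modular_heat]), hence that it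
    contracts the Luxemburg norm, a fortiori with the constant 2; bounding
    [G] by [t^(-n/2)] instead gives a pointwise bound on [S(t) u]
    ([heat_pointwise]).  The semigroup law is Fubini's theorem together with
    [G s * G t = G (s + t)] (convolution), which reduces, by the product
    structure of [G], to completing a square in dimension one.

    Strong continuity is first proved for uniformly continuous functions [psi]
    that vanish off a box.  There [|S(t) psi - psi|] is at most a modulus of
    continuity times the indicator of a larger box, plus [q (S(2t) |psi| +
    |psi|)], where [q] tends to 0 with [t] ([heat_close]): the Gaussian tail is
    itself dominated by a small multiple of the kernel at time [2t], so that
    the contraction property controls it in every Luxemburg norm at once.
    Contraction then propagates the convergence to the norm closure of the
    test functions.  When [Phi] is finite, dominated convergence makes the set
    of functions at which [S(t)] is continuous stable under pointwise limits
    dominated in [M^Phi]; a monotone class argument leads from Lipschitz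
    functions to indicators of Borel sets, then to simple functions and to all
    of [M^Phi] ([M_heat_continuous]).

    For the smoothing estimates put [s = t^(-n/2)], [a = Phi^-1(s)] and
    [b = Psi^-1(s)].  If the modular of [u] is at most 1, then
    [Phi (|S(t) u|) <= s] pointwise, while the modular of [S(t) u] is still at
    most 1.  The factorisation of [x Psi^-1(x)] through [Theta] enters only by
    the fact that [Theta^-1(r) / r] is nonincreasing: up to the factor [beta],
    so is [Psi^-1 / Phi^-1], and this says precisely that
    [Psi (beta b y / (2 a)) <= Phi y] as long as [Phi y <= s]
    ([young_ratio]).  Applied to [y = |S(t) u x|] and integrated, it bounds
    the [Psi]-modular of [beta b S(t) u / (2 a)] by 1.  The vanishing of the
    rescaled norm is immediate for test functions, which belong to [L^Psi],
    and extends to compact subsets of their closure because the smoothing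
    estimate is uniform. *)

(** * Borel representatives of Lebesgue measurable functions *)

Section completion.
Local Open Scope ereal_scope.
Context d (T : measurableType d) (R : realType).
Variable mu : {sigma_finite_measure set T -> \bar R}.
Local Notation muo := (mu^*)%mu.

(** Covers by measurable sets may be replaced by their unions, so the infimum
    that defines the outer measure is attained by the intersection of a
    minimising sequence of such unions. *)
Lemma outer_measure_hull (X : set T) :
  exists B, [/\ measurable B, X `<=` B & mu B = muo X].
Proof.
have [Xoo|Xfin] := eqVneq (muo X) +oo.
  (* A set of infinite outer measure has the whole space as a hull. *)
  exists setT; split => //; apply/eqP; rewrite eq_le Xoo leey/= -Xoo.
  by rewrite -measurable_mu_extE//; apply: le_outer_measure.
have inv0 n : (0 < n.+1%:R^-1 :> R)%R by rewrite invr_gt0.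
have Xfin' : muo X \is a fin_num.
  by rewrite ge0_fin_numE ?ltey// outer_measure_ge0.
have cov s : (0 < s)%R -> exists2 B, measurable B /\ X `<=` B &
    mu B <= muo X + s%:E.
  move=> s0; have := Xfin'; rewrite {1}/mu_ext.
  move/lb_ereal_inf_adherent => /(_ _ s0)[_/= [A [mA XA] <-] Alt].
  exists (\bigcup_i A i).
    by split => //; apply: bigcupT_measurable.
  apply: le_trans (ltW Alt); apply: measure_sigma_subadditive => //.
  exact: bigcupT_measurable.
pose B n := projT1 (cid2 (cov _ (inv0 n))).
have mB n : measurable (B n) by rewrite /B; case: cid2 => ? [].
have XB n : X `<=` B n by rewrite /B; case: cid2 => ? [].
have muB n : mu (B n) <= muo X + n.+1%:R^-1%:E by rewrite /B; case: cid2 => ? [].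
exists (\bigcap_n B n); split.
- exact: bigcapT_measurable.
- exact: sub_bigcap.
- have mcap : measurable (\bigcap_n B n) by exact: bigcapT_measurable.
  apply/eqP; rewrite eq_le; apply/andP; split; last first.
    rewrite -(measurable_mu_extE mu mcap); apply: le_outer_measure.
    exact: sub_bigcap.
  apply/lee_addgt0Pr => _/posnumP[e].
  near \oo => n.
  apply: (@le_trans _ _ (mu (B n))).
    by apply: le_measure; rewrite ?inE//; exact: bigcap_inf.
  rewrite (le_trans (muB n))// leeD2l// lee_fin ltW//.
  by near: n; apply: near_infty_natSinv_lt.
Unshelve. all: by end_near. Qed.

(** For a Caratheodory set of finite measure, additivity makes the difference
    between the set and its hull null, and a hull of that difference is a
    measurable null set; sigma-finiteness glues the pieces. *)
Lemma caratheodory_hull (E : set T) : muo.-cara.-measurable E ->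
  exists B N, [/\ measurable B, measurable N, mu N = 0, E `<=` B & B `\` E `<=` N].
Proof.
move=> mE.
have /sigma_finiteP[A [TA _ Aoo]] := sigma_finiteT mu.
have H k : exists BN : set T * set T,
    [/\ measurable BN.1, measurable BN.2, mu BN.2 = 0, E `&` A k `<=` BN.1 &
        BN.1 `\` (E `&` A k) `<=` BN.2].
  have [mAk Akoo] := Aoo k.
  have mEA : muo.-cara.-measurable (E `&` A k).
    by apply: measurableI => //; exact: caratheodory_measurable_mu_ext.
  have EAoo : muo (E `&` A k) < +oo.
    apply: (@le_lt_trans _ _ (muo (A k))).
      by apply: le_outer_measure; exact: subIsetr.
    by rewrite measurable_mu_extE.
  have [B [mB EB muB]] := outer_measure_hull (E `&` A k).
  have [N [mN BEN muN]] := outer_measure_hull (B `\` (E `&` A k)).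
  exists (B, N); split => //=; rewrite muN.
  have mBc : muo.-cara.-measurable B by exact: caratheodory_measurable_mu_ext.
  pose muc : {measure set (caratheodory_type muo) -> \bar R} :=
    @completed_measure_extension _ _ _ mu.
  have mucB : muc B = muo (E `&` A k).
    by rewrite -muB; exact: measurable_mu_extE.
  rewrite -[LHS]/(muc (B `\` (E `&` A k))) measureD//; last first.
    by have := EAoo; rewrite -mucB.
  rewrite setIidr//; rewrite [X in X - _]mucB subee//.
  by rewrite ge0_fin_numE// outer_measure_ge0.
pose BN k := projT1 (cid (H k)).
have HBN k : [/\ measurable (BN k).1, measurable (BN k).2, mu (BN k).2 = 0,
    E `&` A k `<=` (BN k).1 & (BN k).1 `\` (E `&` A k) `<=` (BN k).2].
  by rewrite /BN; case: cid.
exists (\bigcup_k (BN k).1), (\bigcup_k (BN k).2); split.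
- by apply: bigcupT_measurable => k; case: (HBN k).
- by apply: bigcupT_measurable => k; case: (HBN k).
- apply/eqP; rewrite -measure_le0.
  apply: (@le_trans _ _ (\sum_(0 <= k <oo) mu (BN k).2)).
    apply: measure_sigma_subadditive => //.
    + by move=> k; case: (HBN k).
    + by apply: bigcupT_measurable => k; case: (HBN k).
  by rewrite eseries0// => k _ _; case: (HBN k).
- move=> x Ex; have : [set: T] x by [].
  rewrite TA => -[k _ Akx]; exists k => //.
  by case: (HBN k) => _ _ _ + _; apply.
- move=> x [[k _ Bkx] nEx]; exists k => //.
  by case: (HBN k) => _ _ _ _; apply; split => // -[].
Qed.

End completion.

Section leb_borel.
Context {R : realType} (n : nat).
Local Notation T := 'rV[R]_n.
Local Notation X := (lebesgue_space R n).
Local Notation lam := (borel_lebesgue n : set T -> \bar R).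

Lemma measurable_borel_leb (A : set T) : measurable A -> measurable (A : set X).
Proof. exact: caratheodory_measurable_mu_ext. Qed.

Lemma measurable_fun_borel_leb d' (Y : sigmaRingType d') (f : T -> Y) :
  measurable_fun [set: T] f -> measurable_fun [set: X] (f : X -> Y).
Proof.
by move=> mf _ B mB; apply: measurable_borel_leb; exact: mf.
Qed.

Lemma lebE (A : set T) : measurable A -> leb n A = borel_lebesgue n A.
Proof. exact: measurable_mu_extE. Qed.

(** The identity map is measurable from the Lebesgue to the Borel
    sigma-algebra and pushes [leb n] forward to [borel_lebesgue n]. *)
Lemma ge0_integral_leb (f : T -> \bar R) : (forall x, (0 <= f x)%E) ->
  measurable_fun [set: T] f ->
  (\int[leb n]_x f x = \int[borel_lebesgue n]_x f x)%E.
Proof.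
move=> f0 mf.
have mid : measurable_fun [set: X] (idfun : X -> T).
  by move=> _ A mA; rewrite setTI; exact: measurable_borel_leb.
rewrite -[LHS]/(\int[leb n]_(x in idfun @^-1` setT) (f \o idfun) x)%E.
rewrite -(ge0_integral_pushforward mid) //.
by apply: eq_measure_integral => A mA _; exact: lebE.
Qed.

Lemma integral_leb (f : T -> \bar R) : measurable_fun [set: T] f ->
  (\int[leb n]_x f x = \int[borel_lebesgue n]_x f x)%E.
Proof.
move=> mf; rewrite integralE [RHS]integralE.
by rewrite !ge0_integral_leb//; [exact: measurable_funeneg|exact: measurable_funepos].
Qed.

(** Each set [q < u], with [q] rational, is Borel outside a Borel null set.
    Redefining [u] as 0 on the union [N] of these null sets makes it Borel and
    does not increase its absolute value. *)
Lemma leb_ae_borel (u : T -> R) :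
  measurable_fun [set: X] (u : X -> R) ->
  exists v : T -> R, [/\ measurable_fun [set: T] v,
    (forall x, `|v x| <= `|u x|) & ae_equal u v].
Proof.
move=> mu_.
have H (q : rat) : exists BN : set T * set T,
    [/\ measurable BN.1, measurable BN.2, borel_lebesgue n BN.2 = 0%E,
      [set x | ratr q < u x] `<=` BN.1 &
      BN.1 `\` [set x | ratr q < u x] `<=` BN.2].
  have mE : measurable ([set x | ratr q < u x] : set X).
    rewrite (_ : mkset _ = [set: X] `&` u @^-1` `]ratr q, +oo[).
      exact: mu_.
    by apply/seteqP; split => x /=; rewrite in_itv/= andbT// => -[].
  have [B [N [? ? ? ? ?]]] := caratheodory_hull mE.
  by exists (B, N).
pose BN k := projT1 (cid (H k)).
have HBN k : [/\ measurable (BN k).1, measurable (BN k).2,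
    borel_lebesgue n (BN k).2 = 0%E, [set x | ratr k < u x] `<=` (BN k).1 &
      (BN k).1 `\` [set x | ratr k < u x] `<=` (BN k).2].
  by rewrite /BN; case: cid.
pose N := \bigcup_q (BN q).2.
have mN : measurable N.
  by apply: bigcupT_measurable_rat => k; case: (HBN k).
have N0 : borel_lebesgue n N = 0%E.
  have /card_esym/ppcard_eqP[f] := card_rat.
  rewrite /N -[LHS]/(borel_lebesgue n N).
  have -> : N = \bigcup_(k in [set: nat]) (BN (f k)).2.
    apply/seteqP; split => [x [q _ Bq]|x [k _ ?]]; last by exists (f k).
    have [k _ fk] := surj (f := f) (I : [set: rat] q).
    by exists k => //; rewrite fk.
  apply/eqP; rewrite -measure_le0.
  apply: (@le_trans _ _ (\sum_(0 <= k <oo) borel_lebesgue n (BN (f k)).2)%E).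
    apply: measure_sigma_subadditive => //.
    + by move=> k; case: (HBN (f k)).
    + by apply: bigcupT_measurable => k; case: (HBN (f k)).
  by rewrite eseries0// => k _ _; case: (HBN (f k)).
have mvE q : measurable ([set x | ratr q < u x] `\` N).
  rewrite (_ : _ `\` _ = (BN q).1 `\` N); last first.
    case: (HBN q) => _ _ _ h1 h2.
    apply/seteqP; split => x [/= ux Nx]; split => //; first exact: h1.
    by apply: contrapT => nux; apply: Nx; exists q => //; exact: h2.
  by apply: measurableD => //; case: (HBN q).
exists (fun x => if x \in N then 0 else u x); split.
- apply: (measurability _ (RGenOInfty.measurableE R)) => //.
  move=> _ [_ [a ->] <-]; rewrite setTI.
  set U := \bigcup_(q in [set q : rat | a < ratr q]) ([set x | ratr q < u x] `\` N).
  have mU : measurable U.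
    rewrite /U bigcup_mkcond; apply: bigcupT_measurable_rat => q.
    by case: ifPn.
  have UE : U = [set x | a < u x] `\` N.
    apply/seteqP; split => [x [q /= aq [/= qu Nx]]|x [/= au Nx]].
      by split => //=; exact: lt_trans qu.
    by have [q /[!in_itv]/= /andP[aq qu]] := rat_in_itvoo au; exists q.
  (* The value 0 on N belongs to the level set exactly when a is negative. *)
  have [a0|a0] := ltP a 0.
    rewrite (_ : _ @^-1` _ = U `|` N); first exact: measurableU.
    rewrite UE; apply/seteqP; split => x /=; rewrite in_itv/= andbT.
      case: ifPn => [|]; first by rewrite inE; right.
      by rewrite notin_setE => Nx au; left.
    case: ifPn => [//|]; rewrite notin_setE => Nx; by case => [[]|].
  rewrite (_ : _ @^-1` _ = U) // UE.
  apply/seteqP; split => x /=; rewrite in_itv/= andbT.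
    by case: ifPn => [_|]; [rewrite ltNge a0|rewrite notin_setE].
  by move=> [au Nx]; rewrite memNset.
- by move=> x; case: ifPn => // _; rewrite normr0.
- exists N; split; first exact: measurable_borel_leb.
    by rewrite -N0; exact: lebE.
  move=> x /= /not_implyP[_]; case: ifPn; first by rewrite inE.
  by rewrite notin_setE.
Qed.

End leb_borel.

(** * The heat kernel as a product of Gaussian densities *)

Section product_formula.
Context {R : realType}.

Lemma measurable_prod_coor n (f : 'I_n -> R -> R) :
  (forall i, measurable_fun [set: R] (f i)) ->
  measurable_fun [set: 'rV[R]_n] (fun x : 'rV[R]_n => \prod_(i < n) f i (x 0 i)).
Proof.
move=> mf; apply: measurable_prod => i _.
by apply: (measurableT_comp (mf i)); exact: measurable_coor.
Qed.

(** Tonelli's theorem along the recursive construction of the measure. *)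
Lemma integral_prod_coor n (f : 'I_n -> R -> R) :
  (forall i r, 0 <= f i r) -> (forall i, measurable_fun [set: R] (f i)) ->
  (\int[borel_lebesgue n]_x (\prod_(i < n) f i (x ord0 i))%:E =
   \prod_(i < n) \int[lebesgue_measure]_r (f i r)%:E)%E.
Proof.
elim: n f => [f f0 mf|n IH f f0 mf].
  rewrite big_ord0 /= integral_dirac//; last first.
    by apply/measurable_EFinP; exact: measurable_prod_coor.
  by rewrite diracT mul1e big_ord0.
rewrite big_ord_recl -IH; [|by move=> i r; exact: f0|by move=> i; exact: mf].
pose g (p : measurableTypeR R * 'rV[R]_n) : R :=
  f ord0 p.1 * \prod_(i < n) f (lift ord0 i) (p.2 0 i).
have mg2 : measurable_fun setT (fun x : 'rV[R]_n => \prod_(i < n) f (lift ord0 i) (x ord0 i)).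
  exact: (@measurable_prod_coor n (fun i => f (lift ord0 i)) (fun i => mf _)).
have mg : measurable_fun setT g.
  apply: measurable_funM.
    by apply: (measurableT_comp (mf ord0)); exact: measurable_fst.
  by apply: (measurableT_comp mg2); exact: measurable_snd.
transitivity (\int[pushforward (lebesgue_measure \x borel_lebesgue n)
    (@rV_cons R n)]_x (\prod_(i < n.+1) f i (x ord0 i))%:E)%E.
  reflexivity.
rewrite (ge0_integral_pushforward (@measurable_rV_cons R n))//; last 2 first.
- by apply/measurable_EFinP; exact: measurable_prod_coor.
- by move=> y _; rewrite lee_fin; exact: prodr_ge0.
rewrite preimage_setT.
transitivity (\int[(lebesgue_measure \x borel_lebesgue n)%E]_p (g p)%:E)%E.
  apply: eq_integral => -[a v] _ /=; rewrite big_ord_recl rV_cons0 /g/=.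
  by congr (_ * _)%:E; apply: eq_bigr => i _; rewrite rV_consS.
have f0' x : 0 <= \prod_(i < n) f (lift ord0 i) ((x : 'rV[R]_n) 0 i).
  exact: prodr_ge0.
rewrite fubini_tonelli1/=; last 2 first.
- exact/measurable_EFinP.
- by move=> p; rewrite lee_fin mulr_ge0.
rewrite /fubini_F/= /g/=.
under eq_integral => x _.
  under eq_integral do rewrite EFinM.
  rewrite ge0_integralZl_EFin//; last 2 first.
    by move=> v _; rewrite lee_fin.
    exact/measurable_EFinP.
  over.
rewrite ge0_integralZr//.
- by apply/measurable_EFinP; exact: (mf ord0).
- by move=> v _; rewrite lee_fin.
- by apply: integral_ge0 => v _; rewrite lee_fin.
Qed.

End product_formula.

Section heat_kernel.
Context {R : realType}.
Implicit Types s t r x y z : R.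

(** The heat kernel in dimension one: the centred Gaussian density of variance
    [2 t]. *)
Definition heat1 t r : R := (Num.sqrt (4 * pi * t))^-1 * expR (- r ^+ 2 / (4 * t)).

Lemma heat1_ge0 t r : 0 <= heat1 t r.
Proof. by rewrite mulr_ge0// ?expR_ge0// invr_ge0 sqrtr_ge0. Qed.

Lemma measurable_heat1 t : measurable_fun setT (heat1 t).
Proof.
apply: measurable_funM => //; apply: measurableT_comp => //.
by apply: measurable_funM => //; apply: measurableT_comp => //; exact: measurable_funX.
Qed.

Lemma heat1_normal_pdf t x y : 0 < t ->
  heat1 t (x - y) = normal_pdf x (Num.sqrt (2 * t)) y.
Proof.
move=> t0; have t20 : 0 < 2 * t by rewrite mulr_gt0.
rewrite normal_pdfE ?gt_eqF ?sqrtr_gt0// /normal_peak /normal_fun /heat1.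
rewrite sqr_sqrtr ?ltW//; congr ((Num.sqrt _)^-1 * expR _).
  by rewrite -mulr_natr; ring.
by rewrite -mulr_natr -sqrrN opprB; congr (_ / _); ring.
Qed.

Lemma integral_heat1 t x : 0 < t ->
  (\int[lebesgue_measure]_y (heat1 t (x - y))%:E = 1)%E.
Proof.
move=> t0; under eq_integral do rewrite heat1_normal_pdf//.
exact: integral_normal_pdf.
Qed.

(** Completing the square in [y]: the product of two Gaussians centred at [x]
    and [z] is a Gaussian in [y] centred at their weighted mean, times a factor
    free of [y]. *)
Lemma heat1M s t x y z : 0 < s -> 0 < t ->
  heat1 s (x - y) * heat1 t (y - z) = heat1 (s + t) (x - z) *
    heat1 (s * t / (s + t)) ((x * t + z * s) / (s + t) - y).
Proof.
move=> s0 t0; have st0 : 0 < s + t by rewrite addr_gt0.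
have p4 : 0 < 4 * pi :> R by rewrite mulr_gt0// pi_gt0.
rewrite /heat1 !(mulrACA _ (expR _)); congr (_ * _).
  rewrite -!invfM -!sqrtrM ?mulr_ge0// ?pi_ge0// ?ltW//; congr ((Num.sqrt _)^-1).
  by field; rewrite gt_eqF.
rewrite -!expRD; congr expR; field.
by rewrite !gt_eqF.
Qed.

Lemma integral_heat1M s t x z : 0 < s -> 0 < t ->
  (\int[lebesgue_measure]_y (heat1 s (x - y) * heat1 t (y - z))%:E =
    (heat1 (s + t) (x - z))%:E)%E.
Proof.
move=> s0 t0; have st0 : 0 < s + t by rewrite addr_gt0.
under eq_integral do rewrite heat1M// EFinM.
rewrite ge0_integralZl_EFin//.
- by rewrite integral_heat1 ?mule1// divr_gt0// mulr_gt0.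
- by move=> y _; rewrite lee_fin heat1_ge0.
- apply/measurable_EFinP; apply: (measurableT_comp (measurable_heat1 _)).
  exact: measurable_funB.
- exact: heat1_ge0.
Qed.

Variable n : nat.
Implicit Types u v w : 'rV[R]_n.

Lemma heat_kernel_prod v t : 0 < t -> heat_kernel v t = \prod_(i < n) heat1 t (v 0 i).
Proof.
move=> t0; rewrite /heat_kernel /heat1 big_split/= prodr_const card_ord.
have p4 : 0 <= 4 * pi * t :> R by rewrite !mulr_ge0// ?pi_ge0// ltW.
congr (_ * _).
  rewrite -powR12_sqrt// -powRN -powR_mulrn ?powR_ge0// -powRrM.
  by congr (_ `^ _); ring.
rewrite -expR_sum; congr expR.
by rewrite mulNr mulr_suml -sumrN; apply: eq_bigr => i _; rewrite mulNr.
Qed.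

Lemma heat_kernel_gt0 v t : 0 < t -> 0 < heat_kernel v t.
Proof.
by move=> t0; rewrite mulr_gt0 ?expR_gt0// powR_gt0// !mulr_gt0// pi_gt0.
Qed.

Lemma heat_kernel_ge0 v t : 0 <= heat_kernel v t.
Proof. by rewrite mulr_ge0 ?expR_ge0 ?powR_ge0. Qed.

Lemma heat_kernel_le v t : 0 < t -> heat_kernel v t <= t `^ (- (n%:R / 2)).
Proof.
move=> t0; rewrite /heat_kernel -[leRHS]mulr1 ler_pM ?powR_ge0 ?expR_ge0//.
  rewrite !powRN lef_pV2 ?posrE ?powR_gt0 ?mulr_gt0 ?pi_gt0//.
  have p2 := @pi_ge2 R.
  by apply: ge0_ler_powR; rewrite ?nnegrE ?divr_ge0// ?ltW//; nra.
rewrite -[leRHS]expR0 ler_expR mulNr oppr_le0 divr_ge0//.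
  by apply: sumr_ge0 => i _; exact: sqr_ge0.
by rewrite mulr_ge0// ltW.
Qed.

Lemma heat_kernelC u v t : heat_kernel (u - v) t = heat_kernel (v - u) t.
Proof.
rewrite /heat_kernel; under eq_bigr do rewrite !mxE -sqrrN opprB.
by under [in RHS]eq_bigr do rewrite !mxE.
Qed.

Lemma measurable_heat_kernel2 t : 
  measurable_fun [set: 'rV[R]_n * 'rV[R]_n]
    (fun p : 'rV[R]_n * 'rV[R]_n => heat_kernel (p.1 - p.2) t).
Proof.
apply: measurable_funM => //; apply: measurableT_comp => //.
apply: measurable_funM => //; apply: measurableT_comp => //.
apply: measurable_sum => i; apply: measurable_funX.
rewrite (_ : (fun _ => _) = fun p : 'rV[R]_n * 'rV[R]_n => p.1 0 i - p.2 0 i).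
  apply: measurable_funB.
    by apply: (measurableT_comp (measurable_coor i)); exact: measurable_fst.
  by apply: (measurableT_comp (measurable_coor i)); exact: measurable_snd.
by apply/funext => p; rewrite !mxE.
Qed.

Lemma measurable_heat_kernelr u t :
  measurable_fun [set: 'rV[R]_n] (fun v => heat_kernel (u - v) t).
Proof.
have := measurableT_comp (measurable_heat_kernel2 t) (@pair1_measurable _ _ 'rV[R]_n 'rV[R]_n u).
exact.
Qed.

Lemma integral_heat_kernel u t : 0 < t ->
  (\int[borel_lebesgue n]_v (heat_kernel (u - v) t)%:E = 1)%E.
Proof.
move=> t0; under eq_integral => v _.
  rewrite heat_kernel_prod//; under eq_bigr do rewrite !mxE.
  over.
rewrite (@integral_prod_coor R n (fun i r => heat1 t (u 0 i - r))).
- by rewrite big1// => i _; rewrite integral_heat1.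
- by move=> i r; exact: heat1_ge0.
- move=> i; apply: (measurableT_comp (measurable_heat1 _)).
  exact: measurable_funB.
Qed.

(** The semigroup law at the level of kernels. *)
Lemma integral_heat_kernelM u w s t : 0 < s -> 0 < t ->
  (\int[borel_lebesgue n]_v (heat_kernel (u - v) s * heat_kernel (v - w) t)%:E
  = (heat_kernel (u - w) (s + t))%:E)%E.
Proof.
move=> s0 t0; have st0 : 0 < s + t by rewrite addr_gt0.
under eq_integral => v _.
  rewrite !heat_kernel_prod// -big_split/=; under eq_bigr do rewrite !mxE.
  over.
rewrite (@integral_prod_coor R n
  (fun i r => heat1 s (u 0 i - r) * heat1 t (r - w 0 i))).
- rewrite heat_kernel_prod//.
  under eq_bigr do rewrite integral_heat1M//.
  by rewrite prodEFin; congr EFin; apply: eq_bigr => i _; rewrite !mxE.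
- by move=> i r; rewrite mulr_ge0 ?heat1_ge0.
- move=> i; apply: measurable_funM; apply: (measurableT_comp (measurable_heat1 _));
  exact: measurable_funB.
Qed.

(** The small factor that is gained when, at distance at least [r], the kernel
    at time [t] is compared with the kernel at time [2 t]. *)
Definition heat_tail (r t : R) := 2 `^ (n%:R / 2) * expR (- r ^+ 2 / (8 * t)).

(** Half of the exponent [|v|^2 / (4 t)] is bounded below by [r^2 / (8 t)], the
    other half is the exponent at time [2 t].  Because the right-hand side is
    again a heat kernel, Gaussian tails can be estimated by the contraction
    property instead of by moments. *)
Lemma heat_kernel_tail v r t i : 0 < t -> 0 <= r -> r <= `|v 0 i| ->
  heat_kernel v t <= heat_tail r t * heat_kernel v (2 * t).
Proof.
move=> t0 r0 rv; rewrite /heat_tail /heat_kernel.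
have pt : 0 < 4 * pi * t :> R by rewrite !mulr_gt0 ?pi_gt0.
rewrite mulrACA ler_pM ?powR_ge0 ?expR_ge0//.
  rewrite (_ : 4 * pi * (2 * t) = 2 * (4 * pi * t)); last by ring.
  rewrite [(2 * _) `^ _]powRM ?(ltW pt)// mulrA -powRD; last by rewrite addrN eqxx pnatr_eq0.
  by rewrite addrN powRr0 mul1r.
rewrite -expRD ler_expR.
set S := \sum_(_ | _) _.
have rS : r ^+ 2 <= S.
  rewrite /S (bigD1 i)//= -[leLHS]addr0 lerD//.
    by rewrite -[leRHS]real_normK ?num_real// lerXn2r ?nnegrE.
  by apply: sumr_ge0 => j _; exact: sqr_ge0.
rewrite -subr_ge0 (_ : _ - _ = (S - r ^+ 2) / (8 * t)); last by field; rewrite gt_eqF.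
by rewrite divr_ge0// ?subr_ge0// mulr_ge0// ltW.
Qed.

End heat_kernel.

(** * Young's functions and Jensen's inequality *)

Section young.
Context {R : realType}.
Variable Phi : \bar R -> \bar R.
Hypothesis yPhi : young Phi.
Local Open Scope ereal_scope.

Lemma young_ge0 (x : R) : (0 <= x)%R -> 0 <= Phi x%:E.
Proof. by case: yPhi => + _ _ x0; apply; rewrite lee_fin. Qed.

Lemma young0 : Phi 0 = 0.
Proof. by case: yPhi. Qed.

(** The three kinds of Young's functions differ only in the set where they are
    finite, a half-line or a bounded interval with or without its right end.
    The facts listed here are all that is used about them. *)
Lemma young_domain : exists D : set R, [/\ forall x, D x -> (0 <= x)%R,
  forall x y, D y -> (0 <= x <= y)%R -> D x,
  convex_increasing_finite_on D Phi,
  (forall x, (0 <= x)%R -> ~ D x -> Phi x%:E = +oo) &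
  (exists2 d : R, (0 < d)%R & D d) /\ exists2 x : R, (0 < x)%R & 0 < Phi x%:E].
Proof.
case: (yPhi) => Phi0 Phi00 [[cPhi [x x0 Phix]]|[|]].
- exists `[0%R, +oo[%classic; split => //=.
  + by move=> y; rewrite in_itv/= andbT.
  + by move=> y z; rewrite !in_itv/= !andbT => _ /andP[].
  + by move=> y y0; rewrite in_itv/= andbT y0.
  + split; first by exists 1%R => //=; rewrite in_itv/= andbT.
    exists x; last by rewrite lt0e Phix Phi0.
    rewrite lt_neqAle x0 andbT eq_sym; apply: contra_neq Phix => ->.
    exact: Phi00.
- move=> [a [a0 cPhi Phioo]]; exists `[0%R, a]%classic; split => //=.
  + by move=> y; rewrite in_itv/= => /andP[].
  + move=> y z; rewrite !in_itv/= => /andP[_ za] /andP[-> yz].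
    exact: le_trans za.
  + move=> y y0; rewrite in_itv/= y0/= => /negP; rewrite -ltNge => ay.
    by apply: Phioo; rewrite lte_fin.
  + split; first by exists a => //=; rewrite in_itv/= lexx ltW.
    exists (a + 1)%R; first by rewrite addr_gt0.
    by rewrite Phioo ?ltry// lte_fin ltrDl.
- move=> [a [a0 cPhi _ Phioo]]; exists `[0%R, a[%classic; split => //=.
  + by move=> y; rewrite in_itv/= => /andP[].
  + move=> y z; rewrite !in_itv/= => /andP[_ za] /andP[-> yz].
    exact: le_lt_trans za.
  + move=> y y0; rewrite in_itv/= y0/= => /negP; rewrite -leNgt => ay.
    by apply: Phioo; rewrite lee_fin.
  + split.
      exists (a / 2)%R; first by rewrite divr_gt0.
      by rewrite /= in_itv/= divr_ge0 ?(ltW a0)//= ltr_pdivrMr// ltr_pMr// ltr1n.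
    by exists a => //; rewrite Phioo.
Qed.

Lemma young_le (x y : R) : (0 <= x <= y)%R -> Phi x%:E <= Phi y%:E.
Proof.
move=> xy; have [D [D0 Dle [Dfin _ Dmono] Doo _]] := young_domain.
have y0 : (0 <= y)%R by case/andP: xy; exact: le_trans.
have [Dy|nDy] := pselect (D y); last by rewrite (Doo y)// leey.
have Dx : D x by exact: Dle Dy xy.
rewrite -(fineK (Dfin _ Dx)) -(fineK (Dfin _ Dy)) lee_fin.
by apply: Dmono; rewrite ?inE//; case/andP: xy.
Qed.

(** Thanks to [0 * +oo = 0], convexity on the domain extends to the whole
    half-line. *)
Lemma young_convex (x y l : R) : (0 <= x)%R -> (0 <= y)%R -> (0 <= l <= 1)%R ->
  Phi (l * x + (1 - l) * y)%:E <= l%:E * Phi x%:E + (1 - l)%:E * Phi y%:E.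
Proof.
move=> x0 y0 /andP[l0 l1].
have [->|ln0] := eqVneq l 0%R.
  by rewrite mul0r add0r subr0 mul1r mul0e add0e mul1e.
have [->|ln1] := eqVneq l 1%R.
  by rewrite mul1r subrr mul0r addr0 mul0e adde0 mul1e.
have lgt0 : (0 < l)%R by rewrite lt_neqAle eq_sym ln0.
have l'gt0 : (0 < 1 - l)%R by rewrite subr_gt0 lt_neqAle ln1.
have [D [D0 Dle [Dfin Dconv _] Doo _]] := young_domain.
have [Dx|nDx] := pselect (D x); last first.
  rewrite (Doo x)// gt0_muley ?lte_fin// addye ?leey//.
  by rewrite gt_eqF// (@lt_le_trans _ _ 0)// mule_ge0 ?young_ge0// lee_fin ltW.
have [Dy|nDy] := pselect (D y); last first.
  rewrite (Doo y)// gt0_muley ?lte_fin// addey ?leey//.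
  by rewrite gt_eqF// (@lt_le_trans _ _ 0)// mule_ge0 ?young_ge0// lee_fin ltW.
have Dxy : D (l * x + (1 - l) * y)%R.
  apply: (Dle _ (Num.max x y)); first by rewrite maxEle; case: ifP.
  rewrite addr_ge0 ?mulr_ge0 ?(ltW lgt0) ?(ltW l'gt0)//=.
  have mx : (x <= Num.max x y)%R by rewrite le_max lexx.
  have my : (y <= Num.max x y)%R by rewrite le_max lexx orbT.
  nra.
rewrite -(fineK (Dfin _ Dx)) -(fineK (Dfin _ Dy)) -(fineK (Dfin _ Dxy)).
rewrite -!EFinM -EFinD lee_fin.
pose t := @Itv01 R l l0 l1.
by have := Dconv t x y; rewrite !inE => /(_ Dx Dy); rewrite /t !convRE.
Qed.

Lemma young_scale (x l : R) : (0 <= x)%R -> (0 <= l <= 1)%R ->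
  Phi (l * x)%:E <= l%:E * Phi x%:E.
Proof.
move=> x0 l01; have := young_convex x0 (lexx 0%R) l01.
by rewrite mulr0 addr0 young0 mule0 adde0.
Qed.

Lemma young_fin_near0 : exists2 d : R, (0 < d)%R & Phi d%:E < +oo.
Proof.
have [D [D0 Dle [Dfin Dconv _] Doo [[d d0 Dd] _]]] := young_domain.
by exists d => //; rewrite ltey_eq Dfin.
Qed.

(** If [0 < c <= Phi x], convexity and [Phi 0 = 0] force [Phi] to lie above the
    line of slope [c / x] beyond [x]. *)
Lemma young_linear_lower_bound : exists a b : R, [/\ (0 < a)%R, (0 <= b)%R &
  forall y : R, (0 <= y)%R -> (a * y - b)%:E <= Phi y%:E].
Proof.
have [D [D0 Dle _ _ [_ [x x0 Phix]]]] := young_domain.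
have [c c0 cPhi] : exists2 c : R, (0 < c)%R & c%:E <= Phi x%:E.
  case: (Phi x%:E) Phix => [r|_|//]; last by exists 1%R => //; rewrite leey.
  by rewrite lte_fin => r0; exists r.
exists (c / x)%R, c; split; [by rewrite divr_gt0|exact: ltW|].
move=> y y0; have [xy|yx] := leP x y; last first.
  apply: (@le_trans _ _ 0); last exact: young_ge0.
  by rewrite lee_fin subr_le0 mulrAC ler_pdivrMr// ler_wpM2l ?ltW.
have ygt0 : (0 < y)%R by exact: lt_le_trans xy.
have xy01 : (0 <= x / y <= 1)%R.
  by rewrite divr_ge0 ?(ltW x0)//= ler_pdivrMr// mul1r.
have := young_scale y0 xy01; rewrite divfK ?gt_eqF//.
move/(le_trans cPhi); rewrite -(@lee_pmul2l _ (y / x)%:E)//; last first.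
  by rewrite lte_fin divr_gt0.
have e1 : (y / x * (x / y) = 1)%R by field; rewrite !gt_eqF.
rewrite muleA -[_%:E * (x / y)%:E]EFinM e1 mul1e.
apply: le_trans; rewrite -EFinM lee_fin.
by rewrite (_ : y / x * c = c / x * y)%R ?gerBl ?ltW//; ring.
Qed.

Lemma young_unbounded (M : R) : exists2 y : R, (0 < y)%R & M%:E < Phi y%:E.
Proof.
have [a [b [a0 b0 ab]]] := young_linear_lower_bound.
pose y := ((`|M| + b + 1) / a)%R.
have y0 : (0 < y)%R by rewrite divr_gt0// ltr_wpDl// addr_ge0.
exists y => //; apply: lt_le_trans (ab _ (ltW y0)).
rewrite lte_fin /y mulrC divfK ?gt_eqF//.
by have := ler_norm M; lra.
Qed.

Lemma young_small (y : R) : (0 < y)%R ->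
  exists2 e : R, (0 < e)%R & Phi e%:E <= y%:E.
Proof.
move=> y0; have [d d0 Phid] := young_fin_near0.
have Phid0 := young_ge0 (ltW d0).
case: (Phi d%:E) Phid Phid0 (@young_scale d) => // r _ + H; rewrite lee_fin => r0.
pose l := (y / (r + y))%R.
have ry : (0 < r + y)%R by rewrite ltr_wpDl.
exists (l * d)%R; first by rewrite mulr_gt0// divr_gt0.
apply: le_trans (H _ (ltW d0) _) _.
  by rewrite divr_ge0 ?(ltW y0) ?(ltW ry)//= ler_pdivrMr// mul1r lerDr.
rewrite -EFinM lee_fin /l mulrAC ler_pdivrMr//.
by rewrite ler_wpM2l ?(ltW y0)// lerDl ltW.
Qed.

Lemma young_inv_gt0 (y : R) : (0 < y)%R ->
  exists2 a : R, (0 < a)%R & young_inv Phi y%:E = a%:E.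
Proof.
move=> y0; have [z z0 yz] := young_unbounded y; have [e e0 Phie] := young_small y0.
have le_z : young_inv Phi y%:E <= z%:E.
  by apply: ereal_inf_lbound; split.
have ge_e : e%:E <= young_inv Phi y%:E.
  apply: le_ereal_inf_tmp => x [x0 yx]; rewrite leNgt; apply/negP => xe.
  move: x x0 yx xe => [x| |]//; rewrite !lte_fin => x0 yx xe.
  move: yx; rewrite ltNge => /negP; apply; apply: le_trans Phie.
  by apply: young_le; rewrite !ltW.
have fin : young_inv Phi y%:E \is a fin_num.
  rewrite fin_numE; apply/andP; split.
    by rewrite gt_eqF// (lt_le_trans _ ge_e)// ltNyr.
  by rewrite lt_eqF// (le_lt_trans le_z)// ltry.
exists (fine (young_inv Phi y%:E)); last by rewrite fineK.
by rewrite -lte_fin fineK// (lt_le_trans _ ge_e)// lte_fin.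
Qed.

Lemma le_of_lt_young_inv (x y : R) : (0 <= x)%R -> (0 <= y)%R ->
  x%:E < young_inv Phi y%:E -> Phi x%:E <= y%:E.
Proof.
rewrite le_eqVlt => /predU1P[<- y0 _|x0 y0]; first by rewrite young0 lee_fin.
rewrite leNgt => xy; apply/negP => yx; move: xy; rewrite ltNge => /negP; apply.
by apply: ereal_inf_lbound; split.
Qed.

Lemma le_young_inv (x y : R) : (0 <= x)%R -> Phi x%:E <= y%:E ->
  x%:E <= young_inv Phi y%:E.
Proof.
move=> x0 xy; apply: le_ereal_inf_tmp => z [z0 yz]; rewrite leNgt; apply/negP.
move: z z0 yz => [z| |]//; rewrite !lte_fin => z0 yz zx.
move: yz; rewrite ltNge => /negP; apply; apply: le_trans xy.
by apply: young_le; rewrite !ltW.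
Qed.

(** [Phi x > l s] implies [Phi (x / l) >= Phi x / l > s].  For [s > 0] it says
    that [young_inv Phi s / s] is nonincreasing. *)
Lemma young_inv_scale (s l : R) : (0 < l <= 1)%R ->
  l%:E * young_inv Phi s%:E <= young_inv Phi (l * s)%:E.
Proof.
move=> /andP[l0 l1]; apply: le_ereal_inf_tmp => -[x| |] [x0 lsx]; [|by rewrite leey|by []].
rewrite lte_fin in x0.
rewrite -lee_pdivlMl// -EFinM; apply: ereal_inf_lbound; split.
  by rewrite lte_fin mulr_gt0// invr_gt0.
have := @young_scale (l^-1 * x) l; rewrite mulrA divff ?gt_eqF// mul1r => H.
rewrite -(@lte_pmul2l _ l%:E)// -EFinM; apply: (lt_le_trans lsx); apply: H.
  by rewrite mulr_ge0 ?invr_ge0 ?ltW.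
by rewrite l1 ltW.
Qed.

Lemma young_three_slopes (x m z p q r : R) : (0 <= x)%R -> (x < m < z)%R ->
  Phi x%:E = p%:E -> Phi m%:E = q%:E -> Phi z%:E = r%:E ->
  ((q - p) / (m - x) <= (r - q) / (z - m))%R.
Proof.
move=> x0 /andP[xm mz] Px Pm Pz.
have zx : (0 < z - x)%R by rewrite subr_gt0 (lt_trans xm).
have l01 : (0 <= (z - m) / (z - x) <= 1)%R.
  by rewrite divr_ge0 ?subr_ge0 ?(ltW mz) ?(ltW zx)//= ?ler_pdivrMr//; lra.
have z0 : (0 <= z)%R by lra.
have := young_convex x0 z0 l01.
have zx0 : (z - x)%R != 0%R by rewrite gt_eqF.
rewrite (_ : (z - m) / (z - x) * x + (1 - (z - m) / (z - x)) * z = m)%R; last by field.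
rewrite Px Pm Pz -!EFinM -EFinD lee_fin.
rewrite (_ : (z - m) / (z - x) * p + (1 - (z - m) / (z - x)) * r =
  ((z - m) * p + (m - x) * r) / (z - x))%R; last by field.
rewrite ler_pdivlMr// => H.
rewrite ler_pdivrMr ?subr_gt0// mulrAC ler_pdivlMr ?subr_gt0//.
by lra.
Qed.

(** The slope is the supremum of the slopes of the chords on the left of [m];
    it is finite because [Phi] is finite somewhere on the right of [m].  The
    inequality is written with nonnegative terms only, ready for integration
    in the extended reals. *)
Lemma young_subgradient (m z : R) : (0 <= m < z)%R -> Phi z%:E < +oo ->
  exists2 c : R, (0 <= c)%R & forall y : R, (0 <= y)%R ->
    Phi m%:E + (c * y)%:E <= Phi y%:E + (c * m)%:E.
Proof.
move=> /andP[m0 mz] Phiz.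
have [m_eq0|m_neq0] := eqVneq m 0%R.
  exists 0%R => // y y0; rewrite m_eq0 young0 add0e !mul0r adde0.
  exact: young_ge0.
have mgt0 : (0 < m)%R by rewrite lt_neqAle eq_sym m_neq0.
have finle (y : R) : (0 <= y <= z)%R -> exists2 p : R, (0 <= p)%R & Phi y%:E = p%:E.
  move=> /andP[y0 yz].
  have : Phi y%:E < +oo by apply: le_lt_trans Phiz; apply: young_le; rewrite y0.
  have := young_ge0 y0; case: (Phi y%:E) => // p; rewrite lee_fin => p0 _.
  by exists p.
have [q q0 Pm] : exists2 p : R, (0 <= p)%R & Phi m%:E = p%:E.
  by apply: finle; rewrite m0 ltW.
have [r r0 Pz] : exists2 p : R, (0 <= p)%R & Phi z%:E = p%:E.
  by apply: finle; rewrite lexx (le_trans m0) ?ltW.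
pose S := [set s | exists x p : R, [/\ (0 <= x < m)%R, Phi x%:E = p%:E &
  s = ((q - p) / (m - x))%R]].
have S_q : S ((q - 0) / (m - 0))%R.
  by exists 0%R, 0%R; split => //; [rewrite lexx mgt0|exact: young0].
have ubS (y r' : R) : (m < y)%R -> Phi y%:E = r'%:E -> ubound S ((r' - q) / (y - m))%R.
  move=> my Py _ [x [p [/andP[x0 xm] Px ->]]].
  by apply: (@young_three_slopes x) => //; rewrite xm.
have hS : has_ubound S by exists ((r - q) / (z - m))%R; exact: ubS.
exists (sup S).
  apply: le_trans (ub_le_sup hS S_q).
  by rewrite !subr0 divr_ge0.
move=> y y0; rewrite Pm; have [ym|my|->] := ltgtP y m; last by rewrite Pm.
- have [p p0 Py] : exists2 p : R, (0 <= p)%R & Phi y%:E = p%:E.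
    by apply: finle; rewrite y0 ltW// (lt_trans ym).
  rewrite Py -!EFinD lee_fin.
  have : S ((q - p) / (m - y))%R by exists y, p; split => //; rewrite y0.
  move/(ub_le_sup hS); rewrite ler_pdivrMr ?subr_gt0//.
  lra.
- case Py : (Phi y%:E) (young_ge0 y0) => [r'| |]//; last by move=> _; rewrite addye// leey.
  rewrite lee_fin => r'0; rewrite -!EFinD lee_fin.
  have := ge_sup (ex_intro _ _ S_q) (ubS _ _ my Py).
  rewrite ler_pdivlMr ?subr_gt0//.
  lra.
Qed.

Lemma measurable_young_comp d (T : measurableType d) (f : T -> R) :
  (forall x, (0 <= f x)%R) -> measurable_fun setT f ->
  measurable_fun setT (fun x => Phi (f x)%:E).
Proof.
move=> f0 mf; apply: (measurability _ (ErealGenOInfty.measurableE R)) => //.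
move=> _ [_ [x ->] <-]; rewrite setTI.
rewrite (_ : _ @^-1` _ = setT `&` f @^-1` [set r | (0 <= r)%R /\ x%:E < Phi r%:E]).
  apply: mf => //; apply: is_interval_measurable => a b /= [a0 xa] [b0 xb] c.
  move=> /andP[ac cb]; split; first exact: le_trans ac.
  by apply: (lt_le_trans xa); apply: young_le; rewrite a0.
rewrite setTI; apply/seteqP; split => t /=; rewrite in_itv/= andbT//.
by case.
Qed.

End young.

Section jensen.
Context {R : realType} d (T : measurableType d) (mu : {measure set T -> \bar R}).
Variables (Phi : \bar R -> \bar R) (g f : T -> R).
Hypotheses (yPhi : young Phi) (mg : measurable_fun setT g)
  (mf : measurable_fun setT f) (g0 : forall x, 0 < g x) (f0 : forall x, 0 <= f x).
Local Open Scope ereal_scope.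

(** [Phi] need not be lower semicontinuous at the right end of its domain, so
    the mean [m] may be a point without subgradient.  In that case [Phi] is
    infinite beyond [m]; if the right-hand side is finite then [f <= m] almost
    everywhere, and as [m] is the mean of [f], [f = m] almost everywhere. *)
Lemma jensen_density : \int[mu]_x (g x)%:E = 1 ->
  forall m : R, \int[mu]_x (g x * f x)%:E = m%:E ->
  Phi m%:E <= \int[mu]_x ((g x)%:E * Phi (f x)%:E).
Proof.
move=> ig1 m igf.
have mgf : measurable_fun setT (fun x => (g x * f x)%:E).
  by apply/measurable_EFinP; exact: measurable_funM.
have mg' : measurable_fun setT (fun x => (g x)%:E) by exact/measurable_EFinP.
have gf0 x : 0 <= (g x * f x)%:E by rewrite lee_fin mulr_ge0// ltW.
have g0' x : 0 <= (g x)%:E by rewrite lee_fin ltW.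
have m0 : (0 <= m)%R by rewrite -lee_fin -igf; exact: integral_ge0.
have mPhif := measurable_young_comp yPhi f0 mf.
have Phif0 x : 0 <= Phi (f x)%:E by exact: young_ge0.
have mgPhi : measurable_fun setT (fun x => (g x)%:E * Phi (f x)%:E).
  exact: emeasurable_funM.
have gPhi0 x : 0 <= (g x)%:E * Phi (f x)%:E by exact: mule_ge0.
have [[z /andP[mz Phiz]]|nz] := pselect (exists z, (m < z)%R && (Phi z%:E < +oo)).
  have [|c c0 cP] := @young_subgradient _ _ yPhi m z _ Phiz; first by rewrite m0.
  have Pm0 := young_ge0 yPhi m0.
  have : \int[mu]_x (Phi m%:E * (g x)%:E + c%:E * (g x * f x)%:E) <=
      \int[mu]_x ((g x)%:E * Phi (f x)%:E + (c * m)%:E * (g x)%:E).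
    apply: ge0_le_integral => //.
    - by move=> x _; rewrite adde_ge0 ?mule_ge0.
    - by apply: emeasurable_funD; apply: emeasurable_funM.
    - by apply: emeasurable_funD => //; apply: emeasurable_funM.
    - move=> x _; rewrite !(muleC _ (g x)%:E) EFinM muleCA -!muleDr ?fin_num_adde_defl//.
        by apply: lee_wpmul2l => //; rewrite -EFinM; exact: cP.
  rewrite ge0_integralD//; last 4 first.
  - by move=> x _; rewrite mule_ge0.
  - exact: emeasurable_funM.
  - by move=> x _; rewrite mule_ge0.
  - exact: emeasurable_funM.
  rewrite ge0_integralZl// ig1 mule1 ge0_integralZl// igf.
  rewrite ge0_integralD//; last 2 first.
  - by move=> x _; rewrite mule_ge0// lee_fin mulr_ge0.
  - exact: emeasurable_funM.
  rewrite ge0_integralZl_EFin//; last by rewrite mulr_ge0.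
  by rewrite ig1 mule1 -EFinM leeD2rE.
(* From here on, Phi is infinite on the right of m. *)
have {}nz y : (m < y)%R -> Phi y%:E = +oo.
  move=> my; apply/eqP; rewrite -leye_eq leNgt; apply/negP => Py.
  by apply: nz; exists y; rewrite my.
have [Ioo|Ifin] := eqVneq (\int[mu]_x ((g x)%:E * Phi (f x)%:E)) +oo.
  by rewrite Ioo leey.
have intPhi : mu.-integrable setT (fun x => (g x)%:E * Phi (f x)%:E).
  apply/integrableP; split => //.
  by under eq_integral do rewrite gee0_abs//; rewrite ltey.
have fm : {ae mu, forall x, (f x <= m)%R}.
  have := integrable_ae measurableT intPhi; apply: filterS => x /(_ I).
  move=> fin; rewrite leNgt; apply/negP => /nz Pf; move: fin.
  by rewrite Pf gt0_muley// lte_fin.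
have intg : mu.-integrable setT (fun x => (g x)%:E).
  apply/integrableP; split => //.
  by under eq_integral do rewrite gee0_abs//; rewrite ig1 ltry.
have intgf : mu.-integrable setT (fun x => (g x * f x)%:E).
  apply/integrableP; split => //.
  by under eq_integral do rewrite gee0_abs//; rewrite igf ltry.
have : ae_eq mu setT (fun x => m%:E * (g x)%:E - (g x * f x)%:E) (cst 0).
  apply/ae_eq_integral_abs => //.
    by apply: emeasurable_funB => //; apply: emeasurable_funM.
  transitivity (\int[mu]_x (m%:E * (g x)%:E - (g x * f x)%:E)).
    apply: ae_eq_integral => //.
    - apply: measurableT_comp => //.
      by apply: emeasurable_funB => //; apply: emeasurable_funM.
    - by apply: emeasurable_funB => //; apply: emeasurable_funM.
    - apply: filterS fm => x fxm _; rewrite gee0_abs// -EFinM -EFinB lee_fin.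
      by rewrite mulrC -mulrBr mulr_ge0 ?subr_ge0// ltW.
  rewrite integralB//; last exact: integrableZl.
  by rewrite integralZl// ig1 igf mule1 subee.
move=> fm_eq.
rewrite (_ : Phi m%:E = \int[mu]_x (Phi m%:E * (g x)%:E)); last first.
  by rewrite ge0_integralZl// ?ig1 ?mule1//; exact: young_ge0.
rewrite le_eqVlt; apply/orP; left; apply/eqP.
apply: ae_eq_integral => //; first exact: emeasurable_funM.
apply: filterS fm_eq => x /(_ I)/= H _; rewrite muleC; congr (_ * Phi _%:E).
move: H; rewrite -EFinM -EFinB => -[]/eqP.
by rewrite mulrC -mulrBr mulf_eq0 gt_eqF//= subr_eq0 => /eqP.
Qed.

End jensen.

(** * Modulars and Luxemburg norms on a measure space *)

Section orlicz_norm.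
Local Open Scope ereal_scope.
Context {R : realType} d (T : measurableType d) (mu : {measure set T -> \bar R}).
Implicit Types (u v : T -> R) (k : R) (Phi : \bar R -> \bar R).

(** The modular and the norm are needed both for the completed measure
    [leb n], on which the spaces are defined, and for [borel_lebesgue n], on
    which Fubini's theorem is used. *)
Definition orlicz_modular Phi u k := \int[mu]_x Phi (`|u x| / k)%:E.

Definition orlicz_norm Phi u : \bar R :=
  ereal_inf [set k%:E | k in [set k : R | (0 < k)%R /\ orlicz_modular Phi u k <= 1]].

Variable Phi : \bar R -> \bar R.
Hypothesis yPhi : young Phi.
Local Notation lmeas u := (measurable_fun [set: T] u).

Let absk_ge0 u k x : (0 < k)%R -> (0 <= `|u x| / k)%R.
Proof. by move=> k0; rewrite divr_ge0// ltW. Qed.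

Lemma measurable_absk u k : lmeas u -> lmeas (fun x => (`|u x| / k)%R).
Proof.
by move=> mu_; apply: measurable_funM => //; exact: measurableT_comp.
Qed.

Lemma measurable_young_absk u k : (0 < k)%R -> lmeas u ->
  measurable_fun [set: T] (fun x : T => Phi (`|u x| / k)%:E).
Proof.
move=> k0 mu_; apply: (measurable_young_comp yPhi); last exact: measurable_absk.
by move=> x; exact: absk_ge0.
Qed.

Lemma young_absk_ge0 u k x : (0 < k)%R -> 0 <= Phi (`|u x| / k)%:E.
Proof. by move=> k0; apply: (young_ge0 yPhi); exact: absk_ge0. Qed.

Lemma orlicz_modular_ge0 u k : (0 < k)%R -> 0 <= orlicz_modular Phi u k.
Proof. by move=> k0; apply: integral_ge0 => x _; exact: young_absk_ge0. Qed.

Lemma le_orlicz_modular u v k : (0 < k)%R -> lmeas u -> lmeas v ->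
  (forall x, `|u x| <= `|v x|)%R -> orlicz_modular Phi u k <= orlicz_modular Phi v k.
Proof.
move=> k0 mu_ mv uv; apply: ge0_le_integral => //.
- by move=> x _; exact: young_absk_ge0.
- exact: measurable_young_absk.
- exact: measurable_young_absk.
- move=> x _; apply: (young_le yPhi); rewrite absk_ge0//=.
  by rewrite ler_pM2r ?invr_gt0.
Qed.

Lemma ae_eq_orlicz_modular u v k : (0 < k)%R -> lmeas u -> lmeas v -> ae_eq mu setT u v ->
  orlicz_modular Phi u k = orlicz_modular Phi v k.
Proof.
move=> k0 mu_ mv uv; apply: ge0_ae_eq_integral => //.
- exact: measurable_young_absk.
- exact: measurable_young_absk.
- by move=> x _; exact: young_absk_ge0.
- by move=> x _; exact: young_absk_ge0.
- by apply: filterS uv => x /= + _ => /(_ I) ->.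
Qed.

Lemma orlicz_modular_antitone u k k' : (0 < k)%R -> (k <= k')%R -> lmeas u ->
  orlicz_modular Phi u k' <= orlicz_modular Phi u k.
Proof.
move=> k0 kk' mu_; have k'0 := lt_le_trans k0 kk'.
apply: ge0_le_integral => //.
- by move=> x _; exact: young_absk_ge0.
- exact: measurable_young_absk.
- exact: measurable_young_absk.
- move=> x _; apply: (young_le yPhi); rewrite absk_ge0//=.
  by rewrite ler_wpM2l// lef_pV2.
Qed.

Lemma orlicz_norm_ge0 u : 0 <= orlicz_norm Phi u.
Proof.
by apply: le_ereal_inf_tmp => _ [k [k0 _] <-]; rewrite lee_fin ltW.
Qed.

Lemma orlicz_norm_le u k : (0 < k)%R -> orlicz_modular Phi u k <= 1 ->
  orlicz_norm Phi u <= k%:E.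
Proof. by move=> k0 uk; apply: ereal_inf_lbound; exists k. Qed.

Lemma orlicz_modular_le1 u k : lmeas u -> orlicz_norm Phi u < k%:E ->
  (0 < k)%R /\ orlicz_modular Phi u k <= 1.
Proof.
move=> mu_ /ereal_inf_lt[_ [k' [k'0 uk'] <-]]; rewrite lte_fin => k'k.
split; first exact: lt_trans k'k.
by apply: le_trans uk'; apply: orlicz_modular_antitone => //; exact: ltW.
Qed.

Lemma le_orlicz_norm u v : lmeas u -> lmeas v ->
  (forall x, `|u x| <= `|v x|)%R -> orlicz_norm Phi u <= orlicz_norm Phi v.
Proof.
move=> mu_ mv uv; apply: le_ereal_inf_tmp => _ [k [k0 vk] <-].
by apply: orlicz_norm_le => //; apply: le_trans vk; exact: le_orlicz_modular.
Qed.

Lemma ae_eq_orlicz_norm u v : lmeas u -> lmeas v -> ae_eq mu setT u v ->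
  orlicz_norm Phi u = orlicz_norm Phi v.
Proof.
move=> mu_ mv uv; rewrite /orlicz_norm; congr ereal_inf.
by apply/seteqP; split => _ [k [k0 uk] <-]; exists k => //; split => //;
   rewrite ?(ae_eq_orlicz_modular k0 mu_ mv uv)// -(ae_eq_orlicz_modular k0 mu_ mv uv).
Qed.

Lemma orlicz_norm0 : orlicz_norm Phi (fun _ : T => 0%R) = 0.
Proof.
apply/eqP; rewrite eq_le orlicz_norm_ge0 andbT.
apply/lee_addgt0Pr => e e0; rewrite add0e; apply: orlicz_norm_le => //.
rewrite /orlicz_modular; under eq_integral do rewrite normr0 mul0r (young0 yPhi).
by rewrite integral0.
Qed.

Lemma orlicz_normZ (c : R) u : (0 <= c)%R ->
  orlicz_norm Phi (fun x => c * u x)%R <= c%:E * orlicz_norm Phi u.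
Proof.
rewrite le_eqVlt => /predU1P[<-|c0].
  by under [X in orlicz_norm _ X]eq_fun do rewrite mul0r; rewrite orlicz_norm0 mul0e.
rewrite -lee_pdivrMl//; apply: le_ereal_inf_tmp => _ [k [k0 uk] <-].
rewrite lee_pdivrMl// -EFinM; apply: orlicz_norm_le; first exact: mulr_gt0.
apply: le_trans uk; rewrite /orlicz_modular.
under eq_integral => x _.
  rewrite normrM (ger0_norm (ltW c0)) -mulf_div divff ?gt_eqF// mul1r.
  over.
by [].
Qed.

(** Convexity of [Phi] with weights [a / (a + b)] and [b / (a + b)], for [a] and
    [b] slightly above the two norms. *)
Lemma orlicz_normD u v : lmeas u -> lmeas v ->
  orlicz_norm Phi (u \+ v)%R <= orlicz_norm Phi u + orlicz_norm Phi v.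
Proof.
move=> mu_ mv.
case Eu : (orlicz_norm Phi u) (orlicz_norm_ge0 u) => [a| |]// a0; last first.
  by rewrite addye ?leey// gt_eqF// (lt_le_trans _ (orlicz_norm_ge0 v)).
case Ev : (orlicz_norm Phi v) (orlicz_norm_ge0 v) => [b| |]// b0; last first.
  by rewrite addey ?leey.
rewrite !lee_fin in a0 b0.
apply/lee_addgt0Pr => e e0.
pose a' := (a + e / 2)%R; pose b' := (b + e / 2)%R.
have e20 : (0 < e / 2)%R by rewrite divr_gt0.
have [a'0 ua] : (0 < a')%R /\ orlicz_modular Phi u a' <= 1.
  by apply: orlicz_modular_le1 => //; rewrite Eu lte_fin ltrDl.
have [b'0 vb] : (0 < b')%R /\ orlicz_modular Phi v b' <= 1.
  by apply: orlicz_modular_le1 => //; rewrite Ev lte_fin ltrDl.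
have ab0 : (0 < a' + b')%R by rewrite addr_gt0.
rewrite -!EFinD (_ : a + b + e = a' + b')%R; last by rewrite /a' /b'; field.
apply: orlicz_norm_le => //.
pose l := (a' / (a' + b'))%R.
have l01 : (0 <= l <= 1)%R.
  by rewrite divr_ge0 ?(ltW a'0) ?(ltW ab0)//= ler_pdivrMr// mul1r lerDl ltW.
have l'0 : (0 <= 1 - l)%R by rewrite subr_ge0; case/andP: l01.
apply: (@le_trans _ _ (\int[mu]_x (l%:E * Phi (`|u x| / a')%:E +
    (1 - l)%:E * Phi (`|v x| / b')%:E))).
  apply: ge0_le_integral => //.
  - by move=> x _; exact: young_absk_ge0.
  - by apply: measurable_young_absk => //; exact: measurable_funD.
  - by apply: emeasurable_funD; apply: emeasurable_funM => //; exact: measurable_young_absk.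
  - move=> x _; apply: le_trans (young_convex yPhi _ _ l01); try exact: absk_ge0.
    apply: (young_le yPhi); rewrite absk_ge0//=.
    rewrite [leRHS](_ : _ = (`|u x| + `|v x|) / (a' + b'))%R; last first.
      by rewrite /l; field; rewrite !gt_eqF.
    by rewrite ler_pM2r ?invr_gt0// ler_normD.
have mu' := measurable_young_absk a'0 mu_.
have mv' := measurable_young_absk b'0 mv.
have u0 x : 0 <= Phi (`|u x| / a')%:E by exact: young_absk_ge0.
have v0 x : 0 <= Phi (`|v x| / b')%:E by exact: young_absk_ge0.
have l0 : (0 <= l)%R by case/andP: l01.
rewrite ge0_integralD//; last 4 first.
- by move=> x _; rewrite mule_ge0.
- exact: emeasurable_funM.
- by move=> x _; rewrite mule_ge0.
- exact: emeasurable_funM.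
rewrite !ge0_integralZl_EFin//.
apply: (@le_trans _ _ (l%:E * 1 + (1 - l)%:E * 1)).
  by apply: leeD; apply: lee_wpmul2l.
by rewrite !mule1 -EFinD lee_fin addrCA subrr addr0.
Qed.

(** A finite modular is brought below 1 by increasing [k], since
    [Phi (l x) <= l Phi x] for [l] in the unit interval. *)
Lemma orlicz_norm_lty u : lmeas u -> (exists2 k : R, (0 < k)%R & orlicz_modular Phi u k < +oo) -> orlicz_norm Phi u < +oo.
Proof.
move=> mu_ [k k0 uk].
case Eu : (orlicz_modular Phi u k) (orlicz_modular_ge0 u k0) uk => [M| |]// M0 _.
rewrite lee_fin in M0.
have M10 : (0 < 1 + M)%R by rewrite ltr_pwDl.
have kM0 : (0 < k * (1 + M))%R by exact: mulr_gt0.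
apply: le_lt_trans (ltry (k * (1 + M)))%R; apply: orlicz_norm_le => //.
have Ml : (0 <= (1 + M)^-1 <= 1)%R.
  by rewrite invr_ge0 (ltW M10)/= invf_le1// lerDl.
apply: (@le_trans _ _ (\int[mu]_x ((1 + M)^-1%:E * Phi (`|u x| / k)%:E))).
  apply: ge0_le_integral => //.
  - by move=> x _; exact: young_absk_ge0.
  - exact: measurable_young_absk.
  - by apply: emeasurable_funM => //; exact: measurable_young_absk.
  - move=> x _; apply: le_trans (young_scale yPhi _ Ml); last exact: absk_ge0.
    by rewrite [((1 + M)^-1 * _)%R]mulrC invfM mulrA.
rewrite ge0_integralZl_EFin//.
- rewrite -/(orlicz_modular Phi u k) Eu -EFinM lee_fin ler_pdivrMl// mulr1.
  by rewrite lerDr.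
- by move=> x _; exact: young_absk_ge0.
- exact: measurable_young_absk.
- by case/andP: Ml.
Qed.

Lemma orlicz_norm_ltyP u : lmeas u ->
  orlicz_norm Phi u < +oo <-> exists2 k : R, (0 < k)%R & orlicz_modular Phi u k < +oo.
Proof.
move=> mu_; split; last exact: orlicz_norm_lty.
move=> /ereal_inf_lt[_ [k [k0 uk] <-] _].
by exists k => //; apply: le_lt_trans uk _; exact: ltry.
Qed.

End orlicz_norm.

(** * Averages against doubly stochastic kernels *)

Section orlicz_weight.
Local Open Scope ereal_scope.
Context {R : realType} d (T : measurableType d) (mu : {measure set T -> \bar R}).
Variables (Phi : \bar R -> \bar R) (yPhi : young Phi).

(** The linear lower bound on [Phi] dominates [|u|] by a multiple of
    [Phi (|u| / k) + b]: the first term is integrable against a bounded weight,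
    the second against an integrable one. *)
Lemma orlicz_weight_integrable (g : T -> R) (B : R) (u : T -> R) (k : R) :
  (0 <= B)%R -> measurable_fun setT g -> (forall y, 0 <= g y <= B)%R -> \int[mu]_y (g y)%:E < +oo ->
  measurable_fun setT u -> (0 < k)%R -> orlicz_modular mu Phi u k < +oo ->
  mu.-integrable setT (fun y => (g y * u y)%:E).
Proof.
move=> B0 mr gB gfin mu_ k0 uk.
have [a [b [a0 b0 ab]]] := young_linear_lower_bound yPhi.
have g0w y : (0 <= g y)%R by case/andP: (gB y).
have mPhi := measurable_young_absk yPhi k0 mu_.
have Phi0 y : 0 <= Phi (`|u y| / k)%:E by exact: (young_absk_ge0 yPhi).
apply/integrableP; split.
  by apply/measurable_EFinP; exact: measurable_funM.
apply: (@le_lt_trans _ _ (\int[mu]_y ((k / a)%:E *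
    (B%:E * Phi (`|u y| / k)%:E + b%:E * (g y)%:E)))).
  apply: ge0_le_integral => //.
  - by apply: measurableT_comp => //; apply/measurable_EFinP; exact: measurable_funM.
  - apply: emeasurable_funM => //; apply: emeasurable_funD; apply: emeasurable_funM => //.
    exact/measurable_EFinP.
  - move=> y _ /=; rewrite normrM ger0_norm//.
    have uy0 : (0 <= `|u y| / k)%R by rewrite divr_ge0 ?(ltW k0).
    (* The bound a (|u| / k) - b <= Phi (|u| / k), weighted by g <= B. *)
    have H1 : (g y)%:E * (a * (`|u y| / k) - b)%:E <= B%:E * Phi (`|u y| / k)%:E.
      apply: (@le_trans _ _ ((g y)%:E * Phi (`|u y| / k)%:E)).
        by apply: lee_wpmul2l; [rewrite lee_fin|exact: ab].
      by apply: lee_wpmul2r; [exact: Phi0|rewrite lee_fin; case/andP: (gB y)].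
    apply: (@le_trans _ _ (k / a * (g y * (a * (`|u y| / k) - b) + b * g y))%:E).
      rewrite lee_fin le_eqVlt; apply/orP; left; apply/eqP.
      by field; rewrite !gt_eqF.
    rewrite EFinM EFinD (EFinM (g y)) (EFinM b).
    by apply: lee_wpmul2l; [rewrite lee_fin divr_ge0 ?ltW|exact: leeD2r].
rewrite ge0_integralZl_EFin//; last 3 first.
- by move=> y _; rewrite adde_ge0// mule_ge0// lee_fin.
- apply: emeasurable_funD; apply: emeasurable_funM => //.
  exact/measurable_EFinP.
- by rewrite divr_ge0 ?ltW.
apply: lte_mul_pinfty => //; first by rewrite lee_fin divr_ge0 ?ltW.
rewrite ge0_integralD//; last 4 first.
- by move=> y _; rewrite mule_ge0.
- exact: emeasurable_funM.
- by move=> y _; rewrite mule_ge0// lee_fin.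
- by apply: emeasurable_funM => //; exact/measurable_EFinP.
rewrite !ge0_integralZl_EFin//; last 2 first.
- by move=> y _; rewrite lee_fin.
- exact/measurable_EFinP.
by apply: lte_add_pinfty; apply: lte_mul_pinfty.
Qed.

(** An average of [psi] is close to [c] if [psi] is close to [c] up to an error
    which is itself controlled by a second average; the weights will be heat
    kernels at times [t] and [2 t]. *)
Lemma weighted_average_close (g1 g2 psi : T -> R) (c w q : R) :
  measurable_fun setT g1 -> measurable_fun setT g2 -> measurable_fun setT psi ->
  (forall y, 0 <= g1 y)%R -> (forall y, 0 <= g2 y)%R ->
  \int[mu]_y (g1 y)%:E = 1 -> \int[mu]_y (g2 y)%:E = 1 ->
  mu.-integrable setT (fun y => (g1 y * psi y)%:E) ->
  mu.-integrable setT (fun y => (g2 y * `|psi y|)%:E) ->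
  (0 <= w)%R -> (0 <= q)%R ->
  (forall y, g1 y * `|psi y - c| <= w * g1 y + q * (g2 y * (`|psi y| + `|c|)))%R ->
  (`| (\int[mu]_y (g1 y * psi y)) - c | <=
    w + q * (\int[mu]_y (g2 y * `|psi y|) + `|c|))%R.
Proof.
move=> m1 m2 mpsi g10 g20 i1 i2 ig1 ig2 w0 q0 H.
have int1 : mu.-integrable setT (fun y => (g1 y)%:E).
  apply/integrableP; split; first exact/measurable_EFinP.
  by under eq_integral do rewrite gee0_abs ?lee_fin//; rewrite i1 ltry.
have int2 : mu.-integrable setT (fun y => (g2 y)%:E).
  apply/integrableP; split; first exact/measurable_EFinP.
  by under eq_integral do rewrite gee0_abs ?lee_fin//; rewrite i2 ltry.
have R1 : (\int[mu]_y (g1 y))%R = 1%R by rewrite /Rintegral i1.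
have R2 : (\int[mu]_y (g2 y))%R = 1%R by rewrite /Rintegral i2.
have intc (f : T -> R) (a : R) : mu.-integrable setT (fun y => (f y)%:E) ->
    mu.-integrable setT (EFin \o (fun y => a * f y)%R).
  move=> fi; have := integrableZl measurableT a fi; exact: eq_integrable.
have intD (f h : T -> R) : mu.-integrable setT (EFin \o f) ->
    mu.-integrable setT (EFin \o h) -> mu.-integrable setT (EFin \o (fun y => f y + h y)%R).
  move=> fi hi; have := integrableD measurableT fi hi; exact: eq_integrable.
have -> : ((\int[mu]_y (g1 y * psi y)) - c = \int[mu]_y (g1 y * psi y + (- c) * g1 y))%R.
  rewrite (RintegralD (f2 := fun y => ((- c) * g1 y)%R) measurableT ig1); last exact: intc.
  by rewrite RintegralZl// R1 mulr1.
have intL : mu.-integrable setT (EFin \o (fun y => g1 y * psi y + (- c) * g1 y)%R).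
  by apply: intD => //; exact: intc.
have int2' : mu.-integrable setT (EFin \o (fun y => g2 y * `|psi y| + `|c| * g2 y)%R).
  by apply: intD => //; exact: intc.
have intR : mu.-integrable setT (EFin \o (fun y => w * g1 y +
    q * (g2 y * `|psi y| + `|c| * g2 y))%R).
  by apply: intD; exact: intc.
apply: (le_trans (le_normr_Rintegral measurableT intL)).
apply: (@le_trans _ _ (\int[mu]_y (w * g1 y + q * (g2 y * `|psi y| + `|c| * g2 y)))%R).
  apply: le_Rintegral => //; first exact: integrable_norm.
  move=> y _; apply: le_trans (le_trans (H y) _).
    by rewrite mulNr (mulrC c) -mulrBr normrM ger0_norm.
  by rewrite mulrDr (mulrC _ `|c|%R).
rewrite (RintegralD (f1 := fun y => (w * g1 y)%R)
  (f2 := fun y => (q * (g2 y * `|psi y| + `|c| * g2 y))%R))//; try exact: intc.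
rewrite !RintegralZl// R1 mulr1.
rewrite (RintegralD (f1 := fun y => (g2 y * `|psi y|)%R)
  (f2 := fun y => (`|c| * g2 y)%R))//; last exact: intc.
by rewrite RintegralZl// R2 mulr1.
Qed.

End orlicz_weight.

Section kernel_operator.
Local Open Scope ereal_scope.
Context {R : realType} d (T : measurableType d) (mu : {sigma_finite_measure set T -> \bar R}).
Implicit Types (g : T -> T -> R) (u v : T -> R).

Definition kernel_op g u (x : T) : R := (\int[mu]_y (g x y * u y))%R.

Definition kernel_integrable g u :=
  forall x, mu.-integrable setT (fun y => (g x y * u y)%:E).

(** Unit mass of the rows makes [kernel_op] an average, so that Jensen's
    inequality applies; unit mass of the columns makes it preserve integrals. *)
Record bistochastic g := Bistochastic {
  bistochastic_gt0 : forall x y, (0 < g x y)%R ;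
  bistochastic_measurable : measurable_fun setT (fun p : T * T => g p.1 p.2) ;
  bistochastic_row : forall x, \int[mu]_y (g x y)%:E = 1 ;
  bistochastic_col : forall y, \int[mu]_x (g x y)%:E = 1 }.

Lemma kernel_op_linear g u v (a : R) :
  kernel_integrable g u -> kernel_integrable g v ->
  forall x, kernel_op g (fun y => a * u y + v y)%R x =
    (a * kernel_op g u x + kernel_op g v x)%R.
Proof.
move=> gu gv x; rewrite /kernel_op.
rewrite -(RintegralZl (mu := mu) (f := fun y => (g x y * u y)%R) a measurableT (gu x)).
rewrite -(RintegralD (mu := mu) (f1 := fun y => (a * (g x y * u y))%R)
  (f2 := fun y => (g x y * v y)%R) measurableT _ (gv x)).
  by apply: eq_Rintegral => y _; rewrite mulrDr mulrCA.
have := integrableZl measurableT a (gu x); exact: eq_integrable.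
Qed.

Variable g : T -> T -> R.
Hypothesis bg : bistochastic g.
Let g0 := bistochastic_gt0 bg.
Let mg2 := bistochastic_measurable bg.
Let g0w x y : (0 <= g x y)%R. Proof. exact/ltW/g0. Qed.

Lemma measurable_kernel_row x : measurable_fun setT (g x).
Proof. exact: (measurableT_comp mg2 (pair1_measurable x)). Qed.

Lemma measurable_kernel_col y : measurable_fun setT (g ^~ y).
Proof. exact: (measurableT_comp mg2 (pair2_measurable y)). Qed.

Let mrow := measurable_kernel_row.

Let mgu2 u : measurable_fun setT u ->
  measurable_fun setT (fun p : T * T => (g p.1 p.2 * u p.2)%:E).
Proof.
move=> mu_; apply/measurable_EFinP; apply: measurable_funM => //.
exact: (measurableT_comp mu_ measurable_snd).
Qed.

Lemma measurable_kernel_op u : measurable_fun setT u ->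
  measurable_fun setT (kernel_op g u).
Proof.
move=> mu_; rewrite /kernel_op /Rintegral; apply: (measurableT_comp (fine_measurable measurableT)).
pose f (p : T * T) := (g p.1 p.2 * u p.2)%:E.
have mf : measurable_fun setT f := mgu2 mu_.
under eq_fun do rewrite integralE; apply: emeasurable_funB.
- rewrite [X in measurable_fun _ X](_ : _ = fubini_F mu f^\+); last first.
    by apply/funext => x; apply: eq_integral => y _; rewrite !funeposE.
  by apply: measurable_fun_fubini_tonelli_F => //; exact: measurable_funepos.
- rewrite [X in measurable_fun _ X](_ : _ = fubini_F mu f^\-); last first.
    by apply/funext => x; apply: eq_integral => y _; rewrite !funenegE.
  by apply: measurable_fun_fubini_tonelli_F => //; exact: measurable_funeneg.
Qed.

Variable Phi : \bar R -> \bar R.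
Hypothesis yPhi : young Phi.

Lemma kernel_op_jensen u k : measurable_fun setT u -> (0 < k)%R ->
  kernel_integrable g u -> forall x,
  Phi (`|kernel_op g u x| / k)%:E <= \int[mu]_y ((g x y)%:E * Phi (`|u y| / k)%:E).
Proof.
move=> mu_ k0 gu x; have mr := mrow x.
have mabs : measurable_fun setT (fun y => (`|u y| / k)%R).
  by apply: measurable_funM => //; exact: measurableT_comp.
have igu : \int[mu]_y (g x y * `|u y|)%:E < +oo.
  have /integrableP[_] := gu x; congr (_ < _); apply: eq_integral => y _ /=.
  by rewrite normrM ger0_norm.
have igu0 : 0 <= \int[mu]_y (g x y * `|u y|)%:E.
  by apply: integral_ge0 => y _; rewrite lee_fin mulr_ge0.
have [m Em] : exists m : R, \int[mu]_y (g x y * `|u y|)%:E = m%:E.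
  by case: (\int[mu]_y (g x y * `|u y|)%:E) igu igu0 => // m; exists m.
have m0 : (0 <= m)%R by rewrite -lee_fin -Em.
apply: (@le_trans _ _ (Phi (m / k)%:E)).
  apply: (young_le yPhi); rewrite divr_ge0 ?(ltW k0)//= ler_pM2r ?invr_gt0//.
  rewrite -lee_fin -Em /kernel_op EFin_normr_Rintegral//; last exact: gu.
  apply: le_trans (le_abse_integral _ _ _) _ => //.
    by apply/measurable_EFinP; exact: measurable_funM.
  rewrite le_eqVlt; apply/orP; left; apply/eqP; apply: eq_integral => y _ /=.
  by rewrite normrM ger0_norm.
apply: (jensen_density (mu := mu) yPhi (g := g x) (f := fun y => `|u y| / k)%R) => //.
- by move=> y; rewrite divr_ge0 ?(ltW k0).
- exact: (bistochastic_row bg).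
- under eq_integral do rewrite mulrA EFinM.
  rewrite ge0_integralZr//; last 3 first.
  - by apply/measurable_EFinP; apply: measurable_funM => //; exact: measurableT_comp.
  - by move=> y _; rewrite lee_fin mulr_ge0.
  - by rewrite lee_fin invr_ge0 ltW.
  by rewrite Em -EFinM.
Qed.

(** Jensen's inequality at each point, then Tonelli's theorem and the unit mass
    of the columns. *)
Lemma kernel_op_modular u k : measurable_fun setT u -> (0 < k)%R ->
  kernel_integrable g u ->
  orlicz_modular mu Phi (kernel_op g u) k <= orlicz_modular mu Phi u k.
Proof.
move=> mu_ k0 gu.
have mPhi := measurable_young_absk yPhi k0 mu_.
have Phi0 y : 0 <= Phi (`|u y| / k)%:E by exact: (young_absk_ge0 yPhi).
pose F (p : T * T) := (g p.1 p.2)%:E * Phi (`|u p.2| / k)%:E.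
have mF : measurable_fun setT F.
  apply: emeasurable_funM; first exact/measurable_EFinP.
  exact: (measurableT_comp mPhi measurable_snd).
have F0 p : 0 <= F p by rewrite mule_ge0// lee_fin.
apply: (@le_trans _ _ (\int[mu]_x \int[mu]_y F (x, y))).
  apply: ge0_le_integral => //.
  - by move=> x _; exact: (young_absk_ge0 yPhi).
  - by apply: (measurable_young_absk yPhi) => //; exact: measurable_kernel_op.
  - exact: (measurable_fun_fubini_tonelli_F F).
  - by move=> x _; exact: kernel_op_jensen.
rewrite (fubini_tonelli F)// /F/=.
rewrite le_eqVlt; apply/orP; left; apply/eqP; apply: eq_integral => y _.
rewrite ge0_integralZr//.
- by rewrite (bistochastic_col bg) mul1e.
- by apply/measurable_EFinP; exact: measurable_kernel_col.
- by move=> x _; rewrite lee_fin.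
Qed.

(** Jensen's inequality with the kernel bounded by [B]: an integral bound on [u]
    becomes a pointwise bound on its average. *)
Lemma kernel_op_pointwise (B : R) u k : (forall x y, g x y <= B)%R ->
  measurable_fun setT u -> (0 < k)%R ->
  kernel_integrable g u -> forall x,
  Phi (`|kernel_op g u x| / k)%:E <= B%:E * orlicz_modular mu Phi u k.
Proof.
move=> gB mu_ k0 gu x.
have mPhi := measurable_young_absk yPhi k0 mu_.
have Phi0 y : 0 <= Phi (`|u y| / k)%:E by exact: (young_absk_ge0 yPhi).
have B0 : (0 <= B)%R by apply: le_trans (gB x x).
apply: (le_trans (kernel_op_jensen mu_ k0 gu x)).
rewrite -ge0_integralZl_EFin//; apply: ge0_le_integral => //.
- by move=> y _; rewrite mule_ge0// lee_fin.
- by apply: emeasurable_funM => //; exact/measurable_EFinP/mrow.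
- exact: emeasurable_funM.
- by move=> y _; apply: lee_wpmul2r => //; rewrite lee_fin.
Qed.

End kernel_operator.

Section kernel_composition.
Local Open Scope ereal_scope.
Context {R : realType} d (T : measurableType d) (mu : {sigma_finite_measure set T -> \bar R}).
Variables g1 g2 g3 : T -> T -> R.
Hypotheses (b1 : bistochastic mu g1) (b2 : bistochastic mu g2).
Hypothesis g12 : forall x z, \int[mu]_y (g1 x y * g2 y z)%:E = (g3 x z)%:E.
Let g10 x y : (0 <= g1 x y)%R. Proof. exact/ltW/(bistochastic_gt0 b1). Qed.
Let g20 x y : (0 <= g2 x y)%R. Proof. exact/ltW/(bistochastic_gt0 b2). Qed.

Lemma kernel_op_comp (u : T -> R) : measurable_fun setT u ->
  kernel_integrable mu g2 u -> kernel_integrable mu g3 u ->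
  forall x, kernel_op mu g1 (kernel_op mu g2 u) x = kernel_op mu g3 u x.
Proof.
move=> mu_ gu2 gu3 x.
pose F (p : T * T) := (g1 x p.1 * (g2 p.1 p.2 * u p.2))%:E.
have mg2 := bistochastic_measurable b2.
have m12 : measurable_fun setT (fun p : T * T => (g1 x p.1 * g2 p.1 p.2)%R).
  apply: measurable_funM => //.
  exact: (measurableT_comp (measurable_kernel_row b1 x) measurable_fst).
have mF : measurable_fun setT F.
  apply/measurable_EFinP; rewrite /F; under eq_fun do rewrite mulrA.
  by apply: measurable_funM => //; exact: (measurableT_comp mu_ measurable_snd).
have colE z : \int[mu]_y `|F (y, z)| = (g3 x z * `|u z|)%:E.
  rewrite EFinM -g12 -ge0_integralZr//.
  - by apply: eq_integral => y _; rewrite /F/= mulrA normrM ger0_norm ?EFinM// mulr_ge0.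
  - by apply/measurable_EFinP; exact: (measurableT_comp m12 (pair2_measurable z)).
  - by move=> y _; rewrite lee_fin mulr_ge0.
have g30 z : (0 <= g3 x z)%R.
  by rewrite -lee_fin -g12; apply: integral_ge0 => y _; rewrite lee_fin mulr_ge0.
have iF : (mu \x mu).-integrable setT F.
  apply/integrable21ltyP => //; under eq_integral do rewrite colE.
  have /integrableP[_] := gu3 x; congr (_ < _); apply: eq_integral => z _ /=.
  by rewrite normrM ger0_norm.
rewrite /kernel_op /Rintegral; congr fine.
transitivity (\int[mu]_y \int[mu]_z F (y, z)).
  apply: eq_integral => y _.
  rewrite EFinM fineK; last exact: integrable_fin_num.
  by rewrite -integralZl.
rewrite Fubini//; apply: eq_integral => z _.
rewrite EFinM -g12 -integralZr//; last first.
  apply/integrableP; split.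
    by apply/measurable_EFinP; exact: (measurableT_comp m12 (pair2_measurable z)).
  under eq_integral do rewrite gee0_abs ?lee_fin ?mulr_ge0//.
  by rewrite g12 ltry.
by apply: eq_integral => y _; rewrite /F/= mulrA EFinM.
Qed.

End kernel_composition.

(** * The heat semigroup on Orlicz spaces *)

Section luxemburg.
Context {R : realType} (n : nat).
Variable Phi : \bar R -> \bar R.
Hypothesis yPhi : young Phi.
Local Notation X := (lebesgue_space R n).
Implicit Types (u v : 'rV[R]_n -> R) (k : R).
Local Open Scope ereal_scope.

Definition leb_measurable (u : 'rV[R]_n -> R) := measurable_fun [set: X] (u : X -> R).

Lemma luxemburg_leb u : luxemburg Phi u = orlicz_norm (leb n) Phi u.
Proof. by []. Qed.

Lemma luxemburg_ge0 u : 0 <= luxemburg Phi u.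
Proof. exact: orlicz_norm_ge0. Qed.

Lemma luxemburg_le u k : (0 < k)%R -> modular Phi u k <= 1 -> luxemburg Phi u <= k%:E.
Proof. exact: orlicz_norm_le. Qed.

Lemma le_modular u v k : (0 < k)%R -> leb_measurable u -> leb_measurable v ->
  (forall x, `|u x| <= `|v x|)%R -> modular Phi u k <= modular Phi v k.
Proof. exact: le_orlicz_modular. Qed.

Lemma le_luxemburg u v : leb_measurable u -> leb_measurable v ->
  (forall x, `|u x| <= `|v x|)%R -> luxemburg Phi u <= luxemburg Phi v.
Proof. exact: le_orlicz_norm. Qed.

Lemma luxemburgZ (c : R) u : (0 <= c)%R ->
  luxemburg Phi (fun x => c * u x)%R <= c%:E * luxemburg Phi u.
Proof. exact: orlicz_normZ. Qed.

Lemma luxemburgD u v : leb_measurable u -> leb_measurable v ->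
  luxemburg Phi (u \+ v)%R <= luxemburg Phi u + luxemburg Phi v.
Proof. exact: orlicz_normD. Qed.

Lemma L_orliczP u : L_orlicz n Phi u <-> leb_measurable u /\ luxemburg Phi u < +oo.
Proof.
split=> [[mu_ uk]|[mu_ uk]]; split => //.
  by apply/(orlicz_norm_ltyP (leb n) yPhi mu_).
by have /(orlicz_norm_ltyP (leb n) yPhi mu_) := uk.
Qed.

Lemma M_orlicz_sub u : M_orlicz n Phi u -> L_orlicz n Phi u.
Proof. by move=> [mu_ H]; split => //; exists 1%R => //; exact: H. Qed.

Lemma modular_borel u k : (0 < k)%R -> measurable_fun [set: 'rV[R]_n] u ->
  modular Phi u k = orlicz_modular (borel_lebesgue n) Phi u k.
Proof.
move=> k0 mu_; apply: ge0_integral_leb.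
  by move=> x; exact: (young_absk_ge0 yPhi).
exact: (measurable_young_absk yPhi).
Qed.

End luxemburg.

Section heat_operator.
Context {R : realType} (n : nat).
Local Notation X := (lebesgue_space R n).
Local Notation lam := (@borel_lebesgue R n).
Implicit Types (u v : 'rV[R]_n -> R) (s t k : R).

Definition heat_density t (x y : 'rV[R]_n) := heat_kernel (x - y) t.

Lemma heat_bistochastic t : 0 < t -> bistochastic lam (heat_density t).
Proof.
move=> t0; split.
- by move=> x y; exact: heat_kernel_gt0.
- exact: measurable_heat_kernel2.
- by move=> x; exact: integral_heat_kernel.
- move=> y; under eq_integral do rewrite /heat_density heat_kernelC.
  exact: integral_heat_kernel.
Qed.

Lemma heat0 u : heat 0 u = u.
Proof. by apply/funext => x; rewrite /heat eqxx. Qed.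

Lemma heatE t u x : 0 < t ->
  heat t u x = \int[leb n]_y (heat_kernel (x - y) t * u y).
Proof. by move=> t0; rewrite /heat gt_eqF. Qed.

Lemma leb_measurable_heat_kernel x t :
  leb_measurable (fun y : 'rV[R]_n => heat_kernel (x - y) t).
Proof. by apply: measurable_fun_borel_leb; exact: measurable_heat_kernelr. Qed.

Lemma leb_integral_heat_kernel x t : 0 < t ->
  (\int[leb n]_y (heat_kernel (x - y) t)%:E = 1)%E.
Proof.
move=> t0; rewrite ge0_integral_leb; first exact: integral_heat_kernel.
  by move=> y; rewrite lee_fin heat_kernel_ge0.
by apply/measurable_EFinP; exact: measurable_heat_kernelr.
Qed.

Lemma Rintegral_ae_weight d (T : measurableType d) (mu : {measure set T -> \bar R})
    (g u v : T -> R) : measurable_fun setT g -> measurable_fun setT u ->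
  measurable_fun setT v -> u = v %[ae mu] ->
  (\int[mu]_y (g y * u y) = \int[mu]_y (g y * v y))%R.
Proof.
move=> mg mu_ mv uv; rewrite /Rintegral; congr fine.
apply: ae_eq_integral => //.
- by apply/measurable_EFinP; exact: measurable_funM.
- by apply/measurable_EFinP; exact: measurable_funM.
- by apply: filterS uv => y /= + _ => /(_ I) ->.
Qed.

Lemma heat_ae t u v : 0 < t -> leb_measurable u -> leb_measurable v ->
  ae_equal u v -> heat t u = heat t v.
Proof.
move=> t0 mu_ mv uv; apply/funext => x; rewrite !heatE//.
exact: (Rintegral_ae_weight (mu := leb n) (leb_measurable_heat_kernel x t)).
Qed.

Lemma heat_borel t v : 0 < t -> measurable_fun [set: 'rV[R]_n] v ->
  heat t v = kernel_op lam (heat_density t) v.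
Proof.
move=> t0 mv; apply/funext => x; rewrite heatE// /kernel_op /Rintegral; congr fine.
apply: integral_leb; apply/measurable_EFinP; apply: measurable_funM => //.
exact: measurable_heat_kernelr.
Qed.

Variable Phi : \bar R -> \bar R.
Hypothesis yPhi : young Phi.

Lemma orlicz_heat_abs_cvg t u x : L_orlicz n Phi u -> 0 < t -> heat_abs_cvg t u x.
Proof.
move=> [mu_ [k k0 uk]] t0.
have B0 : 0 <= t `^ (- (n%:R / 2)) by exact: powR_ge0.
have gB y : 0 <= heat_kernel (x - y) t <= t `^ (- (n%:R / 2)).
  by rewrite heat_kernel_ge0 heat_kernel_le.
have gfin : (\int[leb n]_y (heat_kernel (x - y) t)%:E < +oo)%E.
  by rewrite leb_integral_heat_kernel// ltry.
exact: (orlicz_weight_integrable yPhi B0 (leb_measurable_heat_kernel x t) gB gfin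
  mu_ k0 uk).
Qed.

(** Replacing [u] by a Borel representative changes neither its modular nor its
    heat evolution at any point, and makes Tonelli's theorem available. *)
Lemma orlicz_borel u : L_orlicz n Phi u ->
  exists v, [/\ measurable_fun [set: 'rV[R]_n] v, ae_equal u v, L_orlicz n Phi v,
    (forall t, 0 < t -> kernel_integrable lam (heat_density t) v /\
       heat t u = kernel_op lam (heat_density t) v) &
    forall k, 0 < k -> modular Phi u k = orlicz_modular lam Phi v k].
Proof.
move=> [mu_ [k k0 uk]]; have [v [mv _ uv]] := leb_ae_borel mu_.
have mlv : leb_measurable v by exact: measurable_fun_borel_leb.
have modE k' : 0 < k' -> modular Phi u k' = orlicz_modular lam Phi v k'.
  move=> k'0; rewrite -(modular_borel yPhi)//.
  exact: (ae_eq_orlicz_modular (mu := leb n) yPhi).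
exists v; split => //.
- by split => //; exists k => //; rewrite (modular_borel yPhi)// -modE.
- move=> t t0; split; last by rewrite (heat_ae t0 mu_ mlv uv) heat_borel.
  move=> x; apply: (orlicz_weight_integrable (mu := lam) yPhi
    (g := heat_density t x) (B := t `^ (- (n%:R / 2))) (k := k)) => //.
  + exact: powR_ge0.
  + exact: measurable_heat_kernelr.
  + by move=> y; rewrite /heat_density heat_kernel_ge0 heat_kernel_le.
  + by rewrite integral_heat_kernel// ltry.
  + by rewrite -modE.
Qed.

Lemma borel_heat u t : L_orlicz n Phi u -> 0 < t ->
  measurable_fun [set: 'rV[R]_n] (heat t u).
Proof.
move=> Lu t0; have [v [mv _ _ /(_ _ t0)[_ ->] _]] := orlicz_borel Lu.
exact: (measurable_kernel_op (heat_bistochastic t0)).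
Qed.

Lemma leb_measurable_heat u t : L_orlicz n Phi u -> 0 <= t -> leb_measurable (heat t u).
Proof.
move=> Lu; rewrite le_eqVlt => /predU1P[<-|t0]; first by rewrite heat0; case: Lu.
by apply: measurable_fun_borel_leb; exact: borel_heat.
Qed.

(** The heat flow does not increase modulars; the contraction of the norm, the
    invariance of [L^Phi] and the invariance of [M^Phi] follow. *)
Lemma modular_heat u t k : L_orlicz n Phi u -> 0 <= t -> 0 < k ->
  (modular Phi (heat t u) k <= modular Phi u k)%E.
Proof.
move=> Lu; rewrite le_eqVlt => /predU1P[<- _|t0 k0]; first by rewrite heat0.
have mh := borel_heat Lu t0.
rewrite (modular_borel yPhi)//.
have [v [mv _ _ /(_ _ t0)[gv ->] ->//]] := orlicz_borel Lu.
exact: (kernel_op_modular (heat_bistochastic t0) yPhi).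
Qed.

Lemma heat_pointwise u t k x : L_orlicz n Phi u -> 0 < t -> 0 < k ->
  (Phi (`|heat t u x| / k)%:E <= (t `^ (- (n%:R / 2)))%:E * modular Phi u k)%E.
Proof.
move=> Lu t0 k0.
have [v [mv _ _ /(_ _ t0)[gv ->] ->//]] := orlicz_borel Lu.
apply: (kernel_op_pointwise (heat_bistochastic t0) yPhi) => //.
by move=> y z; exact: heat_kernel_le.
Qed.

Lemma luxemburg_heat u t : L_orlicz n Phi u -> 0 <= t ->
  (luxemburg Phi (heat t u) <= luxemburg Phi u)%E.
Proof.
move=> Lu t0; apply: le_ereal_inf_tmp => _ [k [k0 uk] <-].
by apply: luxemburg_le => //; apply: le_trans uk; exact: modular_heat.
Qed.

Lemma L_orlicz_heat u t : L_orlicz n Phi u -> 0 <= t -> L_orlicz n Phi (heat t u).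
Proof.
move=> Lu t0; split; first exact: leb_measurable_heat.
by case: (Lu) => _ [k k0 uk]; exists k => //; exact: le_lt_trans (modular_heat _ _ _) uk.
Qed.

Lemma M_orlicz_heat u t : M_orlicz n Phi u -> 0 <= t -> M_orlicz n Phi (heat t u).
Proof.
move=> Mu t0; have Lu := M_orlicz_sub Mu; split; first exact: leb_measurable_heat.
by case: Mu => _ + k k0 => /(_ k k0); apply: le_lt_trans; exact: modular_heat.
Qed.

Lemma heat_linear (a : R) u v t : 0 <= t -> L_orlicz n Phi u -> L_orlicz n Phi v ->
  heat t (fun x => a * u x + v x) = (fun x => a * heat t u x + heat t v x).
Proof.
rewrite le_eqVlt => /predU1P[<- Lu Lv|t0 Lu Lv]; first by rewrite !heat0.
apply/funext => x; rewrite !heatE//.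
exact: (@kernel_op_linear _ _ X (leb n) (fun x y => heat_kernel (x - y) t) u v a
  (fun x => orlicz_heat_abs_cvg x Lu t0) (fun x => orlicz_heat_abs_cvg x Lv t0)).
Qed.

Lemma heat_semigroup s t u : 0 <= s -> 0 <= t -> L_orlicz n Phi u ->
  heat (s + t) u = heat s (heat t u).
Proof.
rewrite le_eqVlt => /predU1P[<-|s0]; first by rewrite add0r heat0.
rewrite le_eqVlt => /predU1P[<-|t0 Lu]; first by rewrite addr0 heat0.
have st0 : 0 < s + t by rewrite addr_gt0.
have [v [mv _ _ H _]] := orlicz_borel Lu.
rewrite (heat_borel s0); last exact: borel_heat.
have [gt ->] := H t t0; have [gst ->] := H _ st0.
apply/funext => x; rewrite (kernel_op_comp (heat_bistochastic s0)
  (heat_bistochastic t0) _ mv gt gst)//.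
by move=> y z; exact: integral_heat_kernelM.
Qed.

Lemma heat_bounded_linear (X0 : set ('rV[R]_n -> R)) t : 0 <= t ->
  X0 `<=` L_orlicz n Phi -> (forall u, X0 u -> X0 (heat t u)) ->
  bounded_linear_operator X0 (luxemburg Phi) X0 (luxemburg Phi) (heat t).
Proof.
move=> t0 XL Xheat; split => //.
- move=> u v /XL Lu /XL Lv uv; move: t0; rewrite le_eqVlt => /predU1P[<-|t0].
    by rewrite !heat0.
  rewrite (heat_ae t0 _ _ uv); [exact: ae_eq_refl|by case: Lu|by case: Lv].
- by move=> a u v /XL Lu /XL Lv; rewrite (heat_linear a t0 Lu Lv); exact: ae_eq_refl.
- by exists 1 => // u /XL Lu; rewrite mul1e; exact: luxemburg_heat.
Qed.

Lemma heat_operator_semigroup (X0 : set ('rV[R]_n -> R)) :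
  X0 `<=` L_orlicz n Phi -> (forall u t, X0 u -> 0 <= t -> X0 (heat t u)) ->
  operator_semigroup X0 (luxemburg Phi) heat.
Proof.
move=> XL Xheat; split.
- by move=> t t0; apply: heat_bounded_linear => // u Xu; exact: Xheat.
- by move=> u _; rewrite heat0; exact: ae_eq_refl.
- by move=> s t u s0 t0 /XL Lu; rewrite heat_semigroup//; exact: ae_eq_refl.
Qed.

End heat_operator.

(** * Continuity at time zero for uniformly continuous functions *)

Section near_limits.
Context {R : realType}.
Local Open Scope ereal_scope.

Lemma ge0_cvge0 (T : Type) (F : set_system T) {FF : Filter F} (f : T -> \bar R) :
  (forall t, 0 <= f t) -> (forall e : R, (0 < e)%R -> \forall t \near F, f t <= e%:E) ->
  f @ F --> 0.
Proof.
move=> f0 H; apply/fine_cvgP; split.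
  apply: filterS (H 1%R ltr01) => t ft.
  by rewrite ge0_fin_numE// (le_lt_trans ft)// ltry.
apply/cvgrPdist_le => e e0; apply: filterS (H e e0) => t ft /=.
rewrite sub0r normrN ger0_norm ?fine_ge0//.
by rewrite -lee_fin fineK// ge0_fin_numE// (le_lt_trans ft)// ltry.
Qed.

Lemma cvge0_le (T : Type) (F : set_system T) {FF : Filter F} (f : T -> \bar R) (e : R) :
  f @ F --> 0 -> (0 < e)%R -> \forall t \near F, f t <= e%:E.
Proof.
move=> f0 e0; have nb : nbhs (0 : \bar R) [set x | x < e%:E].
  exact: (@nbhs_open_ereal_lt _ 0%R (fun=> e)).
have H : F (f @^-1` [set x | x < e%:E]) by exact: f0.
by apply: filterS H => t /=; exact: ltW.
Qed.

End near_limits.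

Section strong_continuity.
Context {R : realType} (n : nat).
Local Notation X := (lebesgue_space R n).
Implicit Types (u v psi : 'rV[R]_n -> R) (s t k N r w : R).

Lemma leb_measurableD u v : leb_measurable u -> leb_measurable v -> leb_measurable (u \+ v).
Proof. exact: measurable_funD. Qed.

Lemma leb_measurableB u v : leb_measurable u -> leb_measurable v -> leb_measurable (u \- v).
Proof. exact: measurable_funB. Qed.

Lemma measurable_scale d (T : measurableType d) (a : R) (f : T -> R) :
  measurable_fun setT f -> measurable_fun setT (fun x => a * f x).
Proof. by move=> mf; apply: measurable_funM => //; exact: measurable_cst. Qed.

Lemma leb_measurableZ a u : leb_measurable u -> leb_measurable (fun x => a * u x).
Proof. exact: measurable_scale. Qed.

Lemma measurable_abs d (T : measurableType d) (f : T -> R) :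
  measurable_fun setT f -> measurable_fun setT (fun x => `|f x|).
Proof. by move=> mf; exact: measurableT_comp. Qed.

Lemma leb_measurable_abs u : leb_measurable u -> leb_measurable (fun x => `|u x|).
Proof. exact: measurable_abs. Qed.

Definition box N : set 'rV[R]_n := [set x | forall i, `|x 0 i| <= N].

Lemma measurable_box N : measurable (box N).
Proof.
rewrite (_ : box N = \bigcap_(i in [set: 'I_n]) ((fun x : 'rV[R]_n => x 0 i) @^-1` `[- N, N])).
  apply: fin_bigcap_measurable => // i _.
  have := @measurable_coor R n i measurableT `[- N, N]%classic (measurable_itv _).
  by rewrite setTI.
apply/seteqP; split => x /= H i; first by move=> _; rewrite /= in_itv/= -ler_norml.
by have := H i I; rewrite /= in_itv/= -ler_norml.
Qed.

Lemma borel_lebesgue_box_lty N : (borel_lebesgue n (box N) < +oo)%E.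
Proof.
rewrite (_ : box N = [set x : 'rV[R]_n | forall i, `[- N, N]%classic (x 0 i)]).
  rewrite (@borel_lebesgue_box R n (fun=> `[- N, N]%classic)); last by move=> i; exact: measurable_itv.
  have [c cE] : exists c : R, lebesgue_measure (`[- N, N]%classic : set R) = c%:E.
    rewrite lebesgue_measure_itv/=; case: ifP => _; last by exists 0.
    by rewrite -EFinD; eexists.
  by under eq_bigr do rewrite cE; rewrite prodEFin ltry.
by apply/seteqP; split => x H i; have := H i; rewrite /= in_itv/= -ler_norml.
Qed.

Lemma leb_box_lty N : (leb n (box N) < +oo)%E.
Proof. by rewrite lebE ?borel_lebesgue_box_lty//; exact: measurable_box. Qed.

(** [Phi (|u| / k)] is at most [Phi (C / k)] on [Q] and vanishes off [Q]. *)
Lemma orlicz_modular_bounded_support d (T : measurableType d)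
    (mu : {measure set T -> \bar R}) (Phi : \bar R -> \bar R) (u : T -> R) (Q : set T)
    (C k : R) : young Phi -> measurable Q -> (mu Q < +oo)%E ->
  measurable_fun setT u -> 0 < k -> (forall x, `|u x| <= C) ->
  (forall x, ~ Q x -> u x = 0) -> 0 <= C -> (Phi (C / k)%:E < +oo)%E ->
  (orlicz_modular mu Phi u k < +oo)%E.
Proof.
move=> yPhi mQ muQ mu_ k0 uC uQ C0 PhiC.
have Ck0 : 0 <= C / k by rewrite divr_ge0 ?(ltW k0).
have PhiC0 := young_ge0 yPhi Ck0.
apply: (@le_lt_trans _ _ (\int[mu]_x (Phi (C / k)%:E * (\1_Q x)%:E))%E).
  apply: ge0_le_integral => //.
  - by move=> x _; exact: (young_absk_ge0 yPhi).
  - exact: (measurable_young_absk yPhi).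
  - by apply: emeasurable_funM => //; apply/measurable_EFinP; exact: measurable_indic.
  - move=> x _; rewrite indicE; case: (boolP (x \in Q)) => xQ.
      rewrite mule1; apply: (young_le yPhi).
      by rewrite divr_ge0 ?(ltW k0)//= ler_pM2r ?invr_gt0.
    rewrite notin_setE in xQ.
    by rewrite mule0 uQ// normr0 mul0r (young0 yPhi).
rewrite ge0_integralZl//; last first.
  by apply/measurable_EFinP; exact: measurable_indic.
by rewrite integral_indic// setIT lte_mul_pinfty// ge0_fin_numE.
Qed.

Lemma modular_bounded_support Phi u N C k : young Phi -> leb_measurable u -> 0 < k ->
  (forall x, `|u x| <= C) -> (forall x, ~ box N x -> u x = 0) -> 0 <= C ->
  (Phi (C / k)%:E < +oo)%E -> (modular Phi u k < +oo)%E.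
Proof.
move=> yPhi mu_ k0 uC uN C0 PhiC.
exact: (orlicz_modular_bounded_support (mu := leb n) yPhi
  (measurable_borel_leb (measurable_box N)) (leb_box_lty N) mu_ k0 uC uN C0 PhiC).
Qed.

Lemma L_orlicz_bounded_support Phi u N C : young Phi -> leb_measurable u ->
  (forall x, `|u x| <= C) -> (forall x, ~ box N x -> u x = 0) -> L_orlicz n Phi u.
Proof.
move=> yPhi mu_ uC uN; split => //.
have [d d0 Phid] := young_fin_near0 yPhi.
have C0 : 0 <= C by apply: le_trans (uC 0).
have C10 : 0 < C + 1 by rewrite ltr_wpDl.
exists ((C + 1) / d); first by rewrite divr_gt0.
apply: (modular_bounded_support (N := N) yPhi mu_ _ uC uN C0).
  by rewrite divr_gt0.
apply: le_lt_trans Phid; apply: (young_le yPhi).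
rewrite divr_ge0 ?divr_ge0 ?(ltW C10) ?(ltW d0)//=.
by rewrite invf_div mulrCA ler_piMr ?(ltW d0)// ler_pdivrMr// mul1r lerDl.
Qed.

Lemma leb_measurable_indic_box N : leb_measurable (\1_(box N) : 'rV[R]_n -> R).
Proof.
apply: measurable_fun_borel_leb.
exact: (@measurable_indic _ _ R setT _ (measurable_box N)).
Qed.

Lemma L_orlicz_indic_box Phi N : young Phi -> L_orlicz n Phi (\1_(box N) : 'rV[R]_n -> R).
Proof.
move=> yPhi; apply: (@L_orlicz_bounded_support Phi _ N 1) => //.
- exact: leb_measurable_indic_box.
- by move=> x; rewrite indicE; case: (_ \in _); rewrite ?normr0 ?normr1.
- by move=> x Nx; rewrite indicE memNset.
Qed.

Section young_Phi.
Variable Phi : \bar R -> \bar R.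
Hypothesis yPhi : young Phi.

Lemma luxemburgB u v : leb_measurable u -> leb_measurable v ->
  (luxemburg Phi (u \- v)%R <= luxemburg Phi u + luxemburg Phi v)%E.
Proof.
move=> mu_ mv; have mNv := leb_measurableZ (-1) mv.
rewrite (_ : u \- v = u \+ (fun x => -1 * v x)); last first.
  by apply/funext => x /=; rewrite mulN1r.
apply: le_trans (luxemburgD yPhi mu_ mNv) _; apply: leeD2l.
by apply: (le_luxemburg yPhi mNv mv) => x; rewrite mulN1r normrN.
Qed.

Lemma luxemburg_distC u v : leb_measurable u -> leb_measurable v ->
  (luxemburg Phi (u \- v)%R <= luxemburg Phi (v \- u)%R)%E.
Proof.
move=> mu_ mv; apply: (le_luxemburg yPhi (leb_measurableB mu_ mv) (leb_measurableB mv mu_)).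
by move=> x /=; rewrite distrC.
Qed.

Lemma L_orliczB u v : L_orlicz n Phi u -> L_orlicz n Phi v -> L_orlicz n Phi (u \- v).
Proof.
move=> /(L_orliczP yPhi)[mu_ ul] /(L_orliczP yPhi)[mv vl]; apply/(L_orliczP yPhi).
split; first exact: leb_measurableB.
by apply: le_lt_trans (luxemburgB mu_ mv) _; exact: lte_add_pinfty.
Qed.

Lemma L_orlicz_abs u : L_orlicz n Phi u -> L_orlicz n Phi (fun x => `|u x|).
Proof.
move=> [mu_ [k k0 uk]]; split; first exact: leb_measurable_abs.
exists k => //; apply: le_lt_trans uk; apply: (le_modular yPhi k0 _ mu_).
  exact: leb_measurable_abs.
by move=> x; rewrite normr_id.
Qed.

(** Points [y] with [|x_i - y_i| <= r] for all [i] contribute at most the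
    modulus of continuity [w], and nothing if [x] lies off the enlarged box;
    for the other points the kernel is at most [heat_tail n r t] times the
    kernel at time [2 t]. *)
Lemma heat_close psi N r w t x : L_orlicz n Phi psi ->
  (forall x, ~ box N x -> psi x = 0) -> 0 < t -> 0 <= r -> 0 <= w ->
  (forall x y : 'rV[R]_n, (forall i, `|x 0 i - y 0 i| <= r) -> `|psi x - psi y| <= w) ->
  `|heat t psi x - psi x| <= w * \1_(box (N + r)) x +
    heat_tail n r t * (heat (2 * t) (fun y => `|psi y|) x + `|psi x|).
Proof.
move=> Lpsi psiN t0 r0 w0 Hw.
have t20 : 0 < 2 * t by rewrite mulr_gt0.
rewrite !heatE//.
have q0 : 0 <= heat_tail n r t by rewrite mulr_ge0 ?powR_ge0 ?expR_ge0.
have cvg1 := orlicz_heat_abs_cvg yPhi x Lpsi t0.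
have cvg2 := orlicz_heat_abs_cvg yPhi x (L_orlicz_abs Lpsi) t20.
apply: (weighted_average_close (leb_measurable_heat_kernel x t)
  (leb_measurable_heat_kernel x (2 * t)) (proj1 Lpsi) (fun y => heat_kernel_ge0 (x - y) t)
  (fun y => heat_kernel_ge0 (x - y) (2 * t)) (leb_integral_heat_kernel x t0)
  (leb_integral_heat_kernel x t20) cvg1 cvg2 _ q0).
  by rewrite mulr_ge0.
move=> y; have g1 := heat_kernel_ge0 (x - y) t; have g2 := heat_kernel_ge0 (x - y) (2 * t).
have tri : `|psi y - psi x| <= `|psi y| + `|psi x| by exact: ler_normB.
have R0 : 0 <= heat_tail n r t * (heat_kernel (x - y) (2 * t) * (`|psi y| + `|psi x|)).
  by apply: mulr_ge0 => //; apply: mulr_ge0 => //; exact: addr_ge0.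
have [near|] := pselect (forall i, `|x 0 i - y 0 i| <= r).
  apply: (@le_trans _ _ (w * \1_(box (N + r)) x * heat_kernel (x - y) t)); last by rewrite lerDl.
  rewrite mulrC ler_wpM2r// indicE; case: (boolP (x \in _)) => xB.
    by rewrite mulr1 distrC; exact: Hw.
  rewrite mulr0 [psi y]psiN; last first.
    move=> yN; move: xB; rewrite notin_setE; apply => i.
    rewrite -(subrK (y 0 i) (x 0 i)) addrC; apply: (le_trans (ler_normD _ _)).
    by apply: lerD; [exact: yN|exact: near].
  rewrite psiN ?subrr ?normr0// => xN; move: xB; rewrite notin_setE; apply => i.
  by apply: le_trans (xN i) _; rewrite lerDl.
move=> /existsNP[i /negP]; rewrite -ltNge => /ltW far.
have tl : heat_kernel (x - y) t <= heat_tail n r t * heat_kernel (x - y) (2 * t).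
  by apply: (@heat_kernel_tail _ _ _ _ _ i) => //; rewrite !mxE.
apply: (@le_trans _ _ (heat_tail n r t * heat_kernel (x - y) (2 * t) * (`|psi y| + `|psi x|))).
  by apply: ler_pM.
by rewrite -mulrA lerDr mulr_ge0// mulr_ge0.
Qed.

Lemma heat_tail_le r t : 0 < r -> 0 < t ->
  heat_tail n r t <= 2 `^ (n%:R / 2) * (8 * t / r ^+ 2).
Proof.
move=> r0 t0; rewrite ler_wpM2l ?powR_ge0//.
have a0 : 0 < r ^+ 2 / (8 * t) by rewrite divr_gt0 ?exprn_gt0// mulr_gt0.
rewrite mulNr expRN -[leRHS]invf_div lef_pV2 ?posrE ?expR_gt0//.
by apply: le_trans (expR_ge1Dx _); rewrite lerDr.
Qed.

(** Continuity at time zero in epsilon form, which composes better with norm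
    estimates than the equivalent limit in the extended reals. *)
Definition heat_continuous u :=
  forall e : R, 0 < e -> \forall t \near 0^'+, (luxemburg Phi (heat t u \- u)%R <= e%:E)%E.

Lemma heat_continuous_cvg u : heat_continuous u ->
  luxemburg Phi (heat t u \- u)%R @[t --> 0^'+] --> 0%E.
Proof. by move=> H; apply: ge0_cvge0 => // t; exact: luxemburg_ge0. Qed.

(** Take norms in [heat_close]: by contraction, the norm of
    [S(t) psi - psi] is at most [w] times the norm of the indicator of a fixed
    box plus [2 heat_tail n r t] times the norm of [psi].  Choose [w], hence
    [r], and then [t]. *)
Lemma heat_continuous_uniform psi N : L_orlicz n Phi psi ->
  (forall x, ~ box N x -> psi x = 0) ->
  (forall e, 0 < e -> exists2 d, 0 < d &
    forall x y : 'rV[R]_n, (forall i, `|x 0 i - y 0 i| <= d) -> `|psi x - psi y| <= e) ->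
  heat_continuous psi.
Proof.
move=> Lpsi psiN unif e e0.
have [mpsi psi_lty] := (L_orliczP yPhi _).1 Lpsi.
pose K := fine (luxemburg Phi psi).
have KE : luxemburg Phi psi = K%:E.
  by rewrite fineK// ge0_fin_numE// luxemburg_ge0.
have K0 : 0 <= K by rewrite fine_ge0// luxemburg_ge0.
(* With r <= 1 the enlarged box is contained in one that does not depend on r. *)
pose B : 'rV[R]_n -> R := \1_(box (N + 1)).
have [mB B_lty] := (L_orliczP yPhi _).1 (L_orlicz_indic_box (N + 1) yPhi).
pose L := fine (luxemburg Phi B).
have LE : luxemburg Phi B = L%:E.
  by rewrite fineK// ge0_fin_numE// luxemburg_ge0.
have L0 : 0 <= L by rewrite fine_ge0// luxemburg_ge0.
pose w := e / 2 / (L + 1).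
have L10 : 0 < L + 1 by rewrite ltr_wpDl.
have w0 : 0 < w by rewrite !divr_gt0.
have [d d0 Hd] := unif w w0.
pose r := Num.min d 1.
have r0 : 0 < r by rewrite lt_min d0 ltr01.
have Hr (x y : 'rV[R]_n) : (forall i, `|x 0 i - y 0 i| <= r) -> `|psi x - psi y| <= w.
  by move=> H; apply: Hd => i; apply: le_trans (H i) _; rewrite ge_min lexx.
pose q0 := e / 2 / (2 * K + 1).
have K10 : 0 < 2 * K + 1 by rewrite ltr_wpDl// mulr_ge0.
have q00 : 0 < q0 by rewrite !divr_gt0.
have P0 : 0 < 2 `^ (n%:R / 2) :> R by exact: powR_gt0.
near=> t.
have t0 : 0 < t by near: t; exact: nbhs_right_gt.
have tq : heat_tail n r t <= q0.
  apply: le_trans (heat_tail_le r0 t0) _.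
  have : t < q0 * r ^+ 2 / (8 * 2 `^ (n%:R / 2)).
    near: t; apply: nbhs_right_lt.
    by apply: divr_gt0; apply: mulr_gt0 => //; exact: exprn_gt0.
  rewrite ltr_pdivlMr ?mulr_gt0// => /ltW H.
  by rewrite mulrA ler_pdivrMr ?exprn_gt0//; apply: le_trans H; lra.
have q_ge0 : 0 <= heat_tail n r t by rewrite mulr_ge0 ?powR_ge0 ?expR_ge0.
have t20 : 0 <= 2 * t by rewrite mulr_ge0 ?(ltW t0).
have Labs := L_orlicz_abs Lpsi.
have mabs := leb_measurable_abs mpsi.
have mh := leb_measurable_heat yPhi Labs t20.
have mht := leb_measurable_heat yPhi Lpsi (ltW t0).
pose V := heat (2 * t) (fun y => `|psi y|) \+ (fun y => `|psi y|).
have mV : leb_measurable V by exact: leb_measurableD.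
have mwB := leb_measurableZ w mB.
have mqV := leb_measurableZ (heat_tail n r t) mV.
apply: (@le_trans _ _ (luxemburg Phi ((fun x => w * B x) \+ (fun x => heat_tail n r t * V x)))).
  apply: (le_luxemburg yPhi (leb_measurableB mht mpsi) (leb_measurableD mwB mqV)) => x /=.
  apply: le_trans (ler_norm _).
  apply: le_trans (heat_close x Lpsi psiN t0 (ltW r0) (ltW w0) Hr) _.
  rewrite lerD2r ler_wpM2l ?(ltW w0)// /B !indicE ler_nat.
  case: (boolP (x \in box (N + r))) => //; rewrite inE => xr; rewrite mem_set// => i.
  by apply: le_trans (xr i) _; rewrite lerD2l ge_min lexx orbT.
apply: le_trans (luxemburgD yPhi mwB mqV) _.
have absK : (luxemburg Phi (fun y => `|psi y|%R) <= K%:E)%E.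
  rewrite -KE; apply: (le_luxemburg yPhi mabs mpsi) => x.
  by rewrite normr_id.
have VK : (luxemburg Phi V <= (2 * K)%:E)%E.
  apply: le_trans (luxemburgD yPhi mh mabs) _.
  rewrite (_ : 2 * K = K + K); last by ring.
  rewrite EFinD; apply: leeD; last exact: absK.
  by apply: le_trans absK; exact: luxemburg_heat.
apply: (@le_trans _ _ ((w * L)%:E + (heat_tail n r t * (2 * K))%:E)%E).
  apply: leeD.
    by rewrite EFinM -LE; apply: luxemburgZ => //; exact: ltW.
  apply: le_trans (luxemburgZ yPhi V q_ge0) _.
  rewrite (EFinM (heat_tail n r t)); apply: lee_wpmul2l; first by rewrite lee_fin.
  exact: VK.
rewrite -EFinD lee_fin [leRHS](splitr e); apply: lerD.
  by rewrite /w mulrAC ler_pdivrMr// ler_wpM2l ?divr_ge0 ?(ltW e0)// lerDl.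
apply: (@le_trans _ _ (q0 * (2 * K))); first by rewrite ler_wpM2r// mulr_ge0.
by rewrite /q0 mulrAC ler_pdivrMr// ler_wpM2l ?divr_ge0 ?(ltW e0)// lerDl.
Unshelve. all: by end_near. Qed.

Lemma heat_sub u v t : 0 <= t -> L_orlicz n Phi u -> L_orlicz n Phi v ->
  heat t (u \- v) = heat t u \- heat t v.
Proof.
move=> t0 Lu Lv; have := heat_linear yPhi (-1) t0 Lv Lu.
rewrite (_ : (fun x => -1 * v x + u x) = u \- v); last first.
  by apply/funext => x /=; rewrite mulN1r addrC.
by move=> ->; apply/funext => x /=; rewrite mulN1r addrC.
Qed.

(** Three epsilons, by contraction: [S(t) u - u] is
    [S(t) (u - v) + (S(t) v - v) - (u - v)]. *)
Lemma heat_continuous_closure u : L_orlicz n Phi u ->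
  (forall e : R, 0 < e -> exists v, [/\ L_orlicz n Phi v, heat_continuous v &
    (luxemburg Phi (u \- v)%R <= e%:E)%E]) -> heat_continuous u.
Proof.
move=> Lu H e e0; have e30 : 0 < e / 3 by rewrite divr_gt0.
have [v [Lv cv uv]] := H _ e30.
have mu_ := proj1 Lu; have mv := proj1 Lv.
have Luv := L_orliczB Lu Lv.
near=> t; have t0 : 0 < t by near: t; exact: nbhs_right_gt.
have cvt : (luxemburg Phi (heat t v \- v)%R <= (e / 3)%:E)%E by near: t; exact: cv.
have mhuv := leb_measurable_heat yPhi Luv (ltW t0).
have mhv := leb_measurable_heat yPhi Lv (ltW t0).
rewrite (_ : heat t u \- u = heat t (u \- v) \+ ((heat t v \- v) \- (u \- v))); last first.
  by rewrite (heat_sub (ltW t0))//; apply/funext => x /=; ring.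
rewrite (_ : e = e / 3 + (e / 3 + e / 3)); last by field.
rewrite !EFinD; apply: le_trans (luxemburgD yPhi mhuv _) _.
  by apply: leb_measurableB; apply: leb_measurableB.
apply: leeD; first by apply: le_trans uv; exact: (luxemburg_heat yPhi Luv (ltW t0)).
apply: le_trans (luxemburgB _ _) _; try exact: leb_measurableB.
by apply: leeD; [exact: cvt|exact: uv].
Unshelve. all: by end_near. Qed.

End young_Phi.
End strong_continuity.

(** * Continuity at time zero on the closure of the test functions *)

Section test_functions.
Context {R : realType} (n : nat).
Implicit Types (psi : 'rV[R]_n -> R).

(** The coordinates of a compact set form compact, hence bounded, sets. *)
Lemma compact_box (K : set 'rV[R]_n) : compact K -> exists N : R, K `<=` box N.
Proof.
move=> cK.
have H i : exists N : R, 0 <= N /\ forall x : 'rV[R]_n, K x -> `|x 0 i| <= N.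
  have : compact ((fun x : 'rV[R]_n => x 0 i) @` K).
    apply: continuous_compact => //; apply: continuous_subspaceT => x.
    exact: coord_continuous.
  move=> /compact_bounded[M [_ HM]]; exists (`|M| + 1); split; first by rewrite addr_ge0.
  move=> x Kx; apply: (HM (`|M| + 1)); last by exists x.
  by rewrite (le_lt_trans (ler_norm M))// ltrDl.
pose N i := projT1 (cid (H i)).
exists (\sum_i N i) => x Kx i; rewrite (bigD1 i)//=.
have [N0 HN] := projT2 (cid (H i)).
apply: le_trans (HN _ Kx) _; rewrite lerDl sumr_ge0// => j _.
by case: (projT2 (cid (H j))).
Qed.

Lemma test_function_support psi : test_function psi ->
  exists N : R, forall x, ~ box N x -> psi x = 0.
Proof.
move=> [_ /compact_box[N KN]]; exists N => x nNx; apply: contrapT => /eqP ux.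
by apply: nNx; apply: KN; apply: subset_closure.
Qed.

Lemma test_function_continuous psi : test_function psi -> continuous psi.
Proof. by move=> [/(_ [::])[]]. Qed.

Lemma test_function_bounded psi : test_function psi ->
  exists C : R, forall x, `|psi x| <= C.
Proof.
move=> tpsi; have cpsi := test_function_continuous tpsi.
case: tpsi => _ cK.
have : compact (psi @` closure [set x | psi x != 0]).
  by apply: continuous_compact => //; exact: continuous_subspaceT.
move=> /compact_bounded[M [_ HM]]; exists (`|M| + 1) => x.
have [ux|/eqP ux] := eqVneq (psi x) 0; first by rewrite ux normr0 addr_ge0.
apply: (HM (`|M| + 1)); first by rewrite (le_lt_trans (ler_norm M))// ltrDl.
by exists x => //; apply: subset_closure; exact/eqP.
Qed.

(** Heine's theorem: the required [d] works near each point of the support, and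
    a compact set has the near-covering property.  Two points off the support
    have the same value 0. *)
Lemma test_function_unif_continuous psi : test_function psi ->
  forall e : R, 0 < e -> exists2 d, 0 < d &
    forall x y : 'rV[R]_n, (forall i, `|x 0 i - y 0 i| <= d) -> `|psi x - psi y| <= e.
Proof.
move=> tpsi e e0; have cpsi := test_function_continuous tpsi.
case: (tpsi) => _ cK; set K := closure _ in cK.
have K0 x : ~ K x -> psi x = 0.
  move=> nKx; apply: contrapT => /eqP ux; apply: nKx; exact: subset_closure.
pose P (d : R) (x : 'rV[R]_n) := forall y : 'rV[R]_n, (forall i, `|x 0 i - y 0 i| <= d) ->
  `|psi x - psi y| <= e.
have [d d0 Pd] : exists2 d : R, 0 < d & K `<=` P d.
  have /compact_near_coveringP ncK := cK.
  have : \forall d \near (0 : R)^'+, K `<=` P d.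
    apply: ncK => x Kx.
    have e20 : 0 < e / 2 by rewrite divr_gt0.
    have /cvgrPdist_lt/(_ _ e20) := cpsi x.
    move=> /nbhs_ballP[b /= b0 Hb].
    have b20 : 0 < b / 2 by rewrite divr_gt0.
    exists (ball x (b / 2), [set d | d < b / 2]).
      by split; [exact: nbhsx_ballx|exact: nbhs_right_lt].
    move=> [x' d] /= [[_ xx'] db] y x'y.
    have bx' : ball x b x'.
      split => // i j; have := xx' i j; rewrite /ball/= => /lt_le_trans; apply.
      by rewrite ler_pdivrMr// ler_pMr// ler1n.
    have by_ : ball x b y.
      split => // i j; have := xx' i j; rewrite /ball/= !ord1 => H.
      rewrite -(subrK (x' 0 j) (x 0 j)) -addrA (splitr b).
      apply: le_lt_trans (ler_normD _ _) _; apply: ltr_leD => //.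
      exact: le_trans (x'y j) (ltW db).
    rewrite -(subrK (psi x) (psi x')) -addrA (splitr e).
    apply: le_trans (ler_normD _ _) _; apply: lerD; last exact/ltW/Hb.
    by rewrite distrC; exact/ltW/Hb.
  move=> H; have : \forall d \near (0 : R)^'+, 0 < d /\ K `<=` P d.
    by near=> d; split; [near: d; exact: nbhs_right_gt|near: d].
  by move=> /filter_ex[d [d0 Pd]]; exists d.
exists d => // x y xy; have [Kx|nKx] := pselect (K x); first exact: Pd.
have [Ky|nKy] := pselect (K y).
  by rewrite distrC; apply: Pd => // i; rewrite distrC.
by rewrite (K0 x)// (K0 y)// subrr normr0 ltW.
Unshelve. all: by end_near. Qed.

End test_functions.

Section L0.
Context {R : realType} (n : nat).
Variable Phi : \bar R -> \bar R.
Hypothesis yPhi : young Phi.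
Implicit Types (phi psi : orlicz n Phi).

Lemma orlicz_leb_measurable phi : leb_measurable phi.
Proof. by case: (orliczP phi). Qed.

(** Balls are open for the seminorm topology, by the triangle inequality. *)
Lemma luxemburg_ball_nbhs phi (e : R) : 0 < e ->
  nbhs phi [set psi | (luxemburg Phi (psi \- phi)%R < e%:E)%E].
Proof.
move=> e0; apply: open_nbhs_nbhs; split; last first.
  rewrite /=; have -> : (phi : _ -> R) \- phi = (fun=> 0).
    by apply/funext => x /=; rewrite subrr.
  by rewrite luxemburg_leb (orlicz_norm0 (leb n) yPhi) lte_fin.
move=> psi /= psi_phi.
have mphi := orlicz_leb_measurable phi; have mpsi := orlicz_leb_measurable psi.
case E : (luxemburg Phi ((psi : _ -> R) \- phi)%R) psi_phi (luxemburg_ge0 Phi ((psi : _ -> R) \- phi)%R) => [a| |]//.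
rewrite lte_fin => ae _; exists (e - a); first by rewrite subr_gt0.
move=> v vpsi; have mv := orlicz_leb_measurable v.
rewrite /= (_ : (v : _ -> R) \- phi = ((v : _ -> R) \- psi) \+ ((psi : _ -> R) \- phi)); last first.
  by apply/funext => x /=; rewrite addrA subrK.
apply: le_lt_trans (luxemburgD yPhi (leb_measurableB mv mpsi) (leb_measurableB mpsi mphi)) _.
rewrite E; have -> : e%:E = ((e - a)%:E + a%:E)%E by rewrite -EFinD subrK.
by rewrite lteD2rE.
Qed.

Lemma L0_orlicz_approx phi (e : R) : L0_orlicz n Phi phi -> 0 < e ->
  exists2 psi : orlicz n Phi, test_function psi &
    (luxemburg Phi ((psi : _ -> R) \- phi)%R < e%:E)%E.
Proof.
move=> Lphi e0; have [psi [tpsi psi_phi]] := Lphi _ (luxemburg_ball_nbhs phi e0).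
by exists psi.
Qed.

Lemma test_function_heat_continuous psi : test_function psi -> heat_continuous Phi psi.
Proof.
move=> tpsi; have [N psiN] := test_function_support tpsi.
apply: (heat_continuous_uniform yPhi (orliczP psi) psiN).
exact: test_function_unif_continuous.
Qed.

Lemma L0_heat_continuous phi : L0_orlicz n Phi phi -> heat_continuous Phi phi.
Proof.
move=> Lphi; apply: (heat_continuous_closure yPhi (orliczP phi)) => e e0.
have [psi tpsi psi_phi] := L0_orlicz_approx Lphi e0.
exists psi; split; [exact: orliczP|exact: test_function_heat_continuous|].
apply: le_trans (ltW psi_phi).
by apply: luxemburg_distC => //; exact: orlicz_leb_measurable.
Qed.

End L0.

(** * Continuity at time zero on M^Phi *)

Section dominated_modular.
Context {R : realType} d (T : measurableType d) (mu : {measure set T -> \bar R}).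
Variable Phi : \bar R -> \bar R.
Hypothesis yPhi : young Phi.
Local Open Scope ereal_scope.

(** Dominated convergence; [Phi] is continuous at 0 by [young_small]. *)
Lemma orlicz_modular_dominated_cvg0 (v_ : nat -> T -> R) (v : T -> R) (e : R) :
  (0 < e)%R -> (forall j, measurable_fun setT (v_ j)) -> measurable_fun setT v ->
  (forall j x, `|v_ j x| <= `|v x|)%R -> (forall x, v_ ^~ x @ \oo --> (0%R : R)) ->
  orlicz_modular mu Phi v e < +oo ->
  orlicz_modular mu Phi (v_ j) e @[j --> \oo] --> 0.
Proof.
move=> e0 mv_ mv v_v v_0 ve.
have mF j := measurable_young_absk yPhi e0 (mv_ j).
have mG := measurable_young_absk yPhi e0 mv.
have F0 j x : 0 <= Phi (`|v_ j x| / e)%:E by exact: (young_absk_ge0 yPhi).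
have G0 x : 0 <= Phi (`|v x| / e)%:E by exact: (young_absk_ge0 yPhi).
have FG j x : Phi (`|v_ j x| / e)%:E <= Phi (`|v x| / e)%:E.
  by apply: (young_le yPhi); rewrite divr_ge0 ?(ltW e0)//= ler_pM2r ?invr_gt0.
have F_0 x : (fun j => Phi (`|v_ j x| / e)%:E) @ \oo --> 0.
  apply: ge0_cvge0 => // c c0; have [b b0 Phib] := young_small yPhi c0.
  have eb0 : (0 < e * b)%R by exact: mulr_gt0.
  have /cvgrPdist_le/(_ _ eb0) := v_0 x; apply: filterS => j /=.
  rewrite sub0r normrN => vj; apply: le_trans Phib; apply: (young_le yPhi).
  by rewrite divr_ge0 ?(ltW e0)//= ler_pdivrMr// mulrC.
have ae0 : {ae mu, forall x, [set: T] x ->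
    (fun j => Phi (`|v_ j x| / e)%:E) @ \oo --> cst 0 x}.
  by apply: aeW => x _; exact: F_0.
have iG : mu.-integrable setT (fun x => Phi (`|v x| / e)%:E).
  apply/integrableP; split => //.
  by under eq_integral do rewrite gee0_abs//.
have aeG : {ae mu, forall x j, [set: T] x ->
    `|Phi (`|v_ j x| / e)%:E| <= Phi (`|v x| / e)%:E}.
  by apply: aeW => x j _; rewrite gee0_abs.
have [_ _] := dominated_convergence measurableT mF (measurable_cst _) ae0 iG aeG.
by rewrite integral0.
Qed.

Lemma orlicz_norm_dominated_small (v_ : nat -> T -> R) (v : T -> R) (e : R) :
  (0 < e)%R -> (forall j, measurable_fun setT (v_ j)) -> measurable_fun setT v ->
  (forall j x, `|v_ j x| <= `|v x|)%R -> (forall x, v_ ^~ x @ \oo --> (0%R : R)) ->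
  orlicz_modular mu Phi v e < +oo ->
  exists j, orlicz_norm mu Phi (v_ j) <= e%:E.
Proof.
move=> e0 mv_ mv v_v v_0 ve.
have H := orlicz_modular_dominated_cvg0 e0 mv_ mv v_v v_0 ve.
have /filter_ex[j Hj] : \forall j \near \oo, orlicz_modular mu Phi (v_ j) e <= 1%:E.
  exact: (cvge0_le H ltr01).
by exists j; apply: orlicz_norm_le.
Qed.

End dominated_modular.

Lemma ae_eq_sub0 (R : realType) d (T : measurableType d) (mu : {measure set T -> \bar R})
    (u v : T -> R) : u = v %[ae mu] -> u \- v = (fun=> 0) %[ae mu].
Proof. by apply: filterS => x /= /(_ I) -> _; rewrite subrr. Qed.

Section M_strong_continuity.
Context {R : realType} (n : nat).
Variable Phi : \bar R -> \bar R.
Hypothesis yPhi : young Phi.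
Hypothesis fPhi : forall x : R, 0 <= x -> (Phi x%:E < +oo)%E.
Implicit Types (u v : 'rV[R]_n -> R).

Lemma L_orliczZ (a : R) u : L_orlicz n Phi u -> L_orlicz n Phi (fun x => a * u x).
Proof.
move=> /(L_orliczP yPhi)[mu_ uoo]; have mau := leb_measurableZ a mu_.
apply/(L_orliczP yPhi); split; first exact: mau.
apply: (@le_lt_trans _ _ (luxemburg Phi (fun x => `|a| * u x))).
  apply: (le_luxemburg yPhi mau (leb_measurableZ `|a| mu_)) => x.
  by rewrite !normrM normr_id.
apply: le_lt_trans (luxemburgZ yPhi u (normr_ge0 a)) _.
by apply: lte_mul_pinfty; rewrite ?lee_fin.
Qed.

Lemma heat_continuous_linear (a : R) u v : L_orlicz n Phi u -> L_orlicz n Phi v ->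
  heat_continuous Phi u -> heat_continuous Phi v ->
  heat_continuous Phi (fun x => a * u x + v x).
Proof.
move=> Lu Lv cu cv e e0.
have mu_ := proj1 Lu; have mv := proj1 Lv.
pose c := e / 2 / (`|a| + 1).
have a10 : 0 < `|a| + 1 by rewrite ltr_wpDl.
have c0 : 0 < c by rewrite !divr_gt0.
have e20 : 0 < e / 2 by rewrite divr_gt0.
near=> t; have t0 : 0 < t by near: t; exact: nbhs_right_gt.
have cut : (luxemburg Phi (heat t u \- u)%R <= c%:E)%E by near: t; exact: cu.
have cvt : (luxemburg Phi (heat t v \- v)%R <= (e / 2)%:E)%E by near: t; exact: cv.
have mhu := leb_measurable_heat yPhi Lu (ltW t0).
have mhv := leb_measurable_heat yPhi Lv (ltW t0).
have mD := leb_measurableB mhu mu_.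
rewrite (heat_linear yPhi a (ltW t0) Lu Lv).
rewrite (_ : _ \- _ = (fun x => a * (heat t u \- u) x) \+ (heat t v \- v)); last first.
  by apply/funext => x /=; ring.
apply: le_trans (luxemburgD yPhi (leb_measurableZ a mD) (leb_measurableB mhv mv)) _.
rewrite (splitr e) EFinD; apply: leeD; last exact: cvt.
apply: (@le_trans _ _ (luxemburg Phi (fun x => `|a| * (heat t u \- u) x))).
  apply: (le_luxemburg yPhi (leb_measurableZ a mD) (leb_measurableZ `|a| mD)) => x.
  by rewrite !normrM normr_id.
apply: le_trans (luxemburgZ yPhi _ (normr_ge0 a)) _.
apply: (@le_trans _ _ (`|a|%:E * c%:E)%E); first by apply: lee_wpmul2l; rewrite ?lee_fin.
by rewrite -EFinM lee_fin /c mulrCA ler_piMr ?(ltW e20)// ler_pdivrMr// mul1r lerDl.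
Unshelve. all: by end_near. Qed.

Lemma heat_continuous0 : heat_continuous Phi (fun _ : 'rV[R]_n => 0).
Proof.
move=> e e0; near=> t; have t0 : 0 < t by near: t; exact: nbhs_right_gt.
have -> : heat t (fun _ : 'rV[R]_n => 0) = fun=> 0.
  apply/funext => x; rewrite heatE// /Rintegral.
  by under eq_integral do rewrite mulr0; rewrite integral0.
have -> : (fun _ : 'rV[R]_n => 0) \- (fun _ : 'rV[R]_n => 0) = (fun _ => 0 : R).
  by apply/funext => x /=; rewrite subrr.
by rewrite luxemburg_leb (orlicz_norm0 (leb n) yPhi) lee_fin ltW.
Unshelve. all: by end_near. Qed.

Lemma M_orliczZ (a : R) u : M_orlicz n Phi u -> M_orlicz n Phi (fun x => a * u x).
Proof.
move=> [mu_ uk]; have mau := leb_measurableZ a mu_; split => // k k0.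
have a10 : 0 < `|a| + 1 by rewrite ltr_wpDl.
have ka0 : 0 < k / (`|a| + 1) by rewrite divr_gt0.
have mau1 := leb_measurableZ (`|a| + 1) mu_.
apply: (@le_lt_trans _ _ (modular Phi (fun x => (`|a| + 1) * u x) k)).
  apply: (le_modular yPhi k0 mau mau1) => x.
  by rewrite !normrM (ger0_norm (ltW a10)) ler_wpM2r// lerDl.
have := uk _ ka0; congr (_ < _)%E; apply: eq_integral => x _; congr (Phi _%:E).
by rewrite normrM (ger0_norm (ltW a10)); field; rewrite !gt_eqF.
Qed.

Lemma M_orlicz_le u v : leb_measurable u -> M_orlicz n Phi v ->
  (forall x, `|u x| <= `|v x|) -> M_orlicz n Phi u.
Proof.
move=> mu_ [mv vk] uv; split => // k k0.
by apply: le_lt_trans (vk k k0); exact: le_modular.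
Qed.

Lemma M_orlicz_bounded_support u (N C : R) : leb_measurable u ->
  (forall x, `|u x| <= C) -> (forall x, ~ box N x -> u x = 0) -> M_orlicz n Phi u.
Proof.
move=> mu_ uC uN; split => // k k0.
have C0 : 0 <= C by apply: le_trans (uC 0).
apply: (modular_bounded_support yPhi mu_ k0 uC uN C0); apply: fPhi.
by rewrite divr_ge0// ltW.
Qed.

(** The step that makes the monotone class argument work: [u_ j] tends to [u]
    in norm, because [|u - u_ j| <= |2 v|] and all the modulars of [2 v] are
    finite. *)
Lemma heat_continuous_dominated (u_ : nat -> 'rV[R]_n -> R) u v :
  (forall j, leb_measurable (u_ j)) -> leb_measurable u -> M_orlicz n Phi v ->
  (forall j x, `|u_ j x| <= `|v x|) ->
  (forall x, u_ ^~ x @ \oo --> u x) ->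
  (forall j, heat_continuous Phi (u_ j)) -> heat_continuous Phi u.
Proof.
move=> mu_ mu0 Mv u_v u_u cu_.
have uv x : `|u x| <= `|v x|.
  have cabs : `|u_ j x| @[j --> \oo] --> `|u x| by apply: cvg_norm; exact: u_u.
  rewrite -(cvg_lim _ cabs)//; apply: limr_le; first by apply/cvg_ex; eexists; exact: cabs.
  by apply: nearW => j; exact: u_v.
have Mu := M_orlicz_le mu0 Mv uv.
apply: (heat_continuous_closure yPhi (M_orlicz_sub Mu)) => e e0.
have M2v := M_orliczZ 2 Mv.
have [j Hj] : exists j, (orlicz_norm (leb n) Phi (u \- u_ j)%R <= e%:E)%E.
  have := M2v.2 e e0.
  apply: (@orlicz_norm_dominated_small _ _ _ (leb n) Phi yPhi (fun j => u \- u_ j) (fun x => 2 * v x) e e0).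
  - by move=> j; exact: leb_measurableB.
  - by case: M2v.
  - move=> j x; apply: le_trans (ler_normB _ _) _.
    by rewrite normrM ger0_norm// mulr_natl mulr2n lerD.
  - move=> x; rewrite -(subrr (u x)); apply: cvgB; last exact: u_u.
    exact: cvg_cst.
by exists (u_ j); split => //; apply: M_orlicz_sub; exact: M_orlicz_le (mu_ j) Mv (u_v j).
Qed.

(** The Lipschitz property for the supremum distance, expressed coordinatewise
    as in [heat_continuous_uniform]. *)
Definition sup_lipschitz (g : 'rV[R]_n -> R) := exists2 L : R, 0 <= L &
  forall (x y : 'rV[R]_n) (d : R), (forall i, `|x 0 i - y 0 i| <= d) -> 0 <= d ->
    `|g x - g y| <= L * d.

(** These sets form a pi-system that generates the Borel sets, and their
    indicators are limits of Lipschitz functions. *)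
Definition level_set (G : set 'rV[R]_n) := exists g : 'rV[R]_n -> R,
  [/\ sup_lipschitz g, measurable_fun setT g & G = [set x | 0 < g x]].

Lemma ler_norm_min (a b a' b' c : R) : `|a - a'| <= c -> `|b - b'| <= c ->
  `|Num.min a b - Num.min a' b'| <= c.
Proof.
rewrite !ler_norml => /andP[? ?] /andP[? ?].
by rewrite !minEle; case: ifPn; case: ifPn; rewrite -?ltNge => ? ?; apply/andP; lra.
Qed.

Lemma sup_lipschitz_min g h : sup_lipschitz g -> sup_lipschitz h ->
  sup_lipschitz (fun x => Num.min (g x) (h x)).
Proof.
move=> [L L0 HL] [M M0 HM]; exists (L + M); first exact: addr_ge0.
move=> x y d xy d0; apply: ler_norm_min.
  by apply: le_trans (HL x y d xy d0) _; rewrite ler_wpM2r// lerDl.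
by apply: le_trans (HM x y d xy d0) _; rewrite ler_wpM2r// lerDr.
Qed.

Lemma sup_lipschitzZ (c : R) g : 0 <= c -> sup_lipschitz g -> sup_lipschitz (fun x => c * g x).
Proof.
move=> c0 [L L0 HL]; exists (c * L); first exact: mulr_ge0.
move=> x y d xy d0; rewrite -mulrBr normrM (ger0_norm c0) -mulrA ler_wpM2l//.
exact: HL.
Qed.

Lemma sup_lipschitz_cst (c : R) : sup_lipschitz (fun=> c).
Proof. by exists 0 => // x y d _ _; rewrite subrr normr0 mul0r. Qed.

Lemma sup_lipschitz_max0 g : sup_lipschitz g -> sup_lipschitz (fun x => Num.max (g x) 0).
Proof.
move=> [L L0 HL]; exists L => // x y d xy d0.
have := HL x y d xy d0; rewrite !ler_norml => /andP[? ?].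
have Ld0 : 0 <= L * d by exact: mulr_ge0.
by rewrite !maxEle; case: ifPn; case: ifPn; rewrite -?ltNge => ? ?; apply/andP; lra.
Qed.

Lemma level_setI : setI_closed level_set.
Proof.
move=> _ _ [g [Lg mg ->]] [h [Lh mh ->]].
exists (fun x => Num.min (g x) (h x)); split.
- exact: sup_lipschitz_min.
- exact: measurable_minr.
- by apply/seteqP; split => x /=; rewrite lt_min => /andP.
Qed.

Lemma measurable_level_set G : level_set G -> measurable G.
Proof.
move=> [g [_ mg ->]].
rewrite (_ : [set x | 0 < g x] = setT `&` g @^-1` `]0, +oo[%classic).
  by apply: mg => //; exact: measurable_itv.
by rewrite setTI; apply/seteqP; split => x /=; rewrite in_itv/= andbT.
Qed.

Lemma measurable_rV_level : @measurable _ 'rV[R]_n = <<s level_set >>.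
Proof.
apply/seteqP; split; last first.
  apply: smallest_sub; first exact: sigma_algebra_measurable.
  by move=> G /measurable_level_set.
apply: smallest_sub; first exact: smallest_sigma_algebra.
rewrite -bigcup_seq => A [i _] [B mB <-] /=; rewrite setTI.
have mf : measurable_fun [set: g_sigma_algebraType level_set]
    ((fun x : 'rV[R]_n => x 0 i) : g_sigma_algebraType level_set -> R).
  apply: (measurability _ (RGenOInfty.measurableE R)) => //.
  move=> _ [_ [a ->] <-]; rewrite setTI; apply: sub_gen_smallest.
  exists (fun x => x 0 i - a); split.
  - exists 1 => // x y d xy d0; rewrite mul1r (_ : x 0 i - a - (y 0 i - a) = x 0 i - y 0 i)//.
    by ring.
  - by apply: measurable_funB => //; exact: measurable_coor.
  - by apply/seteqP; split => x /=; rewrite in_itv/= andbT subr_gt0.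
by have := mf measurableT B mB; rewrite setTI.
Qed.

(** An open ball of the l^1 norm.  It is used rather than a box because it is a
    level set of an explicit function that is both Lipschitz and measurable. *)
Definition diamond (N : R) : set 'rV[R]_n := [set x | 0 < N - \sum_i `|x 0 i|].

Lemma sup_lipschitz_diamond N : sup_lipschitz (fun x => N - \sum_i `|x 0 i|).
Proof.
exists n%:R => // x y d xy d0.
rewrite (_ : N - _ - _ = \sum_i (`|y 0 i| - `|x 0 i|)); last first.
  by rewrite sumrB; ring.
apply: le_trans (ler_norm_sum _ _ _) _.
apply: (@le_trans _ _ (\sum_(i < n) d)).
  apply: ler_sum => i _; apply: le_trans (ler_dist_dist _ _) _.
  by rewrite distrC.
by rewrite sumr_const card_ord mulr_natl.
Qed.

Lemma measurable_diamond_fun N :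
  measurable_fun setT (fun x : 'rV[R]_n => N - \sum_i `|x 0 i|).
Proof.
apply: measurable_funB => //; apply: measurable_sum => i.
by apply: measurableT_comp => //; exact: measurable_coor.
Qed.

Lemma diamond_box N : diamond N `<=` box N.
Proof.
move=> x; rewrite /diamond/= subr_gt0 => /ltW H i; apply: le_trans H.
by rewrite (bigD1 i)//= lerDl sumr_ge0.
Qed.

Lemma measurable_diamond N : measurable (diamond N).
Proof.
apply: measurable_level_set; exists (fun x => N - \sum_i `|x 0 i|); split => //.
  exact: sup_lipschitz_diamond.
exact: measurable_diamond_fun.
Qed.

Lemma indic_le1 d (T : measurableType d) (A : set T) x : `|\1_A x| <= 1 :> R.
Proof. by rewrite indicE; case: (x \in A); rewrite ?normr0 ?normr1. Qed.

Lemma leb_measurable_indic (A : set 'rV[R]_n) : measurable A ->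
  leb_measurable (\1_A : 'rV[R]_n -> R).
Proof. by move=> mA; apply: measurable_fun_borel_leb; exact: measurable_indic. Qed.

Lemma M_orlicz_indic_diamond (E : set 'rV[R]_n) N : measurable E ->
  M_orlicz n Phi (\1_(E `&` diamond N) : 'rV[R]_n -> R).
Proof.
move=> mE; apply: (@M_orlicz_bounded_support _ N 1).
- by apply: leb_measurable_indic; apply: measurableI => //; exact: measurable_diamond.
- by move=> x; exact: indic_le1.
- by move=> x Nx; rewrite indicE memNset// => -[_ /diamond_box].
Qed.

(** If [h] is the positive part of the minimum of [g] and of the function that
    defines the diamond, the indicator of [h > 0] is the limit of the Lipschitz
    functions [min 1 (j h)], all supported in the box. *)
Lemma heat_continuous_level_set G N : level_set G ->
  heat_continuous Phi (\1_(G `&` diamond N) : 'rV[R]_n -> R).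
Proof.
move=> [g [Lg mg ->]].
pose h (x : 'rV[R]_n) := Num.max (Num.min (g x) (N - \sum_i `|x 0 i|)) 0.
have Lh : sup_lipschitz h.
  by apply/sup_lipschitz_max0/sup_lipschitz_min => //; exact: sup_lipschitz_diamond.
have mh : measurable_fun setT h.
  by apply: measurable_maxr => //; apply: measurable_minr => //; exact: measurable_diamond_fun.
have h0 x : 0 <= h x by rewrite le_max lexx orbT.
have hE x : (0 < h x) = (x \in [set x | 0 < g x] `&` diamond N).
  rewrite /h lt_max ltxx orbF lt_min; apply/andP/idP => [[? ?]|].
    by rewrite inE.
  by rewrite inE => -[].
have hN x : ~ box N x -> h x = 0.
  move=> nx; apply/eqP; rewrite eq_le h0 andbT leNgt hE; apply/negP.
  by rewrite inE => -[_ /diamond_box].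
pose v (j : nat) (x : 'rV[R]_n) := Num.min 1 (j%:R * h x).
have v0 j x : 0 <= v j x by rewrite le_min ler01 mulr_ge0.
have v1 j x : v j x <= 1 by rewrite ge_min lexx.
have vE j x : v j x <= \1_(box N) x.
  rewrite indicE; case: (boolP (x \in box N)) => //; rewrite notin_setE => /hN hx.
  by rewrite /v hx mulr0 ge_min lexx orbT.
have mv j : measurable_fun setT (v j).
  by apply: measurable_minr => //; apply: measurable_scale.
have vN j x : ~ box N x -> v j x = 0.
  by move=> nx; rewrite /v hN// mulr0 min_r.
have mlv j : leb_measurable (v j) by exact: measurable_fun_borel_leb.
have vC j x : `|v j x| <= 1 by rewrite ger0_norm.
have mG : measurable ([set x | 0 < g x]) by apply: measurable_level_set; exists g.
apply: (@heat_continuous_dominated v _ (\1_(box N))).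
- exact: mlv.
- by apply: leb_measurable_indic; apply: measurableI => //; exact: measurable_diamond.
- apply: (@M_orlicz_bounded_support _ N 1).
  + exact: leb_measurable_indic_box.
  + by move=> x; exact: indic_le1.
  + by move=> x Nx; rewrite indicE memNset.
- by move=> j x; rewrite !ger0_norm ?indicE.
- move=> x; rewrite indicE -hE; case: (ltP 0 (h x)) => hx.
    apply: cvg_near_cst; near=> j; rewrite /v min_l//.
    rewrite -ler_pdivrMr// mul1r; apply/ltW; near: j.
    exact: nbhs_infty_gtr.
  apply: cvg_near_cst; apply: nearW => j.
  by rewrite /v (_ : h x = 0) ?mulr0 ?min_r//; apply/eqP; rewrite eq_le hx h0.
- move=> j; apply: (heat_continuous_uniform yPhi _ (vN j)).
    exact: (L_orlicz_bounded_support yPhi (mlv j) (vC j) (vN j)).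
  have [L L0 HL] : sup_lipschitz (v j).
    by apply: sup_lipschitz_min; [exact: sup_lipschitz_cst|exact: sup_lipschitzZ].
  move=> e e0; have L10 : 0 < L + 1 by rewrite ltr_wpDl.
  exists (e / (L + 1)); first by rewrite divr_gt0.
  move=> x y xy; apply: le_trans (HL _ _ _ xy _) _; first by rewrite divr_ge0// ltW.
  by rewrite mulrCA ler_piMr ?(ltW e0)// ler_pdivrMr// mul1r lerDl.
Unshelve. all: by end_near. Qed.

(** Dynkin's lemma: the sets for which the statement holds contain the
    pi-system of level sets, are stable under complement by linearity, and
    under countable disjoint unions by linearity and dominated convergence. *)
Lemma heat_continuous_indic (E : set 'rV[R]_n) N : measurable E ->
  heat_continuous Phi (\1_(E `&` diamond N) : 'rV[R]_n -> R).
Proof.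
have LI A : measurable A -> L_orlicz n Phi (\1_(A `&` diamond N) : 'rV[R]_n -> R).
  by move=> mA; apply: M_orlicz_sub; exact: M_orlicz_indic_diamond.
have levelT : level_set setT.
  exists (fun=> 1); split; [exact: sup_lipschitz_cst|by []|].
  by apply/seteqP; split => x //= _; rewrite ltr01.
rewrite measurable_rV_level.
apply: (dynkin_induction measurable_rV_level level_setI
  (P := fun E => heat_continuous Phi (\1_(E `&` diamond N) : 'rV[R]_n -> R))).
- exact: heat_continuous_level_set.
- by move=> G; exact: heat_continuous_level_set.
- move=> S mS cS.
  rewrite (_ : \1_(~` S `&` diamond N) =
      (fun x => -1 * \1_(S `&` diamond N) x + \1_([set: 'rV[R]_n] `&` diamond N) x)).
    apply: heat_continuous_linear; [exact: LI|exact: LI|exact: cS|].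
    exact: heat_continuous_level_set.
  apply/funext => x; rewrite !indicE !in_setI in_setT in_setC.
  by case: (x \in S); case: (x \in diamond N); rewrite /= ?mulr0 ?mulr1 ?addNr ?add0r.
- move=> F mF tF cF.
  pose B m := \big[setU/set0]_(i < m) F i.
  have mB m : measurable (B m) by apply: bigsetU_measurable => i _; exact: mF.
  have cB m : heat_continuous Phi (\1_(B m `&` diamond N) : 'rV[R]_n -> R).
    elim: m => [|m IH].
      rewrite /B big_ord0 set0I indic0; exact: heat_continuous0.
    rewrite (_ : \1_(B m.+1 `&` diamond N) =
        (fun x => 1 * \1_(B m `&` diamond N) x + \1_(F m `&` diamond N) x)).
      apply: heat_continuous_linear; [exact: LI|apply: LI; exact: mF|exact: IH|exact: cF].
    apply/funext => x; rewrite mul1r.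
    have tF' : trivIset (fun i : nat => predT i) F by apply: sub_trivIset tF.
    have BF0 : B m `&` F m = set0.
      exact: (trivIset_bigsetUI (D := predT) tF' isT (leqnn m)).
    rewrite /B big_ord_recr/= -/(B m) !indicE !in_setI in_setU.
    have : x \notin (B m `&` F m) by rewrite BF0 in_set0.
    rewrite in_setI; case: (x \in B m); case: (x \in F m) => //= _;
      by case: (x \in diamond N); rewrite ?addr0 ?add0r.
  have mUF : measurable (\bigcup_k F k) by exact: bigcupT_measurable.
  apply: (@heat_continuous_dominated (fun m => \1_(B m `&` diamond N)) _ (\1_((\bigcup_k F k) `&` diamond N))).
  + by move=> m; case: (LI _ (mB m)).
  + by case: (LI _ mUF).
  + exact: M_orlicz_indic_diamond.
  + move=> m x; rewrite !indicE !in_setI.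
    case: (boolP (x \in B m)) => /= xB; last by rewrite normr0.
    have -> : x \in \bigcup_k F k; last by [].
    move: xB; rewrite !inE /B -bigcup_mkord => -[i _ Fi]; by exists i.
  + move=> x; rewrite indicE; case: (boolP (x \in _)) => xU; last first.
      apply: cvg_near_cst; apply: nearW => m; rewrite indicE memNset// => -[Bx Dx].
      move/negP: xU; apply; apply/mem_set; split => //.
      by move: Bx; rewrite /B -bigcup_mkord => -[i _ Fi]; exists i.
    move: xU; rewrite inE => -[[i _ Fi] Dx].
    apply: cvg_near_cst; near=> m; rewrite indicE mem_set//; split => //.
    rewrite /B -bigcup_mkord; exists i => //=; near: m; exact: nbhs_infty_gt.
  + exact: cB.
Unshelve. all: by end_near. Qed.

Lemma heat_continuous_sum (I : Type) (s : seq I) (F : I -> 'rV[R]_n -> R) (c : I -> R) :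
  (forall i, L_orlicz n Phi (F i) /\ heat_continuous Phi (F i)) ->
  L_orlicz n Phi (fun x => \sum_(i <- s) c i * F i x) /\
  heat_continuous Phi (fun x => \sum_(i <- s) c i * F i x).
Proof.
move=> LF; elim: s => [|i s [IHL IHc]].
  rewrite (_ : (fun x => \sum_(i <- [::]) c i * F i x) = fun=> 0); last first.
    by apply/funext => x; rewrite big_nil.
  split; last exact: heat_continuous0.
  apply: (@L_orlicz_bounded_support _ _ _ _ 0 0 yPhi) => //.
  - by apply: measurable_fun_borel_leb; exact: measurable_cst.
  - by move=> x; rewrite normr0.
rewrite (_ : (fun x => \sum_(i <- i :: s) c i * F i x) =
  (fun x => c i * F i x + \sum_(i <- s) c i * F i x)); last first.
  by apply/funext => x; rewrite big_cons.
have [Li ci] := LF i; split; last exact: heat_continuous_linear.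
have := L_orliczB yPhi IHL (L_orliczZ (- c i) Li).
by congr (L_orlicz n Phi _); apply/funext => x /=; ring.
Qed.

Import HBNNSimple.

(** Simple functions increasing to [u], cut off by larger and larger diamonds,
    are linear combinations of the indicators treated above. *)
Lemma heat_continuous_borel_ge0 u : measurable_fun [set: 'rV[R]_n] u ->
  M_orlicz n Phi u -> (forall x, 0 <= u x) -> heat_continuous Phi u.
Proof.
move=> mu_ Mu u0.
have mEu : measurable_fun [set: 'rV[R]_n] (fun x => (u x)%:E) by exact/measurable_EFinP.
pose f := nnsfun_approx measurableT mEu.
have fu x : f j x @[j --> \oo] --> u x.
  have : (f j x)%:E @[j --> \oo] --> (u x)%:E.
    by apply: cvg_nnsfun_approx => // y _; rewrite lee_fin.
  by move=> /fine_cvgP[].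
have f_le j x : f j x <= u x.
  rewrite -(cvg_lim _ (fu x))//.
  apply: (nondecreasing_cvgn_le (u_ := fun j => f j x)).
    by move=> k l kl; exact/lefP/nd_nnsfun_approx.
  by apply/cvg_ex; exists (u x); exact: fu.
have f0 j x : 0 <= f j x by [].
pose v (j : nat) (x : 'rV[R]_n) := f j x * \1_(diamond j%:R) x.
have mv j : measurable_fun setT (v j).
  by apply: measurable_funM => //; apply: measurable_indic; exact: measurable_diamond.
apply: (@heat_continuous_dominated v u u) => //.
- by move=> j; exact: measurable_fun_borel_leb.
- by case: Mu.
- move=> j x; rewrite /v normrM (ger0_norm (f0 _ _)) (ger0_norm (u0 _)).
  by apply: le_trans (f_le j x); rewrite ler_piMr// indic_le1.
- move=> x; rewrite -[u x]mulr1; apply: cvgM; first exact: fu.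
  apply: cvg_near_cst; near=> j; rewrite indicE mem_set// /diamond/= subr_gt0.
  by near: j; exact: nbhs_infty_gtr.
- move=> j.
  have [c|_] := @heat_continuous_sum _ (finmap.enum_fset (fset_set (range (f j))))
    (fun c => \1_(f j @^-1` [set c] `&` diamond j%:R)) idfun.
    have mc : measurable (f j @^-1` [set c]) by [].
    by split; [apply: M_orlicz_sub; exact: M_orlicz_indic_diamond|exact: heat_continuous_indic].
  congr (heat_continuous Phi _); apply/funext => x.
  rewrite /v fimfunE fsbig_finite//= mulr_suml; apply: eq_bigr => c _.
  by rewrite -mulrA !indicE in_setI -natrM mulnb.
Unshelve. all: by end_near. Qed.

Lemma M_heat_continuous u : M_orlicz n Phi u -> heat_continuous Phi u.
Proof.
move=> Mu; have Lu := M_orlicz_sub Mu; have mu_ := proj1 Lu.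
have [v [mv vu uv]] := leb_ae_borel mu_.
have mlv : leb_measurable v by exact: measurable_fun_borel_leb.
have Mv : M_orlicz n Phi v by exact: M_orlicz_le Mu vu.
have max_hc (w : 'rV[R]_n -> R) : measurable_fun [set: 'rV[R]_n] w -> (forall x, `|w x| = `|v x|) ->
    M_orlicz n Phi (fun x => Num.max (w x) 0) /\
    heat_continuous Phi (fun x => Num.max (w x) 0).
  move=> mw wv; have mw0 : measurable_fun [set: 'rV[R]_n] (fun x => Num.max (w x) 0).
    exact: measurable_maxr.
  have Mw : M_orlicz n Phi (fun x => Num.max (w x) 0).
    apply: (M_orlicz_le _ Mv); first exact: measurable_fun_borel_leb.
    move=> x; rewrite -wv maxEle; case: ifP => _; first by rewrite normr0.
    by [].
  split => //; apply: heat_continuous_borel_ge0 => // x.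
  by rewrite le_max lexx orbT.
have [Mp cp] := max_hc v mv (fun=> erefl).
have [|x|Mn cn] := max_hc (fun x => - v x).
- exact: measurableT_comp.
- by rewrite normrN.
have cv : heat_continuous Phi v.
  rewrite (_ : v = fun x => -1 * Num.max (- v x) 0 + Num.max (v x) 0).
    exact: (heat_continuous_linear (-1) (M_orlicz_sub Mn) (M_orlicz_sub Mp) cn cp).
  apply/funext => x; rewrite !maxEle; case: ifPn; case: ifPn; rewrite -?ltNge; lra.
have uv_small : luxemburg Phi (u \- v)%R = 0%E.
  rewrite luxemburg_leb -(orlicz_norm0 (leb n) yPhi).
  apply: (ae_eq_orlicz_norm yPhi (leb_measurableB mu_ mlv)).
    exact: measurable_cst.
  exact: ae_eq_sub0.
apply: (heat_continuous_closure yPhi Lu) => e e0; exists v; split => //.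
  exact: M_orlicz_sub.
by rewrite uv_small lee_fin ltW.
Qed.

End M_strong_continuity.

(** * Smoothing from L^Phi to L^Psi *)

Lemma le_orlicz_modular2 (R : realType) d (T : measurableType d)
    (mu : {measure set T -> \bar R}) (Phi Psi : \bar R -> \bar R) (u : T -> R) (k l : R) :
  young Phi -> young Psi -> 0 < k -> 0 < l -> measurable_fun setT u ->
  (forall x, (Psi (`|u x| / l)%:E <= Phi (`|u x| / k)%:E)%E) ->
  (orlicz_modular mu Psi u l <= orlicz_modular mu Phi u k)%E.
Proof.
move=> yPhi yPsi k0 l0 mu_ H; apply: ge0_le_integral => //.
- by move=> x _; exact: (young_absk_ge0 yPsi).
- exact: (measurable_young_absk yPsi).
- exact: (measurable_young_absk yPhi).
Qed.

Section smoothing.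
Context {R : realType} (n : nat).
Variables (Phi Psi Theta : \bar R -> \bar R) (beta : R).
Hypotheses (yPhi : young Phi) (yPsi : young Psi) (yTheta : young Theta).
Hypothesis beta01 : 0 < beta < 1.
Hypothesis PhiThetaPsi : forall x : R, 0 <= x ->
  (beta%:E * x%:E * young_inv Psi x%:E <= young_inv Phi x%:E * young_inv Theta x%:E
     <= x%:E * young_inv Psi x%:E)%E.
Implicit Types (u v : 'rV[R]_n -> R) (s t k : R).

Let beta0 : 0 < beta. Proof. by case/andP: beta01. Qed.

(** Let [a_r], [b_r], [c_r] be the values at [r] of the inverses of [Phi], [Psi]
    and [Theta].  As [c_r / r] is nonincreasing, [beta b_s / a_s <= c_s / s <=
    c_r / r <= b_r / a_r].  Now [Phi y <= r] gives [y <= a_r], hence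
    [beta (b_s / a_s) y <= b_r].  Halving makes the inequality strict, which is
    what turns it into [Psi (beta / 2 * (b_s / a_s) * y) <= r]. *)
Lemma young_ratio_mono (r s a b y : R) : 0 < r -> r <= s ->
  young_inv Phi s%:E = a%:E -> young_inv Psi s%:E = b%:E -> 0 < a -> 0 < b ->
  0 <= y -> (Phi y%:E <= r%:E)%E -> (Psi (beta / 2 * (b / a) * y)%:E <= r%:E)%E.
Proof.
move=> r0 rs ea eb a0 b0 y0 yr; have s0 : 0 < s := lt_le_trans r0 rs.
move: y0; rewrite le_eqVlt => /predU1P[<-|y0].
  by rewrite mulr0 (young0 yPsi) lee_fin ltW.
have [ar ar0 ear] := young_inv_gt0 yPhi r0.
have [br br0 ebr] := young_inv_gt0 yPsi r0.
have [cr cr0 ecr] := young_inv_gt0 yTheta r0.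
have [cs cs0 ecs] := young_inv_gt0 yTheta s0.
have := PhiThetaPsi (ltW s0); rewrite ea eb ecs -!EFinM !lee_fin => /andP[Hs _].
have := PhiThetaPsi (ltW r0); rewrite ear ebr ecr -!EFinM !lee_fin => /andP[_ Hr].
have rs01 : 0 < r / s <= 1 by rewrite divr_gt0//= ler_pdivrMr// mul1r.
have := young_inv_scale yTheta s rs01.
rewrite divfK ?gt_eqF// ecs ecr -EFinM lee_fin => Hc.
have := le_young_inv yPhi (ltW y0) yr; rewrite ear lee_fin => yar.
have key : beta * (b / a) * y <= br.
  rewrite -(ler_pM2r r0) (mulrC br).
  apply: le_trans Hr; apply: (@le_trans _ _ (y * cr)); last by rewrite ler_pM2r.
  apply: (@le_trans _ _ (y * (r / s * cs))); last by rewrite ler_pM2l.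
  rewrite (_ : beta * (b / a) * y * r = y * (r / s * (beta * s * b / a))); last first.
    by field; rewrite !gt_eqF.
  rewrite ler_pM2l// ler_pM2l ?divr_gt0// ler_pdivrMr// [leRHS]mulrC.
  exact: Hs.
have pos : 0 < beta * (b / a) * y by rewrite !mulr_gt0// invr_gt0.
apply: (le_of_lt_young_inv yPsi).
- by rewrite !mulr_ge0 ?invr_ge0 ?ltW.
- exact: ltW.
- rewrite ebr lte_fin; apply: lt_le_trans key.
  rewrite (_ : beta / 2 * (b / a) * y = beta * (b / a) * y / 2); last by field; rewrite gt_eqF.
  by rewrite ltr_pdivrMr// ltr_pMr// ltr1n.
Qed.

(** The previous lemma at [r = Phi y], or at all small [r > 0] if [Phi y = 0]. *)
Lemma young_ratio (s a b y : R) : 0 < s ->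
  young_inv Phi s%:E = a%:E -> young_inv Psi s%:E = b%:E -> 0 < a -> 0 < b ->
  0 <= y -> (Phi y%:E <= s%:E)%E -> (Psi (beta / 2 * (b / a) * y)%:E <= Phi y%:E)%E.
Proof.
move=> s0 ea eb a0 b0 y0 ys.
have H r : 0 < r -> r <= s -> (Phi y%:E <= r%:E)%E ->
    (Psi (beta / 2 * (b / a) * y)%:E <= r%:E)%E.
  by move=> r0 rs; exact: (young_ratio_mono r0 rs ea eb a0 b0 y0).
case E : (Phi y%:E) (young_ge0 yPhi y0) ys => [p| |]//.
rewrite !lee_fin le_eqVlt => /predU1P[p0 _|p0 ps]; last by apply: H; rewrite ?E.
rewrite -p0; apply/lee_addgt0Pr => e e0; rewrite add0e.
have m0 : 0 < Num.min e s by rewrite lt_min e0.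
apply: (@le_trans _ _ (Num.min e s)%:E); last by rewrite lee_fin ge_min lexx.
by apply: H => //; [rewrite ge_min lexx orbT|rewrite E -p0 lee_fin ltW].
Qed.

(** If the [Phi]-modular of [u / k] is at most 1, the pointwise bound on
    [S(t) u / k] puts its values in the range where [young_ratio] compares
    [Psi] with [Phi], and the [Phi]-modular of [S(t) u / k] is still at most
    1. *)
Lemma heat_smoothing u t (a b : R) : L_orlicz n Phi u -> 0 < t ->
  young_inv Phi (t `^ (- (n%:R / 2)))%:E = a%:E ->
  young_inv Psi (t `^ (- (n%:R / 2)))%:E = b%:E -> 0 < a -> 0 < b ->
  (luxemburg Psi (heat t u) <= (2 / beta * (a / b))%:E * luxemburg Phi u)%E.
Proof.
move=> Lu t0 ea eb a0 b0; set s := t `^ _ in ea eb *.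
have s0 : 0 < s by exact: powR_gt0.
have c0 : 0 < 2 / beta * (a / b) by rewrite !mulr_gt0// invr_gt0.
rewrite -lee_pdivrMl//; apply: le_ereal_inf_tmp => _ [k [k0 uk] <-].
rewrite lee_pdivrMl// -EFinM; have ck0 := mulr_gt0 c0 k0; apply: luxemburg_le => //.
apply: (@le_trans _ _ (modular Phi (heat t u) k)); last first.
  by apply: le_trans uk; exact: (modular_heat yPhi Lu (ltW t0) k0).
apply: (le_orlicz_modular2 (leb n) yPhi yPsi k0 ck0
  (leb_measurable_heat yPhi Lu (ltW t0))) => x.
have hk0 : 0 <= `|heat t u x| / k by rewrite divr_ge0 ?(ltW k0).
rewrite (_ : _ / (2 / beta * (a / b) * k) = beta / 2 * (b / a) * (`|heat t u x| / k)); last first.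
  by field; rewrite !gt_eqF.
apply: (young_ratio s0 ea eb a0 b0 hk0).
apply: le_trans (heat_pointwise yPhi x Lu t0 k0) _; rewrite -/s.
by rewrite -[leRHS]mule1; apply: lee_wpmul2l => //; rewrite lee_fin ltW.
Qed.

Lemma heat_smoothing_bounded t : 0 < t ->
  bounded_linear_operator (L_orlicz n Phi) (luxemburg Phi)
    (L_orlicz n Psi) (luxemburg Psi) (heat t).
Proof.
move=> t0; have s0 : 0 < t `^ (- (n%:R / 2)) by exact: powR_gt0.
have [a a0 ea] := young_inv_gt0 yPhi s0.
have [b b0 eb] := young_inv_gt0 yPsi s0.
have c0 : 0 < 2 / beta * (a / b) by rewrite !mulr_gt0// invr_gt0.
split.
- move=> u Lu; apply/(L_orliczP yPsi); split.
    exact: (leb_measurable_heat yPhi Lu (ltW t0)).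
  apply: le_lt_trans (heat_smoothing Lu t0 ea eb a0 b0) _.
  have [_ uoo] := (L_orliczP yPhi u).1 Lu.
  by apply: lte_mul_pinfty; rewrite ?lee_fin ?(ltW c0).
- move=> u v Lu Lv uv; rewrite (heat_ae t0 (proj1 Lu) (proj1 Lv) uv); exact: ae_eq_refl.
- by move=> c u v Lu Lv; rewrite (heat_linear yPhi c (ltW t0) Lu Lv); exact: ae_eq_refl.
- by exists (2 / beta * (a / b)) => // u Lu; exact: heat_smoothing.
Qed.

Lemma young_inv_div (Phi1 Phi2 : \bar R -> \bar R) (s a b : R) :
  young_inv Phi1 s%:E = a%:E -> young_inv Phi2 s%:E = b%:E -> 0 < b ->
  (young_inv Phi1 s%:E / young_inv Phi2 s%:E = (a / b)%:E)%E.
Proof. by move=> -> -> b0; rewrite inver gt_eqF// -EFinM. Qed.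

Lemma heat_smoothing_bound : exists2 C : R, 0 < C & forall u t,
  L_orlicz n Phi u -> 0 < t ->
  (luxemburg Psi (heat t u) <=
     C%:E * (young_inv Phi (t `^ (- (n%:R / 2)))%:E
             / young_inv Psi (t `^ (- (n%:R / 2)))%:E) * luxemburg Phi u)%E.
Proof.
exists (2 / beta); first by rewrite divr_gt0.
move=> u t Lu t0; have s0 : 0 < t `^ (- (n%:R / 2)) by exact: powR_gt0.
have [a a0 ea] := young_inv_gt0 yPhi s0.
have [b b0 eb] := young_inv_gt0 yPsi s0.
by rewrite (young_inv_div ea eb)// -EFinM; exact: heat_smoothing.
Qed.

(** [t^(-n/2)] tends to infinity as [t] decreases to 0 because [n] is not 0. *)
Lemma near_powR_pinfty (P : R -> Prop) : (1 <= n)%N ->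
  (\forall s \near +oo, P s) -> \forall t \near 0^'+, P (t `^ (- (n%:R / 2))).
Proof.
move=> n1 [M [_ HM]]; pose M1 := `|M| + 1.
have M10 : 0 < M1 by rewrite ltr_wpDl.
have n0 : 0 < n%:R / 2 :> R by rewrite divr_gt0// ltr0n.
(* The point at which t^(-n/2) takes the value M1. *)
pose d := M1 `^ (- (n%:R / 2)^-1).
have d0 : 0 < d by exact: powR_gt0.
near=> t; have t0 : 0 < t by near: t; exact: nbhs_right_gt.
have td : t < d by near: t; exact: nbhs_right_lt.
apply: HM; apply: (@lt_trans _ _ M1); first by rewrite (le_lt_trans (ler_norm _))// ltrDl.
have -> : M1 = d `^ (- (n%:R / 2)).
  by rewrite /d -powRrM mulrNN mulVf ?gt_eqF// powRr1// ltW.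
rewrite !powRN ltf_pV2 ?posrE ?powR_gt0//.
by apply: gt0_ltr_powR => //; rewrite nnegrE ltW.
Unshelve. all: by end_near. Qed.

(** Near [phi] in [K], write [phi' = (phi' - psi) + psi] with a test function
    [psi] close to [phi].  The smoothing estimate controls the first term
    uniformly in [t]; the second stays bounded in [L^Psi] while the prefactor
    tends to 0.  The near-covering property of compact sets makes the choice
    of [t] uniform in [K]. *)
Lemma heat_smoothing_vanishing : (1 <= n)%N ->
  (young_inv Psi s%:E / young_inv Phi s%:E)%E @[s --> +oo] --> 0%E ->
  forall K : set (orlicz n Phi), K `<=` L0_orlicz n Phi -> compact K ->
  forall e : R, 0 < e ->
    \forall t \near 0^'+, forall phi : orlicz n Phi, K phi ->
      (young_inv Psi (t `^ (- (n%:R / 2)))%:E / young_inv Phi (t `^ (- (n%:R / 2)))%:E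
         * luxemburg Psi (heat t phi) < e%:E)%E.
Proof.
move=> n1 ratio0 K KL0 /compact_near_coveringP cK e e0.
apply: cK => phi Kphi.
(* So that the smoothing constant 2 / beta times 2 e1 is e / 2. *)
pose e1 := e * beta / 8.
have e10 : 0 < e1 by rewrite divr_gt0// mulr_gt0.
have [psi tpsi psi_phi] := L0_orlicz_approx yPhi (KL0 _ Kphi) e10.
have [N psiN] := test_function_support tpsi.
have [C psiC] := test_function_bounded tpsi.
have mpsi := orlicz_leb_measurable psi; have mphi := orlicz_leb_measurable phi.
have LPsi_psi : L_orlicz n Psi psi by exact: (L_orlicz_bounded_support yPsi mpsi psiC psiN).
pose B := fine (luxemburg Psi psi).
have BE : luxemburg Psi psi = B%:E.
  rewrite fineK// ge0_fin_numE ?luxemburg_ge0//.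
  by case: ((L_orliczP yPsi _).1 LPsi_psi).
have B0 : 0 <= B by rewrite fine_ge0// luxemburg_ge0.
have B10 : 0 < B + 1 by rewrite ltr_wpDl.
pose c := e / 4 / (B + 1).
have c0 : 0 < c by rewrite !divr_gt0.
have near_c0 : \forall s \near +oo,
  (young_inv Psi s%:E / young_inv Phi s%:E <= c%:E)%E by exact: cvge0_le.
have near_c := near_powR_pinfty n1 near_c0.
exists ([set phi' : orlicz n Phi | (luxemburg Phi ((phi' : _ -> R) \- phi)%R < e1%:E)%E],
  [set t | 0 < t /\ (young_inv Psi (t `^ (- (n%:R / 2)))%:E /
    young_inv Phi (t `^ (- (n%:R / 2)))%:E <= c%:E)%E]).
  split; first exact: (luxemburg_ball_nbhs yPhi).
  by apply: filterI => //; exact: nbhs_right_gt.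
move=> [phi' t] /= [phi'_phi [t0 tc]].
have s0 : 0 < t `^ (- (n%:R / 2)) by exact: powR_gt0.
have [a a0 ea] := young_inv_gt0 yPhi s0.
have [b b0 eb] := young_inv_gt0 yPsi s0.
rewrite (young_inv_div eb ea a0) lee_fin in tc; rewrite (young_inv_div eb ea a0).
have ba0 : 0 < b / a by rewrite divr_gt0.
have mphi' := orlicz_leb_measurable phi'.
have Lw := L_orliczB yPhi (orliczP phi') (orliczP psi).
have w_small : (luxemburg Phi ((phi' : _ -> R) \- psi)%R <= (2 * e1)%:E)%E.
  rewrite (_ : (phi' : _ -> R) \- psi = ((phi' : _ -> R) \- phi) \- ((psi : _ -> R) \- phi)); last first.
    by apply/funext => x /=; ring.
  apply: le_trans (luxemburgB yPhi (leb_measurableB mphi' mphi) (leb_measurableB mpsi mphi)) _.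
  rewrite (_ : 2 * e1 = e1 + e1); last by ring.
  by rewrite EFinD; apply: leeD; [exact: ltW phi'_phi|exact: ltW psi_phi].
rewrite (_ : heat t phi' = heat t ((phi' : _ -> R) \- psi) \+ heat t psi); last first.
  rewrite (heat_sub yPhi (ltW t0) (orliczP phi') (orliczP psi)).
  by apply/funext => x /=; rewrite subrK.
have mhw := leb_measurable_heat yPhi Lw (ltW t0).
have mhpsi := leb_measurable_heat yPhi (orliczP psi) (ltW t0).
have hw : (luxemburg Psi (heat t ((phi' : _ -> R) \- psi)%R) <= (2 / beta * (a / b) * (2 * e1))%:E)%E.
  apply: le_trans (heat_smoothing Lw t0 ea eb a0 b0) _.
  rewrite [leRHS]EFinM; apply: lee_wpmul2l => //.
  by rewrite lee_fin !mulr_ge0 ?invr_ge0 ?ltW.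
have hpsi : (luxemburg Psi (heat t psi) <= B%:E)%E.
  by rewrite -BE; exact: (luxemburg_heat yPsi LPsi_psi (ltW t0)).
apply: (@le_lt_trans _ _ ((b / a)%:E * (2 / beta * (a / b) * (2 * e1) + B)%:E)%E).
  apply: lee_wpmul2l; first by rewrite lee_fin ltW.
  apply: le_trans (luxemburgD yPsi mhw mhpsi) _.
  by rewrite EFinD; exact: leeD.
rewrite -EFinM lte_fin mulrDr.
have -> : b / a * (2 / beta * (a / b) * (2 * e1)) = e / 2.
  by rewrite /e1; field; rewrite !gt_eqF.
have : b / a * B <= e / 4.
  apply: (@le_trans _ _ (c * B)); first by rewrite ler_wpM2r.
  by rewrite /c mulrAC ler_pdivrMr// ler_wpM2l ?divr_ge0 ?(ltW e0)// lerDl.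
lra.
Qed.

End smoothing.

(** * The heat flow on Orlicz spaces *)

Theorem theoremA (R : realType) (n : nat) (Phi : \bar R -> \bar R) :
  (1 <= n)%N -> young Phi ->
  (* (a) *)
  [/\ (* (i) *)
      [/\ forall (phi : 'rV[R]_n -> R) (t : R) (x : 'rV[R]_n),
            L_orlicz n Phi phi -> 0 < t -> heat_abs_cvg t phi x,
          operator_semigroup (L_orlicz n Phi) (luxemburg Phi) heat
        & forall (phi : 'rV[R]_n -> R) (t : R),
            L_orlicz n Phi phi -> 0 <= t ->
            (luxemburg Phi (heat t phi) <= 2%:E * luxemburg Phi phi)%E],
      (* (ii) *)
      forall phi : orlicz n Phi, L0_orlicz n Phi phi ->
        luxemburg Phi (heat t phi \- phi) @[t --> 0^'+] --> 0%E
    & (* (iii) *)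
      N_function Phi ->
        C0_semigroup (M_orlicz n Phi) (luxemburg Phi) heat /\
        forall (phi : 'rV[R]_n -> R) (t : R),
          M_orlicz n Phi phi -> 0 <= t ->
          (luxemburg Phi (heat t phi) <= 2%:E * luxemburg Phi phi)%E] /\
  (* (b) *)
  forall Psi : \bar R -> \bar R, young Psi ->
    (exists (beta : R) (Theta : \bar R -> \bar R),
      [/\ 0 < beta < 1, young Theta
        & forall x : R, 0 <= x ->
            (beta%:E * x%:E * young_inv Psi x%:E
               <= young_inv Phi x%:E * young_inv Theta x%:E
               <= x%:E * young_inv Psi x%:E)%E]) ->
    (* (i) *)
    ((forall t : R, 0 < t ->
        bounded_linear_operator (L_orlicz n Phi) (luxemburg Phi)
          (L_orlicz n Psi) (luxemburg Psi) (heat t)) /\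
     exists2 C : R, 0 < C &
       forall (phi : 'rV[R]_n -> R) (t : R), L_orlicz n Phi phi -> 0 < t ->
         (luxemburg Psi (heat t phi) <=
            C%:E * (young_inv Phi (t `^ (- (n%:R / 2)))%:E
                    / young_inv Psi (t `^ (- (n%:R / 2)))%:E)
            * luxemburg Phi phi)%E) /\
    (* (ii) *)
    ((young_inv Psi s%:E / young_inv Phi s%:E)%E @[s --> +oo] --> 0%E ->
     forall K : set (orlicz n Phi), K `<=` L0_orlicz n Phi -> compact K ->
       forall e : R, 0 < e ->
         \forall t \near 0^'+, forall phi : orlicz n Phi, K phi ->
           (young_inv Psi (t `^ (- (n%:R / 2)))%:E
              / young_inv Phi (t `^ (- (n%:R / 2)))%:E
            * luxemburg Psi (heat t phi) < e%:E)%E).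
Proof.
move=> n1 yPhi.
have le2 u t : L_orlicz n Phi u -> 0 <= t ->
    (luxemburg Phi (heat t u) <= 2%:E * luxemburg Phi u)%E.
  move=> Lu t0; apply: le_trans (luxemburg_heat yPhi Lu t0) _.
  rewrite -[leLHS]mul1e; apply: lee_wpmul2r; first exact: luxemburg_ge0.
  by rewrite lee_fin ler1n.
split.
  split.
  - split; last exact: le2.
    + by move=> phi t x; exact: orlicz_heat_abs_cvg.
    + apply: (heat_operator_semigroup yPhi); first exact: subset_refl.
      by move=> u t; exact: L_orlicz_heat.
  - move=> phi Lphi; apply: heat_continuous_cvg; exact: L0_heat_continuous.
  - move=> [[_ [[finPhi _ _] _]] _ _ _].
    have fPhi x : 0 <= x -> (Phi x%:E < +oo)%E.
      move=> x0; have : Phi x%:E \is a fin_num by apply: finPhi; rewrite /= in_itv/= x0.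
      by rewrite fin_numE => /andP[_]; rewrite ltey.
    split; last by move=> phi t /M_orlicz_sub; exact: le2.
    split.
      apply: (heat_operator_semigroup yPhi); first exact: M_orlicz_sub.
      by move=> u t; exact: M_orlicz_heat.
    by move=> u Mu; apply: heat_continuous_cvg; exact: M_heat_continuous.
move=> Psi yPsi [beta [Th [beta01 yTh PTP]]].
split; last exact: (heat_smoothing_vanishing yPhi yPsi yTh beta01 PTP n1).
split; last exact: (heat_smoothing_bound n yPhi yPsi yTh beta01 PTP).
by move=> t; exact: (heat_smoothing_bounded n yPhi yPsi yTh beta01 PTP).
Qed.
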